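(* Let $P\subset\mathbb{R}^d$ be a closed convex cone with $P-P=\mathbb{R}^d$ and $P\cap(-P)=\{0\}$. Let $(Y,\mathcal{B})$ be a measurable space with $\mathcal{B}$ countably generated, on which $\mathbb{R}^d$ acts measurably, let $\lambda$ be an $\mathbb{R}^d$-invariant $\sigma$-finite measure on $Y$, and let $X\in\mathcal{B}$ satisfy $X+a\subset X$ for all $a\in P$ and $\bigcap_{a\in P}(X+a)=\emptyset$. Let $\eta$ be a Poisson process on $Y$ with intensity measure $\lambda$, realised on $(\Omega,\mathcal{F},\mathbb{P})$, where $\mathcal{F}$ is generated by $\{\eta(B):B\in\mathcal{B}\}$. For $a\in P$ let $\mathcal{F}_a$ be the $\sigma$-algebra generated by $\{\eta(B): B\in\mathcal{B},\ B\subset X\setminus(X+a)\}$. Then the set $$E=\{(a,f): a\in P,\ f\in L^2(\Omega,\mathcal{F}_a,\mathbb{P})\},$$ with the measurable structure inherited from $P\times L^2(\Omega,\mathcal{F},\mathbb{P})$, the projection $p(a,f)=a$, and the product $$(a,f)(b,g)=(a+b,\,f\,S_a(g)),$$ where $S_a$ denotes the shift unitary, is a product system over $P$.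
   Context: All probability spaces are complete and all sub-$\sigma$-algebras are complete (they contain every set that agrees with one of their members up to a null set); ''generated by random variables'' means the smallest complete $\sigma$-algebra making them measurable. For $a,b\in P$, $a\le b$ means $b-a\in P$. The action of $\mathbb{R}^d$ on $Y$ is written additively. Poisson process: with $\overline{\mathbb{N}}=\{0,1,2,\dots\}\cup\{\infty\}$, a point process on $Y$ is a measurable map $\eta$ from $\Omega$ to the set of $\overline{\mathbb{N}}$-valued $\sigma$-finite measures on $Y$ (with the smallest $\sigma$-algebra making each $\mu\mapsto\mu(B)$ measurable). It is a Poisson process with intensity measure $\lambda$ if $\eta(B)$ is Poisson distributed with parameter $\lambda(B)$ for every $B\in\mathcal{B}$ (with $\eta(B)=\infty$ a.s. if $\lambda(B)=\infty$), and $\eta(B_1),\dots,\eta(B_n)$ are independent whenever $B_1,\dots,B_n\in\mathcal{B}$ are pairwise disjoint. Shift unitaries: for $a\le b$ in $P$ let $\mathcal{F}_{a,b}$ be the $\sigma$-algebra generated by $\{\eta(B): B\in\mathcal{B},\ B\subset (X+a)\setminus(X+b)\}$, so $\mathcal{F}_a=\mathcal{F}_{0,a}$. By stationarity of $\eta$, for $c\in P$ there is a unique unitary $S_c:L^2(\Omega,\mathcal{F}_{a,b},\mathbb{P})\to L^2(\Omega,\mathcal{F}_{a+c,b+c},\mathbb{P})$ with $S_c\big(f(\eta(B_1),\dots,\eta(B_n))\big)=f(\eta(B_1+c),\dots,\eta(B_n+c))$ for measurable $B_i\subset(X+a)\setminus(X+b)$ and measurable $f$ for which the left-hand argument is square integrable.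 Product system over $P$: a standard Borel space $E$ with a measurable surjection $p:E\to P$ such that (i) each fibre $E(a)=p^{-1}(a)$ is a non-zero separable Hilbert space; (ii) there is a measurable associative multiplication $E\times E\to E$ with $E(a)E(b)\subset E(a+b)$ and, for all $a,b\in P$, the map $u\otimes v\mapsto uv$ extends to a unitary $E(a)\otimes E(b)\to E(a+b)$; (iii) with $\Gamma$ the set of measurable maps $s:P\to E$ with $s(a)\in E(a)$ for all $a$, the pair $(E,\Gamma)$ is a measurable field of Hilbert spaces, i.e. $\Gamma$ is a vector space, $a\mapsto\langle s(a)|t(a)\rangle$ is measurable for $s,t\in\Gamma$, any section $t$ such that $a\mapsto\langle t(a)|s(a)\rangle$ is measurable for every $s\in\Gamma$ lies in $\Gamma$, and there is a sequence $(s_n)$ in $\Gamma$ such that $\{s_n(a)\}_n$ is total in $E(a)$ for every $a\in P$. *)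

(* Defs.v *)
From HB Require Import structures.
From mathcomp Require Import all_boot all_order all_algebra complex.
From mathcomp Require Import all_classical all_reals all_analysis.
From mathcomp Require Import measurable_realfun ring lra.
Set Implicit Arguments.
Unset Strict Implicit.
Unset Printing Implicit Defensive.
Import Order.TTheory GRing.Theory Num.Theory.
Import numFieldNormedType.Exports.
Local Open Scope classical_set_scope.
Local Open Scope ring_scope.
Local Open Scope complex_scope.

Local Notation reC := (@complex.Re _).
Local Notation imC := (@complex.Im _).

Section ComplexMeasurable.
Variable R : realType.

HB.instance Definition _ := isPointed.Build R[i] 0.

(* Borel structure of the complex plane, via R[i] = R x R. *)
Definition complex_pair (z : R[i]) : R * R := (reC z, imC z).
HB.instance Definition _ :=
  Measurable.copy R[i] (g_sigma_algebra_preimageType complex_pair).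

Lemma measurable_complexP d (T : measurableType d) (f : T -> R[i]) :
  measurable_fun setT f <->
  measurable_fun setT (reC \o f) /\ measurable_fun setT (imC \o f).
Proof.
split=> [mf|[mr mi]].
  split=> mD B mB.
    have := mf mD (reC @^-1` B).
    rewrite -comp_preimage; apply; exists (fst @^-1` B) => //.
      by rewrite -[X in measurable X]setTI; exact: measurable_fst.
    by rewrite setTI.
  have := mf mD (imC @^-1` B).
  rewrite -comp_preimage; apply; exists (snd @^-1` B) => //.
    by rewrite -[X in measurable X]setTI; exact: measurable_snd.
  by rewrite setTI.
have mp : measurable_fun setT (complex_pair \o f) by exact: measurable_fun_pair.
by move=> mD _ [B mB <-]; rewrite setTI -comp_preimage; exact: mp.
Qed.

Lemma measurable_complexD d (T : measurableType d) (f g : T -> R[i]) :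
  measurable_fun setT f -> measurable_fun setT g ->
  measurable_fun setT (fun x => f x + g x).
Proof.
move=> /measurable_complexP[fr fi] /measurable_complexP[gr gi].
apply/measurable_complexP; split.
  rewrite (_ : _ \o _ = (reC \o f) \+ (reC \o g)).
    exact: measurable_funD.
  by apply/funext => x /=; case: (f x) => ? ?; case: (g x).
rewrite (_ : _ \o _ = (imC \o f) \+ (imC \o g)).
  exact: measurable_funD.
by apply/funext => x /=; case: (f x) => ? ?; case: (g x).
Qed.

Lemma measurable_complexZ d (T : measurableType d) (k : R[i]) (f : T -> R[i]) :
  measurable_fun setT f -> measurable_fun setT (fun x => k * f x).
Proof.
move=> /measurable_complexP[fr fi]; case: k => a b.
apply/measurable_complexP; split.
  rewrite (_ : _ \o _ = (cst a \* (reC \o f)) \- (cst b \* (imC \o f))).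
    by apply: measurable_funB; apply: measurable_funM.
  by apply/funext => x /=; case: (f x).
rewrite (_ : _ \o _ = (cst a \* (imC \o f)) \+ (cst b \* (reC \o f))).
  by apply: measurable_funD; apply: measurable_funM.
by apply/funext => x /=; case: (f x).
Qed.

End ComplexMeasurable.

Section L0.
Context (R : realType) d (T : measurableType d).
Variable mu : {measure set T -> \bar R}.
Definition L0 : Type := {mfun_ mu, T >-> R[i]}.
HB.instance Definition _ := Choice.on L0.

Definition L0fun (u : L0) : T -> R[i] := repr u.
Coercion L0fun : L0 >-> Funclass.

Lemma measurable_L0 (u : L0) : measurable_fun setT u.
Proof. exact: measurable_funPT. Qed.

Definition L0cls (f : T -> R[i]) (mf : measurable_fun setT f) : L0 :=
  (\pi_({mfun_ mu, T >-> R[i]}) (mfun_Sub (mem_set mf)))%qT.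

Lemma L0P (u v : L0) : u = v <-> (u = v %[ae mu]).
Proof.
split=> [->|uv]; first exact: ae_eq_refl.
rewrite -(reprK u) -(reprK v).
apply/eqmodP/asboolP; exact: uv.
Qed.

Lemma L0clsE f (mf : measurable_fun setT f) : L0cls mf = f %[ae mu].
Proof.
have /eqmodP h := reprK (L0cls mf).
by move/asboolP : h.
Qed.

Let mD (u v : L0) := measurable_complexD (measurable_L0 u) (measurable_L0 v).
Let mZ k (u : L0) := measurable_complexZ k (measurable_L0 u).
Let m0 : measurable_fun setT (cst 0 : T -> R[i]) := measurable_cst (0 : R[i]).

Definition L0add (u v : L0) : L0 := L0cls (mD u v).
Definition L0scale k (u : L0) : L0 := L0cls (mZ k u).
Definition L0zero : L0 := L0cls m0.

Let L0addE u v : L0add u v = (fun x => u x + v x) %[ae mu].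
Proof. exact: L0clsE. Qed.

Let L0scaleE k u : L0scale k u = (fun x => k * u x) %[ae mu].
Proof. exact: L0clsE. Qed.

Let L0zeroE : L0zero = cst 0 %[ae mu].
Proof. exact: L0clsE. Qed.

Let addA : associative L0add.
Proof.
move=> u v w; apply/L0P.
apply: filterS (filterI (L0addE u (L0add v w))
  (filterI (L0addE v w)
  (filterI (L0addE (L0add u v) w)
  (L0addE u v)))).
by move=> x [a [b [c e]]] _; rewrite a// b// c// e// addrA.
Qed.

Let addC : commutative L0add.
Proof.
move=> u v; apply/L0P; apply: filterS (filterI (L0addE u v)
  (L0addE v u)).
by move=> x [a b] _; rewrite a// b// addrC.
Qed.

Let add0 : left_id L0zero L0add.
Proof.
move=> u; apply/L0P; apply: filterS (filterI (L0addE L0zero u)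
  (L0zeroE)).
by move=> x [a b] _; rewrite a// b// add0r.
Qed.

Let addN : left_inverse L0zero (L0scale (-1)) L0add.
Proof.
move=> u; apply/L0P.
apply: filterS (filterI (L0addE (L0scale (-1) u) u)
  (filterI (L0zeroE)
  (L0scaleE (-1) u))).
by move=> x [a [b c]] _; rewrite a// b// c// mulN1r addNr.
Qed.

HB.instance Definition _ := GRing.isZmodule.Build L0 addA addC add0 addN.

Let scaleA k l u : L0scale k (L0scale l u) = L0scale (k * l) u.
Proof.
apply/L0P; apply: filterS (filterI (L0scaleE k (L0scale l u))
  (filterI (L0scaleE l u)
  (L0scaleE (k * l) u))).
by move=> x [a [b c]] _; rewrite a// b// c// mulrA.
Qed.

Let scale1 : left_id 1 L0scale.
Proof.
move=> u; apply/L0P; apply: filterS (L0scaleE 1 u).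
by move=> x a _; rewrite a// mul1r.
Qed.

Let scaleDr : right_distributive L0scale +%R.
Proof.
move=> k u v; apply/L0P.
apply: filterS (filterI (L0scaleE k (L0add u v))
  (filterI (L0addE u v)
  (filterI (L0addE (L0scale k u) (L0scale k v))
  (filterI (L0scaleE k u)
  (L0scaleE k v))))).
by move=> x [a [b [c [e f]]]] _; rewrite a// b// c// e// f// mulrDr.
Qed.

Let scaleDl u : {morph L0scale^~ u : k l / k + l}.
Proof.
move=> k l; apply/L0P.
apply: filterS (filterI (L0scaleE (k + l) u)
  (filterI (L0addE (L0scale k u) (L0scale l u))
  (filterI (L0scaleE k u)
  (L0scaleE l u)))).
by move=> x [a [b [c e]]] _; rewrite a// b// c// e// mulrDl.
Qed.

HB.instance Definition _ := GRing.Zmodule_isLmodule.Build R[i] L0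
  scaleA scale1 scaleDr scaleDl.

Lemma L0_add (u v : L0) : L0fun (u + v) = (fun x => u x + v x) %[ae mu].
Proof. exact: L0addE. Qed.

Lemma L0_scale k (u : L0) : L0fun (k *: u) = (fun x => k * u x) %[ae mu].
Proof. exact: L0scaleE. Qed.

Lemma L0_zero : L0fun 0 = cst 0 %[ae mu].
Proof. exact: L0zeroE. Qed.

End L0.

Section L2.
Context (R : realType) d (T : measurableType d).
Variable mu : {measure set T -> \bar R}.

Definition sqmod (z : R[i]) : R := reC z ^+ 2 + imC z ^+ 2.

Definition sq_integrable : {pred L0 mu} :=
  [pred u : L0 mu | (\int[mu]_x (sqmod (u x))%:E < +oo)%E].

Let sqmod_ge0 z : 0 <= sqmod z.
Proof. by rewrite addr_ge0 ?sqr_ge0. Qed.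

Let measurable_sqmod (f : T -> R[i]) : measurable_fun setT f ->
  measurable_fun setT (fun x => (sqmod (f x))%:E).
Proof.
move=> /measurable_complexP[mr mi]; apply/measurable_EFinP.
by apply: measurable_funD; apply: measurable_funX.
Qed.

Lemma sq_integrableP (f : T -> R[i]) (u : L0 mu) : measurable_fun setT f ->
  u = f %[ae mu] ->
  (u \in sq_integrable) = (\int[mu]_x (sqmod (f x))%:E < +oo)%E.
Proof.
move=> mf uf; rewrite inE; congr (_ < _)%E.
apply: ge0_ae_eq_integral => //.
- exact/measurable_sqmod/measurable_L0.
- by apply: measurable_sqmod.
- by move=> x _; rewrite lee_fin.
- by move=> x _; rewrite lee_fin.
- by apply: filterS uf => x h _; rewrite h.
Qed.

Let sqmodD a b : sqmod (a + b) <= 2 * sqmod a + 2 * sqmod b.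
Proof.
case: a b => [a a'] [b b']; rewrite -subr_ge0 /sqmod/=.
rewrite [leRHS](_ : _ = (a - b) ^+ 2 + (a' - b') ^+ 2); last by ring.
by rewrite addr_ge0 ?sqr_ge0.
Qed.

Let sqmodM a b : sqmod (a * b) = sqmod a * sqmod b.
Proof. by case: a b => [a a'] [b b']; rewrite /sqmod/=; ring. Qed.

Lemma sq_integrable_submod_closed : submod_closed sq_integrable.
Proof.
have mS u : measurable_fun setT (fun x => (sqmod ((u : L0 mu) x))%:E).
  exact/measurable_sqmod/measurable_L0.
split=> [|k u v uL vL].
  rewrite (sq_integrableP _ (L0_zero mu))//.
  by rewrite integral0_eq// => x _; rewrite /sqmod/= !expr0n/= addr0.
have mku := measurable_complexZ k (measurable_L0 u).
have m : measurable_fun setT (fun x => k * L0fun u x + L0fun v x).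
  exact: measurable_complexD (measurable_L0 v).
rewrite (sq_integrableP m); last first.
  apply: filterS (filterI (L0_add (k *: u) v) (L0_scale k u)).
  by move=> x [a b] _; rewrite a// b.
have c0 : 0 <= 2 * sqmod k by rewrite mulr_ge0.
apply: (@le_lt_trans _ _ (\int[mu]_x ((2 * sqmod k)%:E * (sqmod (L0fun u x))%:E
   + 2%:E * (sqmod (L0fun v x))%:E))%E).
  apply: ge0_le_integral => //.
  - by move=> x _; rewrite lee_fin.
  - exact: measurable_sqmod m.
  - by apply: emeasurable_funD; apply: measurable_funeM.
  - move=> x _; rewrite -!EFinM -EFinD lee_fin (le_trans (sqmodD _ _))//.
    by rewrite sqmodM mulrA.
rewrite ge0_integralD//=.
- rewrite !ge0_integralZl_EFin//; last 2 first.
  + by move=> x _; rewrite lee_fin.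
  + by move=> x _; rewrite lee_fin.
  by rewrite lte_add_pinfty// lte_mul_pinfty// lee_fin.
- by move=> x _; rewrite -EFinM lee_fin mulr_ge0.
- exact: measurable_funeM.
- by move=> x _; rewrite -EFinM lee_fin mulr_ge0.
- exact: measurable_funeM.
Qed.

HB.instance Definition _ := GRing.isSubmodClosed.Build R[i] (L0 mu)
  sq_integrable sq_integrable_submod_closed.

Record L2 := MkL2 { L2val :> L0 mu ; L2P : L2val \in sq_integrable }.
HB.instance Definition _ := [isSub of L2 for L2val].
HB.instance Definition _ := [Choice of L2 by <:].
HB.instance Definition _ := [SubChoice_isSubLmodule of L2 by <:].

(* Linear in the first argument, conjugate-linear in the second. *)
Definition L2ip (u v : L2) : R[i] :=
  let h x := u x * (v x)^* in
  (\int[mu]_x reC (h x)) +i* (\int[mu]_x imC (h x)).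

(* L^2 of a sub-sigma-algebra G: the classes having a G-measurable
   representative. *)
Variable G : set (set T).
Definition G_measurable : {pred L2} :=
  [pred u : L2 | `[< exists2 f : T -> R[i],
    measurable_fun setT (f : g_sigma_algebraType G -> R[i]) &
    u = f %[ae mu] >] ].

Lemma G_measurable_submod_closed : submod_closed G_measurable.
Proof.
split=> [|k u v]; rewrite !inE.
  exists (cst 0); first exact: measurable_cst.
  exact: L0_zero.
move=> -[f mf uf] [g mg vg].
exists (fun x => k * f x + g x).
  apply: measurable_complexD => //; exact: measurable_complexZ.
apply: filterS (filterI (L0_add (k *: L2val u) (L2val v))
  (filterI (L0_scale k (L2val u)) (filterI uf vg))).
by move=> x [a [b [c e]]] _; rewrite a// b// c// e.
Qed.

HB.instance Definition _ := GRing.isSubmodClosed.Build R[i] L2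
  G_measurable G_measurable_submod_closed.
Record L2sub := MkL2sub { L2sub_val :> L2 ; L2subP : L2sub_val \in G_measurable }.
HB.instance Definition _ := [isSub of L2sub for L2sub_val].
HB.instance Definition _ := [Choice of L2sub by <:].
HB.instance Definition _ := [SubChoice_isSubLmodule of L2sub by <:].

End L2.

HB.instance Definition _ (R : realType) d (T : measurableType d)
  (mu : {measure set T -> \bar R}) := isPointed.Build (L2 mu) 0.

Section InnerProductSpace.
Context (R : realType) (V : lmodType R[i]).
Variable ip : V -> V -> R[i].

Definition ip_norm (u : V) : R := Num.sqrt (reC (ip u u)).

Definition ip_complete := forall u : nat -> V,
  (forall e, 0 < e -> exists N, forall i j, (N <= i)%N -> (N <= j)%N ->
     ip_norm (u i - u j) < e) ->
  exists l, forall e, 0 < e -> exists N, forall i, (N <= i)%N ->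
    ip_norm (u i - l) < e.

Definition is_hilbert :=
  (exists phi : {dot V for Num.conj}, ip = phi :> (V -> V -> R[i])) /\
  ip_complete.

Definition ip_open (U : set V) := forall u, U u ->
  exists2 e, 0 < e & forall v, ip_norm (v - u) < e -> U v.

Definition ip_dense (A : set V) := forall u e, 0 < e ->
  exists2 v, A v & ip_norm (u - v) < e.

Definition ip_separable := exists2 A : set V, countable A & ip_dense A.

Definition lin_span (A : set V) : set V :=
  [set u | exists (m : nat) (k : 'I_m -> R[i]) (w : 'I_m -> V),
     (forall i, A (w i)) /\ u = \sum_i k i *: w i].

Definition ip_total (A : set V) := ip_dense (lin_span A).

End InnerProductSpace.

Definition is_unitary_on (R : realType) (V W : lmodType R[i])
    (ipV : V -> V -> R[i]) (ipW : W -> W -> R[i]) (A : set V) (B : set W)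
    (U : V -> W) :=
  [/\ forall k u v, A u -> A v -> U (k *: u + v) = k *: U u + U v,
      forall u v, A u -> A v -> ipW (U u) (U v) = ipV u v &
      U @` A = B].

(* (T, tau) is a Hilbert space tensor product of V and W; it is determined up to
   a unique unitary compatible with tau. *)
Definition is_hilbert_tensor (R : realType) (V W T : lmodType R[i])
    (ipV : V -> V -> R[i]) (ipW : W -> W -> R[i]) (ipT : T -> T -> R[i])
    (tau : {bilinear V -> W -> T}) :=
  [/\ is_hilbert ipT,
      forall v v' w w', ipT (tau v w) (tau v' w') = ipV v v' * ipW w w' &
      ip_total ipT [set t | exists v w, t = tau v w]].

(* A standard Borel space is isomorphic to a Borel subset of a Polish space. *)
Definition standard_borel (R : realType) d (T : measurableType d) :=
  exists (S : completePseudoMetricType R) (f : T -> S),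
    [/\ hausdorff_space S,
        exists2 D : set S, countable D & dense D,
        injective f,
        <<s @open S >> (range f) &
        forall A : set T, measurable A <->
          exists2 B, <<s @open S >> B & A = f @^-1` B].

Section Cone.
Context (R : realType) (n : nat).

Definition borelRV := g_sigma_algebraType (@open 'rV[R]_n).

Record closedConvexCone := ClosedConvexCone {
  cone_set :> set 'rV[R]_n ;
  cone_nonempty : cone_set !=set0 ;
  cone_closed : closed cone_set ;
  cone_convex : convex_set (cone_set : set (convex_lmodType 'rV[R]_n)) ;
  coneZ : forall (t : R) x, 0 <= t -> cone_set x -> cone_set (t *: x) }.

Variable P : closedConvexCone.

Lemma cone0 : cone_set P 0.
Proof. by have [x Px] := cone_nonempty P; rewrite -(scale0r x); exact: coneZ. Qed.

Lemma coneD x y : cone_set P x -> cone_set P y -> cone_set P (x + y).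
Proof.
move=> Px Py.
have h0 : 0 <= 2^-1 :> R by rewrite invr_ge0.
have h1 : 2^-1 <= 1 :> R by lra.
have := cone_convex (Itv01 h0 h1) (mem_set Px) (mem_set Py).
move=> /set_mem/(coneZ (ler0n R 2)); congr (cone_set P _).
rewrite scalerDr !scalerA /= mulrBr mulr1 divff// scale1r.
by rewrite [2 - 1](_ : _ = 1) ?scale1r//; ring.
Qed.

Definition conePt : Type := set_type P.
HB.instance Definition _ := Choice.on conePt.
HB.instance Definition _ := isPointed.Build conePt (exist _ 0 (mem_set cone0)).

Definition cone_val (a : conePt) : borelRV := val a.
HB.instance Definition _ :=
  Measurable.copy conePt (g_sigma_algebra_preimageType cone_val).

Definition cone_add (a b : conePt) : conePt :=
  exist _ (val a + val b)
    (mem_set (coneD (set_mem (valP a)) (set_mem (valP b)))).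

End Cone.

Section ProductSystem.
Context (R : realType) (n : nat) (P : closedConvexCone R n).
Context (d : measure_display) (E : measurableType d).
(* The Hilbert space structure of the fibre over a is presented by a Hilbert
   space H a together with a bijection emb of H a onto that fibre. *)
Variable p : E -> conePt P.
Variables (H : conePt P -> lmodType R[i]) (ip : forall a, H a -> H a -> R[i]).
Variable emb : forall a, H a -> E.
Variable mul : E -> E -> E.

Definition measurable_section (s : forall a, H a) :=
  measurable_fun setT (fun a => emb (s a)).

Record is_measurable_field : Prop := {
  field0 : measurable_section (fun=> 0) ;
  fieldD : forall s t, measurable_section s -> measurable_section t ->
    measurable_section (fun a => s a + t a) ;
  fieldZ : forall (k : R[i]) s, measurable_section s ->
    measurable_section (fun a => k *: s a) ;
  field_ip : forall s t, measurable_section s -> measurable_section t ->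
    measurable_fun setT (fun a => ip (s a) (t a)) ;
  field_saturated : forall t,
    (forall s, measurable_section s ->
       measurable_fun setT (fun a => ip (t a) (s a))) ->
    measurable_section t ;
  field_total : exists s : nat -> forall a, H a,
    (forall i, measurable_section (s i)) /\
    (forall a, ip_total (@ip a) (range (fun i => s i a))) }.

Record is_product_system : Prop := {
  ps_standard : standard_borel R E ;
  ps_measurable : measurable_fun setT p ;
  ps_surj : range p = setT ;
  ps_fibre : forall a, set_bij setT (p @^-1` [set a]) (@emb a) ;
  ps_hilbert : forall a, is_hilbert (@ip a) ;
  ps_separable : forall a, ip_separable (@ip a) ;
  ps_nonzero : forall a, exists u : H a, u != 0 ;
  ps_mul_measurable : measurable_fun setT (fun x : E * E => mul x.1 x.2) ;
  ps_mulA : associative mul ;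
  ps_mul_fibre : forall x y, p (mul x y) = cone_add (p x) (p y) ;
  ps_mul_unitary : forall a b : conePt P,
    exists (T : lmodType R[i]) (ipT : T -> T -> R[i])
           (tau : {bilinear H a -> H b -> T}) (U : T -> H (cone_add a b)),
    [/\ is_hilbert_tensor (@ip a) (@ip b) ipT tau,
        is_unitary_on ipT (@ip (cone_add a b)) setT setT U &
        forall u v, emb (U (tau u v)) = mul (emb u) (emb v)] ;
  ps_field : is_measurable_field }.

End ProductSystem.

Definition countably_generated d (T : measurableType d) :=
  exists2 G : set (set T), countable G & @measurable _ T = <<s G >>.

Section Action.
Context (R : realType) (n : nat) d (Y : measurableType d).
Variable act : Y -> 'rV[R]_n -> Y.

Record is_measurable_action : Prop := {
  act0 : forall y, act y 0 = y ;
  actD : forall y a b, act y (a + b) = act (act y a) b ;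
  act_measurable : measurable_fun setT (fun z : Y * borelRV R n => act z.1 z.2) }.

Definition translate (B : set Y) (a : 'rV[R]_n) : set Y := [set act y a | y in B].

End Action.

Section Poisson.
Context (R : realType) dO (Omega : measurableType dO) (Pr : probability Omega R).
Context dY (Y : measurableType dY).

(* The product rule for subfamilies is the case V i = setT. *)
Definition mutually_independent (m : nat) (Z : 'I_m -> Omega -> \bar R) :=
  forall V : 'I_m -> set (\bar R), (forall i, measurable (V i)) ->
    Pr (\bigcap_i (Z i @^-1` V i)) = (\prod_i Pr (Z i @^-1` V i))%E.

(* A sigma-finite kernel is a measurable map into the sigma-finite measures on Y
   for the sigma-algebra generated by the evaluations. The mass function is
   written out because poisson_pmf is constantly 1 at rate 0. *)
Record is_poisson_process (lambda : {measure set Y -> \bar R})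
    (eta : R.-sigmafker Omega ~> Y) : Prop := {
  poisson_nat : forall w B, measurable B ->
    (exists k : nat, eta w B = k%:R%:E) \/ eta w B = +oo%E ;
  poisson_law : forall B, measurable B -> (lambda B < +oo)%E ->
    forall k : nat, let r := fine (lambda B) in
    Pr [set w | eta w B = k%:R%:E] = (r ^+ k / k`!%:R * expR (- r))%:E ;
  poisson_infty : forall B, measurable B -> lambda B = +oo%E ->
    {ae Pr, forall w, eta w B = +oo%E} ;
  poisson_indep : forall (m : nat) (B : 'I_m -> set Y),
    (forall i, measurable (B i)) -> trivIset setT B ->
    mutually_independent (fun i w => eta w (B i)) }.

Definition complete_sub_sigma_algebra (G : set (set Omega)) :=
  [/\ sigma_algebra setT G, G `<=` measurable &
      forall A B, G B -> Pr.-negligible (A `+` B) -> G A].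

Variable eta : R.-sigmafker Omega ~> Y.

Definition sigma_eta (A : set Y) : set (set Omega) :=
  smallest complete_sub_sigma_algebra
    [set D | exists B V, [/\ measurable B, B `<=` A, measurable V &
                            D = [set w | V (eta w B)]]].

Context (n : nat) (act : Y -> 'rV[R]_n -> Y) (X : set Y).

Definition sigma_window (a b : 'rV[R]_n) : set (set Omega) :=
  sigma_eta (translate act X a `\` translate act X b).

(* Since u ranges over L2, the second clause only concerns cylinder functions
   that are square integrable. *)
Definition is_shift_unitary (a b c : 'rV[R]_n) (S : L2 Pr -> L2 Pr) :=
  is_unitary_on (@L2ip _ _ _ Pr) (@L2ip _ _ _ Pr)
    [set` G_measurable (mu:=Pr) (sigma_window a b)]
    [set` G_measurable (mu:=Pr) (sigma_window (a + c) (b + c))] S /\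
  forall (m : nat) (B : 'I_m -> set Y) (f : m.-tuple (\bar R) -> R[i])
         (u : L2 Pr),
    (forall i, measurable (B i) /\
               B i `<=` translate act X a `\` translate act X b) ->
    measurable_fun setT f ->
    u = (fun w => f [tuple eta w (B i) | i < m]) %[ae Pr] ->
    S u = (fun w => f [tuple eta w (translate act (B i) c) | i < m]) %[ae Pr].

(* Only meaningful on L^2(sigma_window a b), where is_shift_unitary determines
   the function uniquely. *)
Definition shift_unitary (a b c : 'rV[R]_n) : L2 Pr -> L2 Pr :=
  get (is_shift_unitary a b c).

Variable P : closedConvexCone R n.

Definition fibre (a : conePt P) :=
  L2sub Pr (sigma_eta (X `\` translate act X (val a))).

Definition fibre_ip (a : conePt P) (u v : fibre a) : R[i] :=
  L2ip (L2sub_val u) (L2sub_val v).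

Definition poissonE : Type := {a : conePt P & fibre a}.
HB.instance Definition _ := Choice.on poissonE.
HB.instance Definition _ := isPointed.Build poissonE
  (existT (fun a => fibre a : Type) point 0).

Definition poissonE_incl (x : poissonE) :
    conePt P * g_sigma_algebraType (ip_open (@L2ip _ _ _ Pr)) :=
  (projT1 x, L2sub_val (projT2 x)).
HB.instance Definition _ :=
  Measurable.copy poissonE (g_sigma_algebra_preimageType poissonE_incl).

(* F_b is sigma_window 0 b, so S_a is the shift unitary for the window (0, b). *)
Definition is_poisson_mul (mul : poissonE -> poissonE -> poissonE) :=
  forall x y,
    projT1 (mul x y) = cone_add (projT1 x) (projT1 y) /\
    projT2 (mul x y) =
      (fun w => projT2 x w *
         shift_unitary 0 (val (projT1 y)) (val (projT1 x)) (projT2 y) w) %[ae Pr].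

End Poisson.

(* Main.v *)
Require Import Defs.
From HB Require Import structures.
From mathcomp Require Import all_boot all_order all_algebra complex.
From mathcomp Require Import all_classical all_reals all_analysis.
From mathcomp Require Import measurable_realfun ring lra.
Set Implicit Arguments.
Unset Strict Implicit.
Unset Printing Implicit Defensive.
Import Order.TTheory GRing.Theory Num.Theory.
Import numFieldNormedType.Exports.
Local Open Scope classical_set_scope.
Local Open Scope ring_scope.
Local Open Scope complex_scope.

(** The window of [a] is [W_a = X \ (X + a)]. Up to null sets, a variable
    measurable with respect to the counts in a window [W] is a function of the
    sequence [(eta (B_i `&` W))_i], for a countable pi-system [(B_i)] of sets of
    finite intensity generating [Y]. The joint law of counts [(eta C_i)_i] is
    determined by the intensities of the atoms of finitely many [C_i], hence is
    invariant under translation. So [g (eta C_i)_i |-> g (eta (C_i + c))_i]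
    defines an isometry [U_c] of the whole of L^2, multiplicative, with
    [U_a U_b = U_(a+b)], and the shift unitaries are its restrictions;
    associativity of the product is then immediate. Since [W_(a+b)] is the
    disjoint union of [W_a] and [W_b + a], independence makes [f (x) g |-> f U_a g]
    isometric, and the indicators of [D `&` D'], with [D] and [D'] measurable for
    the two pieces, form a pi-system whose span is dense.

    Rational combinations of the indicators of the events
    [{eta (B_i `&` W_a) = k_i for finitely many i}] are sections of [E] that are
    dense in every fibre; by Fubini they are measurable in [a], as is
    [(a, f) |-> U_a f]. They exhibit [E] as the Borel subset of the Polish space
    [R^d x L^2] of the pairs [(a, f)] such that [f] is a limit of values at [a] of
    these sections. *)

(** [shift_unitary] is picked by [get] among all maps of L^2 that meet a specification on one
    window, so nothing can be computed from it. The construction therefore uses [translateU], and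
    existence together with uniqueness of shift unitaries identifies the two on the window
    subspaces. The delicate point for [translateU] is independence of the representation: an almost
    sure identity [g (eta C_i)_i = h (eta D_i)_i] has to survive translation. It does because it
    only concerns the law of the two count sequences merged into one. A second obstacle is that the
    kernel [eta] is sigma-finite for each outcome separately. Sets of finite intensity have finite
    counts only almost surely, so complements can be counted by subtraction only off a null set; for
    sets depending on a parameter, this null set must not depend on the parameter. Measurability of
    maps into L^2 is reduced by a dense sequence to that of distances and inner products. The
    product of two L^2 functions, in general not in L^2, is reached by moving one factor across the
    inner product. *)

Local Notation reC := (@complex.Re _).
Local Notation imC := (@complex.Im _).

Local Notation sqmod := (@sqmod _).

(** * Inner products and L^2 spaces of complex functions *)

Section ComplexFacts.
Variable R : realType.
Implicit Types (z t : R[i]).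

Lemma sqmod_ge0 z : 0 <= sqmod z.
Proof. by rewrite addr_ge0 ?sqr_ge0. Qed.

Lemma sqmodM z t : sqmod (z * t) = sqmod z * sqmod t.
Proof. by case: z t => [a b] [c e]; rewrite /sqmod /=; ring. Qed.

Lemma sqmodC (x : R) : sqmod x%:C = x ^+ 2.
Proof. by rewrite /sqmod /= expr0n addr0. Qed.

Lemma sqmod_eq0 z : (sqmod z == 0) = (z == 0).
Proof. by case: z => a b; rewrite paddr_eq0 ?sqr_ge0// !sqrf_eq0 eq_complex. Qed.

Lemma reD z t : reC (z + t) = reC z + reC t. Proof. by case: z t => ? ? []. Qed.
Lemma imD z t : imC (z + t) = imC z + imC t. Proof. by case: z t => ? ? []. Qed.
Lemma reN z : reC (- z) = - reC z. Proof. by case: z. Qed.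
Lemma imN z : imC (- z) = - imC z. Proof. by case: z. Qed.
Lemma reCM (x : R) z : reC (x%:C * z) = x * reC z.
Proof. by case: z => a b /=; rewrite mul0r subr0. Qed.

Lemma measurable_reC : measurable_fun setT (reC : R[i] -> R).
Proof. by have [] := (measurable_complexP (id : R[i] -> R[i])).1 (@measurable_id _ _ _). Qed.

Lemma measurable_imC : measurable_fun setT (imC : R[i] -> R).
Proof. by have [] := (measurable_complexP (id : R[i] -> R[i])).1 (@measurable_id _ _ _). Qed.

Lemma measurable_sqmod : measurable_fun setT (sqmod : R[i] -> R).
Proof.
apply: measurable_funD; apply: measurable_funX.
  exact: measurable_reC.
exact: measurable_imC.
Qed.

Lemma measurable_complexM d (T : measurableType d) (f g : T -> R[i]) :
  measurable_fun setT f -> measurable_fun setT g ->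
  measurable_fun setT (fun x => f x * g x).
Proof.
move=> /measurable_complexP[fr fi] /measurable_complexP[gr gi].
apply/measurable_complexP; split.
  rewrite (_ : _ \o _ = ((reC \o f) \* (reC \o g)) \- ((imC \o f) \* (imC \o g))).
    by apply: measurable_funB; apply: measurable_funM.
  by apply/funext => x /=; case: (f x) => ? ?; case: (g x).
rewrite (_ : _ \o _ = ((reC \o f) \* (imC \o g)) \+ ((imC \o f) \* (reC \o g))).
  by apply: measurable_funD; apply: measurable_funM.
by apply/funext => x /=; case: (f x) => ? ?; case: (g x).
Qed.

Lemma measurable_complex_conj d (T : measurableType d) (f : T -> R[i]) :
  measurable_fun setT f -> measurable_fun setT (fun x => (f x)^*).
Proof.
move=> /measurable_complexP[fr fi]; apply/measurable_complexP; split.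
  by rewrite (_ : _ \o _ = reC \o f)//; apply/funext => x /=; case: (f x).
rewrite (_ : _ \o _ = \- (imC \o f)); first exact: measurable_funN.
by apply/funext => x /=; case: (f x).
Qed.

Lemma measurable_complexC d (T : measurableType d) (f : T -> R) :
  measurable_fun setT f -> measurable_fun setT (fun x => (f x)%:C : R[i]).
Proof. by move=> mf; apply/measurable_complexP; split => //; exact: measurable_cst. Qed.

End ComplexFacts.

Section InnerProduct.
Context (R : realType) (V : lmodType R[i]) (ip : {dot V for Num.conj}).
Implicit Types (u v w : V) (k : R[i]).
Local Notation N := (ip_norm ip).
Local Notation rip u v := (reC (ip u v)).

Lemma ipC u v : ip v u = (ip u v)^*.
Proof. by rewrite hermC /= expr0 mul1r. Qed.

Lemma ripC u v : rip v u = rip u v.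
Proof. by rewrite ipC; case: (ip u v). Qed.

Lemma ipDl u v w : ip (u + v) w = ip u w + ip v w.
Proof. exact: linearDl. Qed.

Lemma ipDr u v w : ip w (u + v) = ip w u + ip w v.
Proof. exact: linearDr. Qed.

Lemma ipZl k u w : ip (k *: u) w = k * ip u w.
Proof. exact: linearZl_LR. Qed.

Lemma ipZr k u w : ip w (k *: u) = k^* * ip w u.
Proof. by rewrite linearZr. Qed.

Lemma ipBl u v w : ip (u - v) w = ip u w - ip v w.
Proof. by rewrite -scaleN1r ipDl ipZl mulN1r. Qed.

Lemma ipBr u v w : ip w (u - v) = ip w u - ip w v.
Proof. by rewrite -scaleN1r ipDr ipZr rmorphN1 mulN1r. Qed.

Lemma ip_ge0 u : 0 <= ip u u.
Proof.
have [->|u0] := eqVneq u 0; last exact/ltW/neq0_dnorm_gt0.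
by rewrite linear0l.
Qed.

Lemma ip_normE u : ip u u = (N u ^+ 2)%:C.
Proof.
have := ip_ge0 u; rewrite /ip_norm lecE /= => /andP[/eqP im0 re0].
by rewrite sqr_sqrtr//; case: (ip u u) im0 re0 => a b /= ->.
Qed.

Lemma ip_norm_sqr u : N u ^+ 2 = rip u u.
Proof. by rewrite ip_normE. Qed.

Lemma ip_norm_ge0 u : 0 <= N u. Proof. exact: sqrtr_ge0. Qed.

Lemma ip_norm_eq0 u : N u = 0 -> u = 0.
Proof.
move=> u0; apply/eqP; apply: contraT => /neq0_dnorm_gt0 => /(_ _ ip).
by rewrite ip_normE u0 expr0n ltxx.
Qed.

Lemma ip_norm0 : N 0 = 0.
Proof. by rewrite /ip_norm linear0l sqrtr0. Qed.

Lemma ip_normZ_sqr k u : N (k *: u) ^+ 2 = sqmod k * N u ^+ 2.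
Proof.
rewrite ip_norm_sqr ipZl ipZr ip_normE mulrA.
by case: k => a b; rewrite /sqmod /=; ring.
Qed.

Lemma ip_normN u : N (- u) = N u.
Proof.
apply/eqP; rewrite -(@eqrXn2 _ 2) ?ip_norm_ge0// -scaleN1r ip_normZ_sqr.
by rewrite /sqmod /= oppr0 expr0n sqrrN expr1n addr0 mul1r.
Qed.

Lemma ip_distC u v : N (u - v) = N (v - u).
Proof. by rewrite -opprB ip_normN. Qed.

Lemma ip_normD_sqr u v : N (u + v) ^+ 2 = N u ^+ 2 + N v ^+ 2 + 2 * rip u v.
Proof. by rewrite !ip_norm_sqr ipDl !ipDr !reD (ripC u v); ring. Qed.

Lemma ip_normB_sqr u v : N (u - v) ^+ 2 = N u ^+ 2 + N v ^+ 2 - 2 * rip u v.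
Proof. by rewrite !ip_norm_sqr ipBl !ipBr !reD !reN !reD !reN (ripC u v); ring. Qed.

(** Cauchy-Schwarz, from expanding the square norm of [(N v)%:C *: u - (N u)%:C *: v], which is
    [2 * (N u * N v) * (N u * N v - rip u v)]. The real part suffices for the triangle
    inequality. *)
Lemma rip_le u v : rip u v <= N u * N v.
Proof.
have [u0|u0] := eqVneq (N u) 0.
  by rewrite (ip_norm_eq0 u0) linear0l ip_norm0 mul0r.
have [v0|v0] := eqVneq (N v) 0.
  by rewrite (ip_norm_eq0 v0) ip_norm0 mulr0 linear0r.
have := sqr_ge0 (N ((N v)%:C *: u - (N u)%:C *: v)).
rewrite ip_normB_sqr !ip_normZ_sqr !sqmodC ipZl ipZr reCM.
rewrite (_ : reC _ = N u * rip u v); last first.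
  by case: (ip u v) => a b /=; ring.
have -> : N v ^+ 2 * N u ^+ 2 + N u ^+ 2 * N v ^+ 2
  - 2 * (N v * (N u * rip u v)) = 2 * (N u * N v) * (N u * N v - rip u v) by ring.
rewrite pmulr_rge0 ?subr_ge0// mulr_gt0// mulr_gt0// lt_neqAle ip_norm_ge0 andbT.
  by rewrite eq_sym.
by rewrite eq_sym.
Qed.

Lemma ler_ip_normD u v : N (u + v) <= N u + N v.
Proof.
rewrite -(@ler_pXn2r _ 2) ?nnegrE ?addr_ge0 ?ip_norm_ge0//.
by rewrite ip_normD_sqr; have := rip_le u v; lra.
Qed.

Lemma ler_ip_dist u v w : N (u - w) <= N (u - v) + N (v - w).
Proof. by rewrite (le_trans _ (ler_ip_normD _ _))// addrA subrK. Qed.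

Lemma rip_polar u v : rip u v = 2^-1 * (N u ^+ 2 + N v ^+ 2 - N (u - v) ^+ 2).
Proof. by rewrite ip_normB_sqr; field. Qed.

(** Conjugation in the second argument turns ['i] into a factor [-i], which moves the imaginary part
    to the real one. With [rip_polar] this recovers the whole inner product from norms, for
    isometries as well as for measurability. *)
Lemma im_ip u v : imC (ip u v) = rip u ('i *: v).
Proof. by rewrite ipZr; case: (ip u v) => a b /=; ring. Qed.

Lemma ip_norm_inj u v : N (u - v) = 0 -> u = v.
Proof. by move=> /ip_norm_eq0/eqP; rewrite subr_eq0 => /eqP. Qed.

(** [2 * rip u v - N v ^+ 2] is [N u ^+ 2 - N (u - v) ^+ 2]. The supremum sees [u] only through
    inner products, so weak measurability yields measurability of the norm. *)
Lemma ip_norm_sup u (D : set V) :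
  (forall e, 0 < e -> exists2 v, D v & N (u - v) < e) ->
  N u ^+ 2 = sup [set 2 * rip u v - N v ^+ 2 | v in D].
Proof.
move=> dD; have ub v : 2 * rip u v - N v ^+ 2 <= N u ^+ 2.
  have := sqr_ge0 (N (u - v)); rewrite ip_normB_sqr; lra.
apply/eqP; rewrite eq_le; apply/andP; split; last first.
  apply: ge_sup => [|_ [v _ <-]//].
  by have [v Dv _] := dD 1 ltr01; exists (2 * rip u v - N v ^+ 2), v.
apply/ler_addgt0Pl => e e0.
have [|v Dv uv] := dD (Num.sqrt e); first by rewrite sqrtr_gt0.
have : 2 * rip u v - N v ^+ 2 <= sup [set 2 * rip u v - N v ^+ 2 | v in D].
  apply: ub_le_sup; last by exists v.
  by exists (N u ^+ 2) => _ [w _ <-].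
have : N (u - v) ^+ 2 <= e.
  by rewrite -(sqr_sqrtr (ltW e0)) ler_pXn2r ?nnegrE ?ip_norm_ge0 ?sqrtr_ge0// ltW.
by rewrite ip_normB_sqr; lra.
Qed.

(** With [D] the range of a sequence, a distance becomes a countable infimum of distances to and
    from its terms, measurable as soon as these are. *)
Lemma ip_dist_inf u v (D : set V) :
  (forall e, 0 < e -> exists2 w, D w & N (u - w) < e) ->
  N (u - v) = inf [set N (u - w) + N (w - v) | w in D].
Proof.
move=> dD; apply/eqP; rewrite eq_le; apply/andP; split.
  apply: lb_le_inf => [|_ [w _ <-]]; last exact: ler_ip_dist.
  by have [w Dw _] := dD 1 ltr01; exists (N (u - w) + N (w - v)), w.
apply/ler_addgt0Pl => e e0.
have e20 : 0 < e / 2 by rewrite divr_gt0.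
have [w Dw uw] := dD _ e20.
apply: (@le_trans _ _ (N (u - w) + N (w - v))).
  by apply: ge_inf; [exists 0 => _ [? _ <-]; rewrite addr_ge0 ?ip_norm_ge0|exists w].
have := ler_ip_dist w u v; rewrite (ip_distC w u).
have : e / 2 + e / 2 = e by field.
by move: uw; lra.
Qed.

End InnerProduct.

Lemma filterS4 T (F : set_system T) : Filter F -> forall A B C D E : set T,
  (forall x, A x -> B x -> C x -> D x -> E x) -> F A -> F B -> F C -> F D -> F E.
Proof.
move=> FF A B C D E ABCDE FA FB FC FD.
by apply: filterS2 (filterI FA FB) (filterI FC FD) => x [? ?] [? ?]; exact: ABCDE.
Qed.

Section AlmostEverywhere.
Context (R : realType) d (T : measurableType d) (mu : {measure set T -> \bar R}).

Lemma ae_eqP (U : Type) (f g : T -> U) :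
  f = g %[ae mu] <-> {ae mu, forall x, f x = g x}.
Proof. by split; apply: filterS => x /=; [exact|move=> ->]. Qed.

End AlmostEverywhere.

Section ComplexIntegral.
Context (R : realType) d (T : measurableType d) (mu : {measure set T -> \bar R}).
Implicit Types (f g : T -> R[i]) (k : R[i]).

Definition cintegral f : R[i] :=
  (\int[mu]_x reC (f x)) +i* (\int[mu]_x imC (f x)).

Definition cintegrable f :=
  mu.-integrable setT (EFin \o (reC \o f)) /\
  mu.-integrable setT (EFin \o (imC \o f)).

Lemma cintegrable_measurable f : cintegrable f -> measurable_fun setT f.
Proof.
move=> [/measurable_int fr /measurable_int fi].
by apply/measurable_complexP; split; exact/measurable_EFinP.
Qed.

Lemma cintegralD f g : cintegrable f -> cintegrable g ->
  cintegral (fun x => f x + g x) = cintegral f + cintegral g.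
Proof.
move=> [fr fi] [gr gi].
rewrite /cintegral (_ : (fun x => reC _) = (fun x => (reC \o f) x + (reC \o g) x)).
  rewrite (_ : (fun x => imC _) = (fun x => (imC \o f) x + (imC \o g) x)).
    by rewrite !RintegralD.
  by apply/funext => x /=; rewrite imD.
by apply/funext => x /=; rewrite reD.
Qed.

Lemma cintegrableZ k f : cintegrable f -> cintegrable (fun x => k * f x).
Proof.
case: k => a b [fr fi]; split.
  rewrite (_ : _ \o _ = (fun x => a%:E * (EFin \o (reC \o f)) x
    - b%:E * (EFin \o (imC \o f)) x)%E).
    by apply: integrableB => //; exact: integrableZl.
  by apply/funext => x /=; case: (f x).
rewrite (_ : _ \o _ = (fun x => a%:E * (EFin \o (imC \o f)) x
  + b%:E * (EFin \o (reC \o f)) x)%E).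
  by apply: integrableD => //; exact: integrableZl.
by apply/funext => x /=; case: (f x).
Qed.

Lemma integrable_RZl (r : R) (h : T -> R) : mu.-integrable setT (EFin \o h) ->
  mu.-integrable setT (EFin \o (fun x => r * h x)).
Proof.
move=> ih; rewrite (_ : _ \o _ = (fun x => r%:E * (EFin \o h) x)%E)//.
exact: integrableZl.
Qed.

Lemma cintegralZ k f : cintegrable f ->
  cintegral (fun x => k * f x) = k * cintegral f.
Proof.
case: k => a b [fr fi].
rewrite /cintegral (_ : (fun x => reC _) =
    (fun x => a * (reC \o f) x - b * (imC \o f) x)); last first.
  by apply/funext => x /=; case: (f x).
rewrite (_ : (fun x => imC _) =
    (fun x => a * (imC \o f) x + b * (reC \o f) x)); last first.
  by apply/funext => x /=; case: (f x).
rewrite RintegralB//; try exact: integrable_RZl.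
rewrite RintegralD//; try exact: integrable_RZl.
by rewrite !RintegralZl.
Qed.

Lemma cintegral_ae f g : measurable_fun setT f -> measurable_fun setT g ->
  f = g %[ae mu] -> cintegral f = cintegral g.
Proof.
move=> /measurable_complexP[fr fi] /measurable_complexP[gr gi] fg.
rewrite /cintegral /Rintegral.
rewrite (@ae_eq_integral _ _ _ mu setT (EFin \o (reC \o g)) (EFin \o (reC \o f)))//.
- rewrite (@ae_eq_integral _ _ _ mu setT (EFin \o (imC \o g)) (EFin \o (imC \o f)))//.
  + exact/measurable_EFinP.
  + exact/measurable_EFinP.
  + by apply: filterS fg => x h _ /=; rewrite h.
- exact/measurable_EFinP.
- exact/measurable_EFinP.
- by apply: filterS fg => x h _ /=; rewrite h.
Qed.

Lemma cintegrable_le f (h : T -> R) : measurable_fun setT f ->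
  mu.-integrable setT (EFin \o h) -> (forall x, `|reC (f x)| <= h x) ->
  (forall x, `|imC (f x)| <= h x) -> cintegrable f.
Proof.
move=> /measurable_complexP[fr fi] ih hr hi.
split; apply: (le_integrable _ _ _ ih) => //; try exact/measurable_EFinP.
  by move=> x _; rewrite /= lee_fin (le_trans (hr x))// ler_norm.
by move=> x _; rewrite /= lee_fin (le_trans (hi x))// ler_norm.
Qed.

End ComplexIntegral.

Section L2Basics.
Context (R : realType) d (T : measurableType d) (mu : {measure set T -> \bar R}).
Implicit Types (u v w : L2 mu) (k : R[i]) (f g : T -> R[i]).

Local Notation nrm := (ip_norm (@L2ip _ _ _ mu)).

Lemma measurable_sqmodE f : measurable_fun setT f ->
  measurable_fun setT (fun x => (sqmod (f x))%:E).
Proof.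
move=> mf; apply/measurable_EFinP.
exact: (measurableT_comp (@measurable_sqmod R)).
Qed.

Lemma mkL2_subproof f (mf : measurable_fun setT f) :
  (\int[mu]_x (sqmod (f x))%:E < +oo)%E -> L0cls mu mf \in sq_integrable (mu:=mu).
Proof. by rewrite (sq_integrableP mf (L0clsE mu mf)). Qed.

Definition mkL2 f (mf : measurable_fun setT f)
  (fi : (\int[mu]_x (sqmod (f x))%:E < +oo)%E) : L2 mu := MkL2 (mkL2_subproof mf fi).

Lemma mkL2E f (mf : measurable_fun setT f) fi :
  @mkL2 f mf fi = f %[ae mu].
Proof. exact: L0clsE. Qed.

Lemma L2_measurable u : measurable_fun setT (u : T -> R[i]).
Proof. exact: measurable_L0. Qed.

Lemma L2_inj u v : u = v %[ae mu] -> u = v.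
Proof. by move=> uv; apply/val_inj/L0P. Qed.

Lemma L2_sq_lty f u : measurable_fun setT f -> u = f %[ae mu] ->
  (\int[mu]_x (sqmod (f x))%:E < +oo)%E.
Proof. by move=> mf uf; rewrite -(sq_integrableP mf uf); exact: L2P. Qed.

Lemma L2D u v : L2val (u + v) = (fun x => u x + v x) %[ae mu].
Proof. exact: L0_add. Qed.

Lemma L2Z k u : L2val (k *: u) = (fun x => k * u x) %[ae mu].
Proof. exact: L0_scale. Qed.

Lemma L20 : L2val (0 : L2 mu) = cst 0 %[ae mu].
Proof. exact: L0_zero. Qed.

Lemma L2_lin k u v f g : u = f %[ae mu] -> v = g %[ae mu] ->
  L2val (k *: u + v) = (fun x => k * f x + g x) %[ae mu].
Proof.
move=> uf vg; apply: filterS4 (L2D (k *: u) v) (L2Z k u) uf vg.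
by move=> x + + + + _; move=> -> // -> // -> // -> .
Qed.

Lemma L2N u : L2val (- u) = (fun x => - u x) %[ae mu].
Proof.
rewrite -scaleN1r; apply: filterS (L2Z (-1) u) => x + _.
by move=> ->//; rewrite mulN1r.
Qed.

Lemma L2B u v : L2val (u - v) = (fun x => u x - v x) %[ae mu].
Proof.
by apply: filterS2 (L2D u (- v)) (L2N v) => x + + _; move=> -> // ->.
Qed.

Lemma L2_integrable_sqE f u : measurable_fun setT f -> u = f %[ae mu] ->
  mu.-integrable setT (EFin \o (fun x => sqmod (f x))).
Proof.
move=> mf uf; apply/integrableP; split; first exact/measurable_sqmodE.
under eq_integral do rewrite /= ger0_norm ?sqmod_ge0//.
exact: L2_sq_lty uf.
Qed.

Lemma L2_integrable_sq u : mu.-integrable setT (EFin \o (fun x => sqmod (u x))).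
Proof. exact/L2_integrable_sqE/ae_eq_refl/L2_measurable. Qed.

(** Each part of the integrand is a signed sum of two products of coordinates, and a product of
    reals is in absolute value at most half the sum of their squares. *)
Lemma L2_prod_integrableE u v f g : measurable_fun setT f -> measurable_fun setT g ->
  u = f %[ae mu] -> v = g %[ae mu] -> cintegrable mu (fun x => f x * (g x)^*).
Proof.
move=> mf mg uf vg.
apply: (@cintegrable_le _ _ _ _ _ (fun x => sqmod (f x) + sqmod (g x))).
- exact/measurable_complexM/measurable_complex_conj.
- rewrite (_ : _ \o _ = (EFin \o (fun x => sqmod (f x))) \+
    (EFin \o (fun x => sqmod (g x))))%E//.
  apply: integrableD => //; first exact: L2_integrable_sqE uf.
  exact: L2_integrable_sqE vg.
- move=> x; case: (f x) (g x) => [a b] [c e]; rewrite /sqmod /= ler_norml.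
  have := sqr_ge0 (a - c); have := sqr_ge0 (b - e).
  have := sqr_ge0 (a + c); have := sqr_ge0 (b + e).
  have := sqr_ge0 a; have := sqr_ge0 b; have := sqr_ge0 c; have := sqr_ge0 e.
  by move=> *; apply/andP; split; lra.
- move=> x; case: (f x) (g x) => [a b] [c e]; rewrite /sqmod /= ler_norml.
  have := sqr_ge0 (a - e); have := sqr_ge0 (b - c).
  have := sqr_ge0 (a + e); have := sqr_ge0 (b + c).
  have := sqr_ge0 a; have := sqr_ge0 b; have := sqr_ge0 c; have := sqr_ge0 e.
  by move=> *; apply/andP; split; lra.
Qed.

Lemma L2_prod_integrable u v : cintegrable mu (fun x => u x * (v x)^*).
Proof.
exact: L2_prod_integrableE (L2_measurable u) (L2_measurable v) (ae_eq_refl _ _ _)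
  (ae_eq_refl _ _ _).
Qed.

Lemma L2ipE u v f g : measurable_fun setT f -> measurable_fun setT g ->
  u = f %[ae mu] -> v = g %[ae mu] ->
  L2ip u v = cintegral mu (fun x => f x * (g x)^*).
Proof.
move=> mf mg uf vg; apply: cintegral_ae.
- exact/cintegrable_measurable/L2_prod_integrable.
- exact/measurable_complexM/measurable_complex_conj.
- by apply: filterS2 uf vg => x + + _; move=> -> // ->.
Qed.

Lemma L2ip_linearl w : linear_for *%R ((@L2ip _ _ _ mu)^~ w).
Proof.
move=> k u v /=.
have mw := L2_measurable w; have mu' := L2_measurable u; have mv := L2_measurable v.
rewrite (@L2ipE _ w (fun x => k * u x + v x) w)//.
- under eq_fun do rewrite mulrDl -mulrA.
  rewrite cintegralD ?cintegralZ//; try exact: L2_prod_integrable.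
  exact/cintegrableZ/L2_prod_integrable.
- by apply: measurable_complexD => //; exact: measurable_complexZ.
- by apply: filterS2 (L2D (k *: u) v) (L2Z k u) => x + + _; move=> -> // ->.
- exact: ae_eq_refl.
Qed.

Lemma L2ip_conj u v : L2ip u v = (L2ip v u)^*.
Proof.
rewrite /L2ip /=; congr (_ +i* _).
  by apply: eq_Rintegral => x _; case: (u x) (v x) => [a b] [c e] /=; ring.
rewrite -[RHS]mulN1r -RintegralZl//.
  by apply: eq_Rintegral => x _; case: (u x) (v x) => [a b] [c e] /=; ring.
exact: (L2_prod_integrable v u).2.
Qed.

Lemma L2ip_linearr w : linear_for (Num.conj \; *%R) (@L2ip _ _ _ mu w).
Proof.
move=> k u v /=; rewrite (L2ip_conj w u) (L2ip_conj w v) L2ip_conj L2ip_linearl.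
by rewrite [LHS]rmorphD [X in X + _]rmorphM.
Qed.

HB.instance Definition _ := @bilinear_isBilinear.Build R[i] (L2 mu) (L2 mu) R[i]
  ( *%R) (Num.conj \; *%R) (@L2ip _ _ _ mu) (L2ip_linearl, L2ip_linearr).

Lemma L2ip_hermitian u v : L2ip u v = (-1) ^+ false * Num.conj (L2ip v u).
Proof. by rewrite expr0 mul1r; exact: L2ip_conj. Qed.

HB.instance Definition _ := @isHermitianSesquilinear.Build R[i] (L2 mu) false
  Num.conj (@L2ip _ _ _ mu) L2ip_hermitian.

Lemma L2ip_self u : L2ip u u = (\int[mu]_x sqmod (u x))%:C.
Proof.
rewrite /L2ip /=; apply/eqP; rewrite eq_complex /=; apply/andP; split.
  apply/eqP/eq_Rintegral => x _.
  by case: (u x) => a b; rewrite /sqmod /=; ring.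
rewrite (_ : (fun x => _) = cst 0); first by rewrite Rintegral_cst// mul0r.
by apply/funext => x; case: (u x) => a b /=; ring.
Qed.

Lemma L2_norm_sqr u : (nrm u ^+ 2)%:E = (\int[mu]_x (sqmod (u x))%:E)%E.
Proof.
rewrite /ip_norm L2ip_self /= sqr_sqrtr; last first.
  by apply: Rintegral_ge0 => x _; exact: sqmod_ge0.
rewrite /Rintegral fineK//.
exact/integrable_fin_num/L2_integrable_sq.
Qed.

Lemma L2_norm_sqrE u f : measurable_fun setT f -> u = f %[ae mu] ->
  (nrm u ^+ 2)%:E = (\int[mu]_x (sqmod (f x))%:E)%E.
Proof.
move=> mf uf; rewrite L2_norm_sqr; apply: ge0_ae_eq_integral => //.
- exact/measurable_sqmodE/L2_measurable.
- exact: measurable_sqmodE.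
- by move=> x _; rewrite lee_fin sqmod_ge0.
- by move=> x _; rewrite lee_fin sqmod_ge0.
- by apply: filterS uf => x h _; rewrite h.
Qed.

Lemma L2ip_gt0 u : u != 0 -> 0 < L2ip u u.
Proof.
move=> u0; rewrite L2ip_self ltcR lt_neqAle Rintegral_ge0 ?andbT; last first.
  by move=> x _; exact: sqmod_ge0.
apply/negP => /eqP i0'; have := congr1 EFin i0'.
rewrite /Rintegral fineK; last exact/integrable_fin_num/L2_integrable_sq.
move=> /esym i0; move/eqP : u0; apply; apply/L2_inj.
have mu2 := measurable_sqmodE (L2_measurable u).
have := (ae_eq_integral_abs mu measurableT mu2).1.
under eq_integral do rewrite gee0_abs ?lee_fin ?sqmod_ge0//.
move=> /(_ i0) h; apply: filterS2 h L20 => x + + _ => /(_ I) + ->//.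
by move=> /eqP; rewrite eqe sqmod_eq0 => /eqP.
Qed.

HB.instance Definition _ := @isDotProduct.Build R[i] (L2 mu) (@L2ip _ _ _ mu) L2ip_gt0.

End L2Basics.

(** * Completeness of L^2 and almost everywhere limits *)

Section L2Complete.
Context (R : realType) d (T : measurableType d) (mu : {measure set T -> \bar R}).
Implicit Types (u v w : L2 mu).

Local Notation nrm := (ip_norm (@L2ip _ _ _ mu)).

(* Weighting the k-th term by 4^k makes the sum of the squares integrable, so
   that almost every point has geometrically decaying terms. *)
Lemma L2_geometric_ae (D : nat -> L2 mu) :
  (forall k, nrm (D k) ^+ 2 <= (8 ^- k)) ->
  {ae mu, forall x, exists C, forall k, sqmod (D k x) <= C * 4 ^- k}.
Proof.
move=> D8; pose S x := (\sum_(0 <= k <oo) (4 ^+ k * sqmod (D k x))%:E)%E.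
have t0 k x : (0 <= (4 ^+ k * sqmod (D k x))%:E)%E.
  by rewrite lee_fin mulr_ge0 ?sqmod_ge0// exprn_ge0.
have mt k : measurable_fun setT (fun x => (4 ^+ k * sqmod (D k x))%:E).
  apply/measurable_EFinP/measurable_funM => //.
  by apply/measurable_EFinP/measurable_sqmodE/L2_measurable.
have mS : measurable_fun setT S.
  by apply: ge0_emeasurable_sum => // k x _ _; exact: t0.
have S0 x : (0 <= S x)%E by apply: nneseries_ge0 => k _ _; exact: t0.
have iS : mu.-integrable setT S.
  apply/integrableP; split => //.
  under eq_integral do rewrite gee0_abs//.
  rewrite /S integral_nneseries//.
  (* The k-th integral is at most [4 ^+ k * 8 ^- k = 2 ^- k], written as a term of the
     half-geometric series. *)
  apply: (@le_lt_trans _ _ (\sum_(0 <= k <oo) (2 / (2 ^ (k + 0.+1))%:R)%:E)%E).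
    apply: lee_nneseries => [k _ _|k _].
      by apply: integral_ge0 => x _; exact: t0.
    under eq_integral do rewrite EFinM.
    rewrite ge0_integralZl_EFin//; last 2 first.
    - by move=> x _; rewrite lee_fin sqmod_ge0.
    - exact/measurable_sqmodE/L2_measurable.
    rewrite -L2_norm_sqr -EFinM lee_fin.
    apply: (@le_trans _ _ (4 ^+ k * 8 ^- k)).
      by rewrite ler_wpM2l// exprn_ge0.
    rewrite addn1 expnS natrM natrX invfM mulrA divff// mul1r.
    rewrite (_ : (8 : R) = 4 * 2); last by rewrite -natrM.
    by rewrite exprMn invfM mulrA divff ?mul1r// expf_neq0.
  have := @cvg_geometric_eseries_half R 2 0.
  by move=> /cvg_lim => /(_ (@ereal_hausdorff R)); rewrite /eseries => ->; rewrite ltry.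
have := integrable_ae measurableT iS; apply: filterS => x /(_ I) Sx.
exists (fine (S x)) => k.
rewrite ler_pdivlMr ?exprn_gt0// mulrC -lee_fin fineK//.
apply: (@le_trans _ _ (\sum_(0 <= i < k.+1) (4 ^+ i * sqmod (D i x))%:E)%E).
  by rewrite big_nat_recr//= leeDr// sume_ge0.
by apply: nneseries_lim_ge => n _ _; exact: t0.
Qed.

Lemma geometric_half_bound (x C : R) k : 0 <= C -> x ^+ 2 <= C * 4 ^- k ->
  `|x| <= geometric (Num.sqrt C) (2^-1) k.
Proof.
move=> C0 xC; rewrite -sqrtr_sqr (le_trans (ler_wsqrtr xC))// sqrtrM//.
rewrite (_ : (4 : R) = 2 ^+ 2); last by rewrite -natrX.
by rewrite -exprM mulnC exprM -exprVn sqrtr_sqr ger0_norm ?invr_ge0 ?exprn_ge0//= exprVn.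
Qed.

Lemma cvg_of_geometric (r : nat -> R) (l C : R) : 0 <= C ->
  (forall k, (r k - l) ^+ 2 <= C * 4 ^- k) -> r @ \oo --> l.
Proof.
move=> C0 rC; apply/subr_cvg0.
apply/norm_cvg0P.
apply: (@squeeze_cvgr _ _ _ _ (cst 0) (geometric (Num.sqrt C) (2^-1))).
- by near=> k; rewrite normr_ge0 /=; exact: geometric_half_bound.
- exact: cvg_cst.
- by apply: cvg_geometric; rewrite ger0_norm ?invr_ge0// invf_lt1// ltr1n.
Unshelve. all: by end_near. Qed.

Lemma is_cvg_of_geometric (r : nat -> R) (C : R) : 0 <= C ->
  (forall k, (r k.+1 - r k) ^+ 2 <= C * 4 ^- k) -> cvgn r.
Proof.
move=> C0 rC.
have : cvgn (series (telescope r)).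
  apply: normed_cvg.
  apply: (@series_le_cvg _ _ (geometric (Num.sqrt C) (2^-1))).
  - by move=> n; rewrite normr_ge0.
  - by move=> n; apply: geometric_ge0; rewrite ?sqrtr_ge0 ?invr_ge0.
  - by move=> n; apply: geometric_half_bound; last exact: rC.
  - by apply: is_cvg_geometric_series; rewrite ger0_norm ?invr_ge0// invf_lt1// ltr1n.
rewrite telescopeK => h.
rewrite (_ : r = (fun n => r 0%N + (r n - r 0%N))).
  by apply: is_cvgD => //; exact: is_cvg_cst.
by apply/funext => n; rewrite addrC subrK.
Qed.

(** Upper limits of both parts, with [fine] sending infinite values to 0: a total function of the
    sequence, measurable in parameters without a convergence hypothesis, and equal to the limit
    where there is one. *)
Definition climit (z : nat -> R[i]) : R[i] :=
  fine (limn_esup (fun k => (reC (z k))%:E)) +i*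
  fine (limn_esup (fun k => (imC (z k))%:E)).

Lemma climitE (z : nat -> R[i]) (a b : R) :
  (fun k => reC (z k)) @ \oo --> a -> (fun k => imC (z k)) @ \oo --> b ->
  climit z = a +i* b.
Proof.
move=> za zb; rewrite /climit.
have h (r : nat -> R) l : r @ \oo --> l -> limn_esup (EFin \o r) = l%:E.
  move=> rl; have : (EFin \o r) @ \oo --> l%:E by apply: cvg_EFin => //; near=> n.
  by move=> /cvg_limn_einf_sup[].
by rewrite (h _ _ za) (h _ _ zb).
Unshelve. all: by end_near. Qed.

Lemma measurable_climit d' (T' : measurableType d') (f : nat -> T' -> R[i]) :
  (forall k, measurable_fun setT (f k)) ->
  measurable_fun setT (fun x => climit (f^~ x)).
Proof.
move=> mf; apply/measurable_complexP; split.
  apply: (measurableT_comp (fine_measurable measurableT)).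
  apply: measurable_fun_limn_esup => k; apply/measurable_EFinP.
  by have /measurable_complexP[] := mf k.
apply: (measurableT_comp (fine_measurable measurableT)).
apply: measurable_fun_limn_esup => k; apply/measurable_EFinP.
by have /measurable_complexP[] := mf k.
Qed.

Lemma sqr_reC_le (z : R[i]) : reC z ^+ 2 <= sqmod z.
Proof. by rewrite lerDl sqr_ge0. Qed.

Lemma sqr_imC_le (z : R[i]) : imC z ^+ 2 <= sqmod z.
Proof. by rewrite lerDr sqr_ge0. Qed.

(** Convergence in norm at this rate forces convergence almost everywhere, so a limit in L^2 of
    functions of a given form can be rebuilt pointwise with [climit]. *)
Lemma L2_fast_limit u (v : nat -> L2 mu) :
  (forall k, nrm (v k - u) ^+ 2 <= 8 ^- k) ->
  {ae mu, forall x, u x = climit (fun k => v k x)}.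
Proof.
move=> vu; have h1 := L2_geometric_ae vu.
have h2 : {ae mu, forall x, forall k, L2val (v k - u) x = v k x - u x}.
  by apply/ae_foralln => k; exact/ae_eqP/L2B.
apply: filterS2 h1 h2 => x [C hC] hv.
have C0 : 0 <= C by have := hC 0%N; rewrite expr0 divr1; exact/le_trans/sqmod_ge0.
rewrite [LHS](_ : _ = reC (u x) +i* imC (u x)); last by case: (L2val u x).
apply/esym/climitE; apply: (@cvg_of_geometric _ _ C) => // k.
  by rewrite -reN -reD -hv (le_trans (sqr_reC_le _)).
by rewrite -imN -imD -hv (le_trans (sqr_imC_le _)).
Qed.

(** Riesz-Fischer: a fast subsequence converges almost everywhere, and Fatou's lemma bounds the
    distance from its limit to each term. *)
Lemma L2_complete : ip_complete (@L2ip _ _ _ mu).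
Proof.
move=> u cu.
have e8 k : 0 < Num.sqrt (8 ^- k : R) by rewrite sqrtr_gt0 invr_gt0 exprn_gt0.
pose Nf k := projT1 (cid (cu _ (e8 k))).
have NfP k i j : (Nf k <= i)%N -> (Nf k <= j)%N -> nrm (u i - u j) ^+ 2 < 8 ^- k.
  move=> ki kj; have := projT2 (cid (cu _ (e8 k))) i j ki kj.
  rewrite -(@ltr_pXn2r _ 2) ?nnegrE ?ip_norm_ge0 ?sqrtr_ge0//.
  by rewrite (@sqr_sqrtr _ (8 ^- k)) ?invr_ge0 ?exprn_ge0.
(* Summing the [(Nf i).+1] makes [phi] nondecreasing and keeps it above both [Nf k] and [k]. *)
pose phi k := (\sum_(i < k.+1) (Nf i).+1)%N.
have phiN k : (Nf k <= phi k)%N by rewrite /phi big_ord_recr /= addnS ltnW// ltnS leq_addl.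
have phi_mono k : (phi k <= phi k.+1)%N by rewrite /phi [leqRHS]big_ord_recr /= leq_addr.
have phi_ge k : (k <= phi k)%N.
  by elim: k => // k ih; rewrite /phi big_ord_recr /= addnS ltnS (leq_trans ih)// leq_addr.
have phi_homo k m : (k <= m)%N -> (phi k <= phi m)%N.
  by move=> /subnK <-; elim: (m - k)%N => // i ih; rewrite addSn (leq_trans ih).
have h1 : forall k, nrm (u (phi k.+1) - u (phi k)) ^+ 2 <= 8 ^- k.
  by move=> k; apply/ltW/NfP => //; rewrite (leq_trans (phiN k)).
pose f x := climit (fun k => u (phi k) x).
have mf : measurable_fun setT f.
  by apply: measurable_climit => k; exact: L2_measurable.
have cvgf : {ae mu, forall x, (fun k => reC (u (phi k) x)) @ \oo --> reC (f x) /\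
    (fun k => imC (u (phi k) x)) @ \oo --> imC (f x)}.
  have h2 : {ae mu, forall x k, L2val (u (phi k.+1) - u (phi k)) x =
      u (phi k.+1) x - u (phi k) x}.
    by apply/ae_foralln => k; exact/ae_eqP/L2B.
  apply: filterS2 (L2_geometric_ae h1) h2 => x [C hC] hv.
  have C0 : 0 <= C by have := hC 0%N; rewrite expr0 divr1; exact/le_trans/sqmod_ge0.
  have cr : cvgn (fun k => reC (u (phi k) x)).
    apply: (is_cvg_of_geometric C0) => k.
    by rewrite -reN -reD -hv (le_trans (sqr_reC_le _)).
  have ci : cvgn (fun k => imC (u (phi k) x)).
    apply: (is_cvg_of_geometric C0) => k.
    by rewrite -imN -imD -hv (le_trans (sqr_imC_le _)).
  by rewrite /f (climitE cr ci).
(* Fatou along the subsequence started at [i]: since [i <= phi (i + m)], all its terms fall under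
   the hypothesis on [u i]. *)
have key e i : 0 < e -> (forall j, (i <= j)%N -> nrm (u j - u i) ^+ 2 <= e) ->
    (\int[mu]_x (sqmod (f x - u i x))%:E <= e%:E)%E.
  move=> e0 ue; pose g m x := (sqmod (u (phi (i + m)) x - u i x))%:E.
  have mB v : measurable_fun setT (fun x => L2val v x - L2val (u i) x).
    rewrite (_ : (fun x => _) = (fun x => v x + (-1) * u i x)).
      apply: measurable_complexD; first exact: L2_measurable.
      exact/measurable_complexZ/L2_measurable.
    by apply/funext => x; rewrite mulN1r.
  have mfB : measurable_fun setT (fun x => f x - u i x).
    rewrite (_ : (fun x => _) = (fun x => f x + (-1) * u i x)).
      apply: measurable_complexD => //.
      exact/measurable_complexZ/L2_measurable.
    by apply/funext => x; rewrite mulN1r.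
  have mg m : measurable_fun setT (g m) by exact/measurable_sqmodE/mB.
  have g0 m x : (0 <= g m x)%E by rewrite lee_fin sqmod_ge0.
  have -> : (\int[mu]_x (sqmod (f x - u i x))%:E =
      \int[mu]_x limn_einf (g^~ x))%E.
    apply: ae_eq_integral => //.
    - exact: measurable_sqmodE.
    - rewrite /limn_einf; apply: measurableT_comp => //.
      by apply: measurable_fun_limn_esup => m; exact: measurableT_comp.
    - apply: filterS cvgf => x [xr xi] _; apply/esym.
      have /cvg_limn_einf_sup[] // : g^~ x @ \oo --> (sqmod (f x - u i x))%:E.
      apply: cvg_EFin; first by near=> n.
      have sh (r : nat -> R) (l : R) : r @ \oo --> l ->
          (fun m => r (i + m)%N) @ \oo --> l.
        by rewrite -(cvg_shiftn i); under eq_fun do rewrite addnC.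
      have {}xr := sh (fun k => reC (L2val (u (phi k)) x)) _ xr.
      have {}xi := sh (fun k => imC (L2val (u (phi k)) x)) _ xi.
      rewrite /sqmod (_ : fine \o _ = fun m =>
          (reC (u (phi (i + m)) x) - reC (u i x)) ^+ 2 +
          (imC (u (phi (i + m)) x) - imC (u i x)) ^+ 2); last first.
        by apply/funext => m /=; rewrite /sqmod reD imD reN imN.
      rewrite reD imD reN imN.
      by apply: cvgD; apply: cvgM; apply: cvgB => //; exact: cvg_cst.
  apply: (le_trans (fatou mu measurableT mg (fun n x _ => g0 n x))).
  rewrite limn_einf_lim; apply: lime_le; first exact: is_cvg_einfs.
  near=> m; apply: (@le_trans _ _ (\int[mu]_x g m x)%E).
    by apply: ereal_inf_lbound; exists m => /=.
  rewrite -(@L2_norm_sqrE _ _ _ _ (u (phi (i + m)) - u i))//.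
    rewrite lee_fin; apply: ue.
    by rewrite (@leq_trans (phi i))//; apply: phi_homo; exact: leq_addr.
  exact: L2B.
have [N0 N0P] := cu 1 ltr01.
have mfB i : measurable_fun setT (fun x => f x - u i x).
  rewrite (_ : (fun x => _) = (fun x => f x + (-1) * u i x)).
    apply: measurable_complexD => //.
    exact/measurable_complexZ/L2_measurable.
  by apply/funext => x; rewrite mulN1r.
have fi : (\int[mu]_x (sqmod (f x - u N0 x))%:E < +oo)%E.
  rewrite (@le_lt_trans _ _ 1%E) ?ltry//; apply: key => // j N0j.
  by rewrite expr_le1 ?ip_norm_ge0// ltW// N0P.
(* Only the difference [f - u N0] is known to be square integrable, so the limit is [u N0] plus the
   class of that difference. *)
pose l := u N0 + mkL2 (mfB N0) fi.
have lE : l = f %[ae mu].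
  apply: filterS2 (L2D (u N0) (mkL2 (mfB N0) fi)) (mkL2E (mfB N0) fi) => x + + _.
  by move=> -> // -> //; rewrite addrC subrK.
exists l => e e0; have e20 : 0 < e / 2 by rewrite divr_gt0.
have [N1 N1P] := cu _ e20; exists N1 => i N1i.
rewrite ip_distC (@le_lt_trans _ _ (e / 2)) ?ltr_pdivrMr ?ltr_pMr ?ltr1n//.
rewrite -(@ler_pXn2r _ 2) ?nnegrE ?ip_norm_ge0 ?(ltW e20)// -lee_fin.
rewrite (@L2_norm_sqrE _ _ _ _ _ (fun x => f x - u i x))//; last first.
  by apply: filterS2 (L2B l (u i)) lE => x + + _; move=> -> // -> .
apply: key => [|j ij]; first by rewrite exprn_gt0.
rewrite ler_pXn2r ?nnegrE ?ip_norm_ge0 ?(ltW e20)//.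
by rewrite ltW// N1P// (leq_trans N1i).
Unshelve. all: by end_near. Qed.

End L2Complete.

(** * Density in L^2 by closed subspaces and pi-systems *)

Section L2Density.
Context (R : realType) d (T : measurableType d) (P : probability T R).
Implicit Types (u v w : L2 P) (A B : set T) (M : set (L2 P)).

Local Notation nrm := (ip_norm (@L2ip _ _ _ P)).

Definition cindic A (x : T) : R[i] := (\1_A x)%:C.

Lemma measurable_cindic A : measurable A -> measurable_fun setT (cindic A).
Proof. by move=> mA; exact/measurable_complexC/measurable_indic. Qed.

Lemma cindic_sq_lty A : measurable A -> (\int[P]_x (sqmod (cindic A x))%:E < +oo)%E.
Proof.
move=> mA; apply: (@le_lt_trans _ _ (\int[P]_x (cst 1%E) x)%E).
  apply: ge0_le_integral => //.
  - by move=> x _; rewrite lee_fin sqmod_ge0.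
  - exact/measurable_sqmodE/measurable_cindic.
  - move=> x _; rewrite lee_fin sqmodC indicE.
    by case: (x \in A); rewrite ?expr1n ?expr0n.
by rewrite integral_cst// mul1e ltey_eq fin_num_measure.
Qed.

(* Junk value 0 on non-measurable sets. *)
Definition L2ind A : L2 P :=
  if pselect (measurable A) is left mA
  then mkL2 (measurable_cindic mA) (cindic_sq_lty mA) else 0.

Lemma L2indE A : measurable A -> L2ind A = cindic A %[ae P].
Proof.
by move=> mA; rewrite /L2ind; case: pselect => // mA'; exact: mkL2E.
Qed.

Lemma L2ip_indE u A : measurable A ->
  L2ip u (L2ind A) = cintegral P (fun x => u x * cindic A x).
Proof.
move=> mA; rewrite (@L2ipE _ _ _ _ _ _ u (cindic A))//.
- congr cintegral; apply/funext => x; congr (_ * _).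
  by apply/eqP; rewrite eq_complex /= oppr0 !eqxx.
- exact: measurable_cindic.
- exact: ae_eq_refl.
- exact: L2indE.
Qed.

Lemma L2ip_ind A B : measurable A -> measurable B ->
  L2ip (L2ind A) (L2ind B) = (fine (P (A `&` B)))%:C.
Proof.
move=> mA mB; rewrite L2ip_indE// (@cintegral_ae _ _ _ _ _ (cindic (A `&` B))).
- rewrite /cintegral; apply/eqP; rewrite eq_complex /=; apply/andP; split.
    by rewrite /Rintegral integral_indic ?setIT//; exact: measurableI.
  by rewrite Rintegral_cst// mul0r.
- apply: measurable_complexM; first exact: L2_measurable.
  exact: measurable_cindic.
- exact/measurable_cindic/measurableI.
- apply: filterS (L2indE mA) => x + _; move=> -> //.
  by rewrite /cindic indicI -rmorphM.
Qed.

Lemma L2ind_norm A : measurable A -> nrm (L2ind A) ^+ 2 = fine (P A).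
Proof. by move=> mA; rewrite /ip_norm L2ip_ind// setIid /= sqr_sqrtr ?fine_ge0. Qed.

Lemma L2indB A B : measurable A -> measurable B -> B `<=` A ->
  L2ind (A `\` B) = L2ind A - L2ind B.
Proof.
move=> mA mB BA; apply: L2_inj.
apply: filterS4 (L2indE (measurableD mA mB)) (L2indE mA) (L2indE mB)
  (L2B (L2ind A) (L2ind B)) => x + + + + _.
move=> -> // hA hB -> //; rewrite hA// hB// /cindic -rmorphB; congr (_%:C).
rewrite !indicE in_setD; case: (boolP (x \in B)) => xB; last by rewrite andbT subr0.
by rewrite (mem_set (BA _ (set_mem xB))) subrr.
Qed.

Lemma L2indU A B : measurable A -> measurable B -> A `&` B = set0 ->
  L2ind (A `|` B) = L2ind A + L2ind B.
Proof.
move=> mA mB AB; have -> : L2ind A = L2ind (A `|` B) - L2ind B.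
  rewrite -L2indB//; last exact: measurableU.
  congr L2ind; rewrite setDUl setDv setU0; apply/esym/setDidPl.
  by rewrite AB.
by rewrite subrK.
Qed.

Lemma L2ind0 : L2ind set0 = 0.
Proof.
by rewrite -(setDv [set: T]) L2indB// subrr.
Qed.

Lemma L2ind_bigcup (F : nat -> set T) n : (forall k, measurable (F k)) ->
  trivIset setT F -> L2ind (\bigcup_(k < n) F k) = \sum_(k < n) L2ind (F k).
Proof.
move=> mF tF; elim: n => [|n ih].
  by rewrite bigcup_mkord big_ord0 big_ord0 L2ind0.
rewrite big_ord_recr -ih /= !bigcup_mkord big_ord_recr /= L2indU//.
  exact: bigsetU_measurable.
rewrite -bigcup_mkord setI_bigcupl; apply: bigcup0 => k /= kn.
by move/trivIsetP : tF => ->//; rewrite lt_eqF.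
Qed.

Lemma L2ind_ae A B : measurable A -> measurable B -> P.-negligible (A `+` B) ->
  L2ind A = L2ind B.
Proof.
move=> mA mB AB; apply: L2_inj.
have h : {ae P, forall x, \1_A x = \1_B x :> R}.
  apply: negligibleS; last exact: AB.
  move=> x /= h; apply: contrapT => xAB; apply: h.
  rewrite !indicE; congr (_%:R); congr nat_of_bool; apply/idP/idP => /set_mem Hx.
    by apply/mem_set; apply: contrapT => xB; apply: xAB; left.
  by apply/mem_set; apply: contrapT => xB; apply: xAB; right.
apply: filterS3 h (L2indE mA) (L2indE mB) => x h + + _; move=> -> // -> //.
by rewrite /cindic h.
Qed.

Definition closed_subspace M := [/\ M 0, forall k u v, M u -> M v -> M (k *: u + v) &
  forall u, (forall e, 0 < e -> exists2 v, M v & nrm (v - u) < e) -> M u].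

(** An explicit form of the completed sigma-algebra of [G], to be compared with [sigma_eta], which
    is given only as a smallest one. *)
Definition ae_completion (G : set (set T)) : set (set T) :=
  [set A | measurable A /\ exists2 B, <<s G >> B & P.-negligible (A `+` B)].

Lemma closed_subspace_sum M (I : Type) (s : seq I) (k : I -> R[i]) (u : I -> L2 P) :
  closed_subspace M -> (forall i, M (u i)) -> M (\sum_(i <- s) k i *: u i).
Proof.
move=> [M0 MD _] Mu; elim: s => [|i s ih]; first by rewrite big_nil.
by rewrite big_cons; exact: MD.
Qed.

(** Dynkin's pi-lambda theorem: the sets with indicator in [M] are closed under complements by
    subtraction, and under disjoint unions because the squared distance from a partial union to the
    union is the measure of what is missing. *)
Lemma closed_subspace_sigma M (G : set (set T)) : closed_subspace M ->
  setI_closed G -> G setT -> G `<=` measurable ->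
  (forall A, G A -> M (L2ind A)) -> forall A, <<s G >> A -> M (L2ind A).
Proof.
move=> cM GI GT Gm MG; have [M0 MD Mc] := cM.
have MB u v : M u -> M v -> M (u - v).
  by move=> Mu Mv; rewrite addrC -scaleN1r; exact: MD.
suff h : <<s G >> `<=` [set A | measurable A /\ M (L2ind A)] by move=> A /h [].
rewrite -setI_closed_g_dynkin_g_sigma_algebra//.
apply: smallest_sub; last by move=> A GA; split; [exact: Gm|exact: MG].
split; first by split => //; exact: MG.
- move=> A [mA MA]; split; first exact: measurableC.
  by rewrite -setTD L2indB//; apply: MB => //; exact: MG.
- move=> F tF hF; have mF k : measurable (F k) by have [] := hF k.
  have mU : measurable (\bigcup_k F k) by exact: bigcup_measurable.
  split => //; apply: Mc => e e0.
  pose H n := \bigcup_(k < n) F k.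
  have mH n : measurable (H n) by exact: bigcup_measurable.
  have HU n : H n `<=` \bigcup_k F k by move=> x [k _ Fx]; exists k.
  have HUE : \bigcup_n H n = \bigcup_k F k.
    apply/seteqP; split; first by move=> x [n _ /HU].
    by move=> x [k _ Fx]; exists k.+1 => //; exists k => //=.
  have : (P \o H) n @[n --> \oo] --> P (\bigcup_k F k).
    rewrite -HUE; apply: nondecreasing_cvg_mu => //; first by rewrite HUE.
    move=> n m nm; apply/subsetPset => x [k /= kn Fx]; exists k => //=.
    exact: leq_trans nm.
  have fU : P (\bigcup_k F k) \is a fin_num by exact: fin_num_measure.
  rewrite -[X in _ --> X]fineK// => /fine_cvgP[_].
  have e20 : 0 < e ^+ 2 by rewrite exprn_gt0.
  move=> /cvgrPdist_lt/(_ _ e20)[n _ /(_ n (leqnn n))] /= hn.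
  exists (L2ind (H n)).
    rewrite /H L2ind_bigcup//.
    under eq_bigr do rewrite -[L2ind _]scale1r.
    by apply: closed_subspace_sum => // k; have [] := hF k.
  rewrite ip_distC -(@ltr_pXn2r _ 2) ?nnegrE ?ip_norm_ge0 ?(ltW e0)//.
  rewrite -L2indB// L2ind_norm; last exact: measurableD.
  rewrite measureD ?setIidr//; last by rewrite ltey_eq fU.
  rewrite fineB ?fin_num_measure//.
  by apply: le_lt_trans hn; exact: ler_norm.
Qed.

Lemma L2_sum (I : Type) (s : seq I) (k : I -> R[i]) (u : I -> L2 P) (h : I -> T -> R[i]) :
  (forall i, u i = h i %[ae P]) ->
  L2val (\sum_(i <- s) k i *: u i) = (fun x => \sum_(i <- s) k i * h i x) %[ae P].
Proof.
move=> uh; elim: s => [|i s ih].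
  by rewrite big_nil; apply: filterS (L20 P) => x + _; move=> -> //; rewrite big_nil.
rewrite big_cons; apply: filterS4 ih (uh i)
  (L2D (k i *: u i) (\sum_(j <- s) k j *: u j)) (L2Z (k i) (u i)).
by move=> x + + + + _; move=> h1 h2 -> // -> //; rewrite h1// h2// big_cons.
Qed.

Import HBNNSimple.

(** Increasing simple functions with level sets in [G] converge to [f] in L^2 by dominated
    convergence, with [f ^+ 2] as the bound. *)
Lemma closed_subspace_nonneg M (G : set (set T)) : closed_subspace M ->
  sigma_algebra setT G -> G `<=` measurable -> (forall A, G A -> M (L2ind A)) ->
  forall u (f : T -> R), measurable_fun setT (f : g_sigma_algebraType G -> R) ->
  (forall x, 0 <= f x) -> u = (fun x => (f x)%:C) %[ae P] -> M u.
Proof.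
move=> cM sG Gm MG u f mf f0 uf; have [M0 MD Mc] := cM.
have mGE (A : set T) : (@measurable _ (g_sigma_algebraType G) A) -> G A.
  by rewrite /measurable /= sigma_algebra_id.
have mG (f' : T -> R) : measurable_fun setT (f' : g_sigma_algebraType G -> R) ->
    measurable_fun setT f'.
  by move=> mf' _ B mB; apply/Gm/mGE; exact: mf'.
have mEf : measurable_fun setT (EFin \o (f : g_sigma_algebraType G -> R)).
  exact/measurable_EFinP.
pose g n : T -> R := nnsfun_approx measurableT mEf n.
have mg n : measurable_fun setT (g n : g_sigma_algebraType G -> R).
  exact: measurable_funPT.
have gf x : g ^~ x @ \oo --> f x.
  have := @cvg_nnsfun_approx _ _ _ _ measurableT _ mEf (fun x _ => f0 x) x I.
  by move=> /fine_cvgP[].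
have g0 n x : 0 <= g n x by exact: fun_ge0.
have nd x : nondecreasing_seq (g ^~ x).
  move=> n m nm; have := @nd_nnsfun_approx _ _ _ _ measurableT _ mEf n m nm.
  by move=> /asboolP; exact.
have gle n x : g n x <= f x.
  rewrite -(cvg_lim (@Rhausdorff R) (gf x)); apply: nondecreasing_cvgn_le => //.
  by apply/cvg_ex; exists (f x); exact: gf.

pose v n := \sum_(y <- finmap.enum_fset (fset_set (range (g n))))
  y%:C *: L2ind (g n @^-1` [set y]).
have mpre n y : measurable (g n @^-1` [set y]).
  by rewrite -[X in measurable X]setTI; apply: (mG _ (mg n)).
have vE n : v n = (fun x => (g n x)%:C) %[ae P].
  apply: filterS (L2_sum (finmap.enum_fset (fset_set (range (g n))))
    (fun y => y%:C) (fun y => L2indE (mpre n y))) => x /(_ I) -> _.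
  rewrite [g n x]fimfunE fsbig_finite//= rmorph_sum/=.
  by apply: eq_bigr => y _; rewrite rmorphM.
have Mv n : M (v n).
  apply: closed_subspace_sum => // y; apply/MG/mGE.
  by rewrite -[X in measurable X]setTI; apply: mg.
apply: Mc => e e0; have e20 : 0 < e ^+ 2 by rewrite exprn_gt0.
have mfC : measurable_fun setT (fun x : T => (f x)%:C).
  exact/measurable_complexC/mG.
have if2 : P.-integrable setT (fun x => (f x ^+ 2)%:E).
  apply/integrableP; split.
    by apply/measurable_EFinP/measurable_funX; exact: mG.
  under eq_integral do rewrite /= ger0_norm ?sqr_ge0// -sqmodC.
  exact: L2_sq_lty uf.
have mg' n : measurable_fun setT (fun x => ((g n x - f x) ^+ 2)%:E).
  apply/measurable_EFinP/measurable_funX/measurable_funB; exact: mG.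
have [] := @dominated_convergence _ _ _ P setT measurableT
  (fun n x => ((g n x - f x) ^+ 2)%:E) (cst 0%E) (fun x => (f x ^+ 2)%:E) mg'.
- exact: measurable_cst.
- apply: aeW => x _; apply: cvg_EFin; first by near=> n.
  rewrite (_ : fine \o _ = fun n => (g n x - f x) * (g n x - f x)); last first.
    by apply/funext => n /=; rewrite expr2.
  have : (fun n => g n x - f x) @ \oo --> (0 : R).
    by rewrite -[X in _ --> X](subrr (f x)); apply: cvgB => //; exact: cvg_cst.
  by move=> h; rewrite -[X in _ --> X](mulr0 (0 : R)); exact: cvgM.
- exact: if2.
- apply: aeW => x n _ /=; rewrite lee_fin ger0_norm ?sqr_ge0// -sqrrN opprB.
  rewrite ler_pXn2r ?nnegrE ?subr_ge0//.
  by rewrite gerBl.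
move=> _ _; rewrite /= integral0 => h.
have /fine_cvgP[_ /cvgrPdist_lt/(_ _ e20)[n _ /(_ n (leqnn n))]] := h.
rewrite /= sub0r normrN => hn; exists (v n) => //.
rewrite -(@ltr_pXn2r _ 2) ?nnegrE ?ip_norm_ge0 ?(ltW e0)//.
apply: le_lt_trans hn; apply: le_trans (ler_norm _).
have -> : (\int[P]_x ((g n x - f x) ^+ 2)%:E = (nrm (v n - u) ^+ 2)%:E)%E; last by [].
rewrite (@L2_norm_sqrE _ _ _ _ _ (fun x => (g n x - f x)%:C)).
- by apply: eq_integral => x _; rewrite sqmodC.
- by apply/measurable_complexC/measurable_funB; exact: mG.
- apply: filterS3 (vE n) uf (L2B (v n) u) => x + + + _.
  by move=> h1 h2 -> //; rewrite h1// h2// rmorphB.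
Unshelve. all: by end_near. Qed.

End L2Density.

Section L2DensityG.
Context (R : realType) d (T : measurableType d) (P : probability T R).
Implicit Types (u v w : L2 P) (A B : set T) (M : set (L2 P)).

(** The positive and negative parts of the real and imaginary parts have squares at most
    [sqmod (f x)], so each is again in L^2 and the nonnegative case applies to it. *)
Lemma closed_subspace_G_measurable M (G : set (set T)) : closed_subspace M ->
  sigma_algebra setT G -> G `<=` measurable -> (forall A, G A -> M (L2ind P A)) ->
  forall u, u \in G_measurable G -> M u.
Proof.
move=> cM sG Gm MG u /asboolP[f mf uf]; have [M0 MD Mc] := cM.
have mG (f' : T -> R) : measurable_fun setT (f' : g_sigma_algebraType G -> R) ->
    measurable_fun setT f'.
  move=> mf' _ B mB; have := mf' measurableT B mB.
  by rewrite {1}/measurable /= sigma_algebra_id//; exact: Gm.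
have [mr mi] := (measurable_complexP (f : g_sigma_algebraType G -> R[i])).1 mf.
have mf' : measurable_fun setT f.
  by apply/measurable_complexP; split; exact: mG.
have key (h : T -> R) : measurable_fun setT (h : g_sigma_algebraType G -> R) ->
    (forall x, h x ^+ 2 <= sqmod (f x)) -> (forall x, 0 <= h x) ->
    exists2 v, M v & v = (fun x => (h x)%:C) %[ae P].
  move=> mh hf h0.
  have mh' : measurable_fun setT (fun x : T => (h x)%:C).
    exact/measurable_complexC/mG.
  have hlt : (\int[P]_x (sqmod (h x)%:C)%:E < +oo)%E.
    apply: le_lt_trans (L2_sq_lty mf' uf); apply: ge0_le_integral => //.
    - by move=> x _; rewrite lee_fin sqmod_ge0.
    - exact: measurable_sqmodE.
    - exact: measurable_sqmodE.
    - by move=> x _; rewrite lee_fin sqmodC.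
  exists (mkL2 mh' hlt); last exact: mkL2E.
  exact: (closed_subspace_nonneg cM sG Gm MG mh h0 (mkL2E mh' hlt)).
have mx (h : T -> R) : measurable_fun setT (h : g_sigma_algebraType G -> R) ->
    measurable_fun setT ((fun x => Num.max (h x) 0) : g_sigma_algebraType G -> R).
  by move=> mh; apply: measurable_maxr => //; exact: measurable_cst.
have sx (x : R) (y : R) : x ^+ 2 <= y -> Num.max x 0 ^+ 2 <= y.
  by move=> xy; rewrite /Num.max; case: ifP => // _; rewrite expr0n (le_trans _ xy)// sqr_ge0.
have m0 (h : T -> R) x : 0 <= Num.max (h x) 0 by rewrite le_max lexx orbT.
have mN (h : T -> R) : measurable_fun setT (h : g_sigma_algebraType G -> R) ->
  measurable_fun setT ((fun x => - h x) : g_sigma_algebraType G -> R).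
  exact: measurable_funN.
have [a Ma aE] := key _ (mx _ mr) (fun x => sx _ _ (sqr_reC_le (f x))) (m0 _).
have [b Mb bE] : exists2 v, M v & v = (fun x => (Num.max (- reC (f x)) 0)%:C) %[ae P].
  apply: key; first (by apply: mx; apply: mN); last by move=> x; rewrite le_max lexx orbT.
  by move=> x; apply: sx; rewrite sqrrN sqr_reC_le.
have [c Mc' cE] := key _ (mx _ mi) (fun x => sx _ _ (sqr_imC_le (f x))) (m0 _).
have [e Me eE] : exists2 v, M v & v = (fun x => (Num.max (- imC (f x)) 0)%:C) %[ae P].
  apply: key; first (by apply: mx; apply: mN); last by move=> x; rewrite le_max lexx orbT.
  by move=> x; apply: sx; rewrite sqrrN sqr_imC_le.
have -> : u = (-1) *: b + (1 *: a + ((- 'i%C) *: e + ('i%C *: c + 0))).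
  apply: L2_inj.
  have h := L2_lin (-1) bE (L2_lin 1 aE (L2_lin (- 'i%C) eE (L2_lin 'i%C cE (L20 P)))).
  apply: filterS2 h uf => x + + _; move=> -> // -> //.
  rewrite /cst /=; move: (f x) => [p q] /=.
  have mxE (r : R) : r = Num.max r 0 - Num.max (- r) 0.
    by rewrite /Num.max; case: ifPn; case: ifPn; rewrite -?leNgt; lra.
  apply/eqP; rewrite eq_complex /=; apply/andP; split; apply/eqP.
    by rewrite [LHS]mxE; ring.
  by rewrite [LHS]mxE; ring.
by apply: (MD) => //; apply: (MD) => //; apply: (MD) => //; exact: (MD).
Qed.

End L2DensityG.

Section L2DensityPi.
Context (R : realType) d (T : measurableType d) (P : probability T R).

(** The common form of the density arguments below: what holds for the indicators of a pi-system and
    passes to combinations and limits holds on the L^2 space of any sigma-algebra inside the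
    completion of the generated one. *)
Lemma closed_subspace_density (M : set (L2 P)) (A G : set (set T)) :
  closed_subspace M -> setI_closed A -> A setT -> A `<=` measurable ->
  (forall B, A B -> M (L2ind P B)) ->
  sigma_algebra setT G -> G `<=` ae_completion P A ->
  forall u, u \in G_measurable G -> M u.
Proof.
move=> cM AI AT Am MA sG GA; apply: (closed_subspace_G_measurable cM sG).
  by move=> B /GA[].
move=> B /GA[mB [C sC BC]].
have mC : measurable C.
  have : <<s A >> `<=` measurable by apply: smallest_sub => //; exact: sigma_algebra_measurable.
  exact.
rewrite (L2ind_ae mB mC BC).
exact: (closed_subspace_sigma cM AI AT Am MA).
Qed.

End L2DensityPi.

(** * Products of independent functions *)

Section IndependentIntegral.
Context (R : realType) d (T : measurableType d) (P : probability T R).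
Context d1 d2 (T1 : measurableType d1) (T2 : measurableType d2).
Variables (X1 : {mfun T >-> T1}) (X2 : {mfun T >-> T2}).
Hypothesis X12 : forall A B, measurable A -> measurable B ->
  P (X1 @^-1` A `&` X2 @^-1` B) = (P (X1 @^-1` A) * P (X2 @^-1` B))%E.

Let m1 : probability T1 R := distribution P X1.
Let m2 : probability T2 R := distribution P X2.

Let X : T -> T1 * T2 := fun x => (X1 x, X2 x).

Let mX : measurable_fun setT X.
Proof. exact: measurable_fun_pair. Qed.

Let Xp : {mfun T >-> (T1 * T2)%type} :=
  HB.pack X (isMeasurableFun.Build _ _ _ _ _ mX).

Let distX A : measurable A -> distribution P Xp A = (m1 \x m2)%E A.
Proof.
move=> mA; apply/esym/product_measure_unique => // B C mB mC.
Qed.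

(** Independence makes the joint law of [X1] and [X2] the product of their laws, so both claims are
    Fubini's theorem on the image space. *)
Lemma indep_integral (f : T1 -> R) (g : T2 -> R) :
  measurable_fun setT f -> measurable_fun setT g ->
  P.-integrable setT (EFin \o (f \o X1)) -> P.-integrable setT (EFin \o (g \o X2)) ->
  P.-integrable setT (EFin \o (fun x => f (X1 x) * g (X2 x))) /\
  \int[P]_x (f (X1 x) * g (X2 x)) = (\int[P]_x f (X1 x)) * (\int[P]_x g (X2 x)).
Proof.
move=> mf mg intf intg; pose h (z : T1 * T2) := (f z.1 * g z.2)%:E.
have mh : measurable_fun setT h.
  by apply/measurable_EFinP/measurable_funM; exact: measurableT_comp.
have If : m1.-integrable setT (EFin \o f).
  apply: (integrable_pushforward (@measurable_funPT _ _ _ _ X1)) => //.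
  exact/measurable_EFinP.
have Ig : m2.-integrable setT (EFin \o g).
  apply: (integrable_pushforward (@measurable_funPT _ _ _ _ X2)) => //.
  exact/measurable_EFinP.
have Ih : (m1 \x m2)%E.-integrable setT h.
  apply/integrable12ltyP => //.
  have -> : (\int[m1]_x \int[m2]_y `|h (x, y)| =
      \int[m1]_x (`|(f x)%:E| * \int[m2]_y `|(g y)%:E|))%E.
    apply: eq_integral => x _; rewrite -ge0_integralZl//.
      by apply: eq_integral => y _; rewrite /h EFinM abseM.
    by apply: measurableT_comp => //; exact/measurable_EFinP.
  rewrite ge0_integralZr//; last 2 first.
  - by apply: measurableT_comp => //; exact/measurable_EFinP.
  - exact: integral_ge0.
  have /integrableP[_ hf] := If; have /integrableP[_ hg] := Ig.
  by apply: lte_mul_pinfty => //; [exact: integral_ge0|rewrite ge0_fin_numE//; exact: integral_ge0].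
have PX (k : T1 * T2 -> \bar R) :
    (\int[m1 \x m2]_z k z = \int[distribution P Xp]_z k z)%E.
  by apply: eq_measure_integral => A mA _; exact/esym/distX.
have Ih' : P.-integrable setT (h \o X).
  apply/integrableP; split; first exact: measurableT_comp.
  have /integrableP[_] := Ih; rewrite PX ge0_integral_distribution//.
  exact: measurableT_comp.
split; first exact: Ih'.
have finf : (\int[m1]_x (f x)%:E)%E \is a fin_num by exact: integrable_fin_num.
have fing : (\int[m2]_x (g x)%:E)%E \is a fin_num by exact: integrable_fin_num.
rewrite /Rintegral -fineM; last 2 first.
- exact: integrable_fin_num intf.
- exact: integrable_fin_num intg.
congr fine; transitivity (\int[m1 \x m2]_z h z)%E.
  by rewrite PX integral_distribution.
rewrite -integral12_prod_meas1// /fubini_F.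
have -> : (\int[m1]_x \int[m2]_y h (x, y) =
    \int[m1]_x ((f x)%:E * (\int[m2]_y (g y)%:E)))%E.
  by apply: eq_integral => x _; rewrite -integralZl//.
rewrite -(fineK fing) integralZr// fineK//; congr (_ * _)%E.
  by rewrite integral_distribution//; exact/measurable_EFinP.
by rewrite integral_distribution//; exact/measurable_EFinP.
Qed.

End IndependentIntegral.

Section IndependentL2.
Context (R : realType) d (T : measurableType d) (P : probability T R).
Variables (G1 G2 : set (set T)).
Hypotheses (sG1 : sigma_algebra setT G1) (sG2 : sigma_algebra setT G2).
Hypotheses (G1m : G1 `<=` measurable) (G2m : G2 `<=` measurable).
Hypothesis indepG : forall A B, G1 A -> G2 B -> P (A `&` B) = (P A * P B)%E.

Let T1 := g_sigma_algebraType G1.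
Let T2 := g_sigma_algebraType G2.

Let mid1 : measurable_fun setT (id : T -> T1).
Proof.
by move=> _ A; rewrite {1}/measurable /= sigma_algebra_id// setTI; exact: G1m.
Qed.

Let mid2 : measurable_fun setT (id : T -> T2).
Proof.
by move=> _ A; rewrite {1}/measurable /= sigma_algebra_id// setTI; exact: G2m.
Qed.

(** Independence of two sigma-algebras becomes independence of two random elements: the identity of
    [T], read with values in [T] carrying [G1] or [G2]. *)
Let X1 : {mfun T >-> T1} := HB.pack (id : T -> T1) (isMeasurableFun.Build _ _ _ _ _ mid1).
Let X2 : {mfun T >-> T2} := HB.pack (id : T -> T2) (isMeasurableFun.Build _ _ _ _ _ mid2).

Let X12 (A : set T1) (B : set T2) : measurable A -> measurable B ->
  P (X1 @^-1` A `&` X2 @^-1` B) = (P (X1 @^-1` A) * P (X2 @^-1` B))%E.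
Proof.
by rewrite {1 2}/measurable /= !sigma_algebra_id//; exact: indepG.
Qed.

Let realM (f : T -> R) (g : T -> R) : measurable_fun setT (f : T1 -> R) ->
  measurable_fun setT (g : T2 -> R) ->
  P.-integrable setT (EFin \o f) -> P.-integrable setT (EFin \o g) ->
  P.-integrable setT (EFin \o (fun x => f x * g x)) /\
  \int[P]_x (f x * g x) = (\int[P]_x f x) * (\int[P]_x g x).
Proof. exact: (indep_integral X12). Qed.

Let complexM (f : T -> R[i]) (g : T -> R[i]) : measurable_fun setT (f : T1 -> R[i]) ->
  measurable_fun setT (g : T2 -> R[i]) -> cintegrable P f -> cintegrable P g ->
  cintegral P (fun x => f x * g x) = cintegral P f * cintegral P g.
Proof.
move=> /measurable_complexP[mfr mfi] /measurable_complexP[mgr mgi] [fr fi] [gr gi].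
have [irr Err] := realM mfr mgr fr gr.
have [iri Eri] := realM mfr mgi fr gi.
have [iir Eir] := realM mfi mgr fi gr.
have [iii Eii] := realM mfi mgi fi gi.
rewrite /cintegral.
have -> : (fun x => reC (f x * g x)) =
    (fun x => (reC \o f) x * (reC \o g) x - (imC \o f) x * (imC \o g) x).
  by apply/funext => x /=; case: (f x) (g x) => [? ?] [].
have -> : (fun x => imC (f x * g x)) =
    (fun x => (reC \o f) x * (imC \o g) x + (imC \o f) x * (reC \o g) x).
  by apply/funext => x /=; case: (f x) (g x) => [? ?] [].
by rewrite RintegralB// RintegralD// Err Eri Eir Eii; apply/eqP; rewrite eq_complex /= !eqxx.
Qed.

Let mT1 (f : T -> R[i]) : measurable_fun setT (f : T1 -> R[i]) -> measurable_fun setT f.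
Proof. by move=> mf; exact: (measurableT_comp mf mid1). Qed.

Let mT2 (f : T -> R[i]) : measurable_fun setT (f : T2 -> R[i]) -> measurable_fun setT f.
Proof. by move=> mf; exact: (measurableT_comp mf mid2). Qed.

(** A product of two L^2 functions is in general only integrable. Here the squared moduli of the
    factors are integrable and independent, so their product is integrable too. *)
Lemma indep_mul_sq_lty (u v : L2 P) : u \in G_measurable G1 -> v \in G_measurable G2 ->
  (\int[P]_x (sqmod (u x * v x))%:E < +oo)%E.
Proof.
move=> /asboolP[f mf uf] /asboolP[g mg vg].
have msq (T' := T1) : measurable_fun setT ((fun x => sqmod (f x)) : T1 -> R).
  exact: (measurableT_comp (@measurable_sqmod R)).
have msq2 : measurable_fun setT ((fun x => sqmod (g x)) : T2 -> R).
  exact: (measurableT_comp (@measurable_sqmod R)).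
have isq (h : T -> R[i]) (w : L2 P) : measurable_fun setT h -> w = h %[ae P] ->
    P.-integrable setT (EFin \o (fun x => sqmod (h x))).
  by move=> mh wh; exact: L2_integrable_sqE wh.
have [/integrableP[_ h] _] := realM msq msq2 (isq _ _ (mT1 mf) uf) (isq _ _ (mT2 mg) vg).
apply: le_lt_trans h; rewrite (@ge0_ae_eq_integral _ _ _ P setT
  (fun x => (sqmod (u x * v x))%:E) (fun x => (sqmod (f x * g x))%:E))//.
- apply: ge0_le_integral => //.
  + by move=> x _; rewrite lee_fin sqmod_ge0.
  + by apply/measurable_sqmodE/measurable_complexM; [exact: mT1|exact: mT2].
  + apply: measurableT_comp => //; apply/measurable_EFinP/measurable_funM;
    apply: (measurableT_comp (@measurable_sqmod R)); [exact: mT1|exact: mT2].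
  + by move=> x _ /=; rewrite lee_fin sqmodM ler_norm.
- by apply/measurable_sqmodE/measurable_complexM; exact: L2_measurable.
- by apply/measurable_sqmodE/measurable_complexM; [exact: mT1|exact: mT2].
- by move=> x _; rewrite lee_fin sqmod_ge0.
- by move=> x _; rewrite lee_fin sqmod_ge0.
- by apply: filterS2 uf vg => x + + _; move=> -> // -> .
Qed.

(** The product [u v] times the conjugate of [u' v'] regroups into a factor measurable for [G1] and
    one measurable for [G2]. *)
Lemma indep_mul_ip (u u' v v' w w' : L2 P) :
  u \in G_measurable G1 -> u' \in G_measurable G1 ->
  v \in G_measurable G2 -> v' \in G_measurable G2 ->
  w = (fun x => u x * v x) %[ae P] -> w' = (fun x => u' x * v' x) %[ae P] ->
  L2ip w w' = L2ip u u' * L2ip v v'.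
Proof.
move=> /asboolP[f mf uf] /asboolP[f' mf' uf'] /asboolP[g mg vg] /asboolP[g' mg' vg'].
move=> wE wE'.
have Tf := mT1 mf; have Tf' := mT1 mf'; have Tg := mT2 mg; have Tg' := mT2 mg'.
rewrite (L2ipE Tf Tf' uf uf') (L2ipE Tg Tg' vg vg').
rewrite -complexM; last 4 first.
- exact/measurable_complexM/measurable_complex_conj.
- exact/measurable_complexM/measurable_complex_conj.
- exact: L2_prod_integrableE uf uf'.
- exact: L2_prod_integrableE vg vg'.
rewrite (@L2ipE _ _ _ _ w w' (fun x => f x * g x) (fun x => f' x * g' x)).
- by congr cintegral; apply/funext => x; rewrite rmorphM /= mulrACA.
- exact: measurable_complexM.
- exact: measurable_complexM.
- by apply: filterS3 wE uf vg => x + + + _; move=> -> // -> // -> .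
- by apply: filterS3 wE' uf' vg' => x + + + _; move=> -> // -> // -> .
Qed.

End IndependentL2.

(** * Borel measurability of maps into L^2 *)

Section MeasurableSups.
Context (R : realType) d (T : measurableType d).

Lemma measurable_sup_seq (g : nat -> T -> R) :
  (forall t, has_ubound (range (g ^~ t))) -> (forall j, measurable_fun setT (g j)) ->
  measurable_fun setT (fun t => sup (range (g ^~ t))).
Proof.
move=> ub mg; have := @measurable_fun_sups _ _ _ setT g 0 (fun t _ => ub t) mg.
congr measurable_fun; apply/funext => t; rewrite /sups /=; congr sup.
by apply/seteqP; split => [_ [k _ <-]|_ [k _ <-]]; exists k.
Qed.

Lemma measurable_inf_seq (g : nat -> T -> R) :
  (forall t, has_lbound (range (g ^~ t))) -> (forall j, measurable_fun setT (g j)) ->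
  measurable_fun setT (fun t => inf (range (g ^~ t))).
Proof.
move=> lb mg; have := @measurable_fun_infs _ _ _ setT g 0 (fun t _ => lb t) mg.
congr measurable_fun; apply/funext => t; rewrite /infs /=; congr inf.
by apply/seteqP; split => [_ [k _ <-]|_ [k _ <-]]; exists k.
Qed.

Lemma measurable_fun_ltr_preimage (f : T -> R) :
  (forall r, measurable [set t | f t < r]) -> measurable_fun setT f.
Proof.
move=> mf mT; apply: (measurability _ (RGenInftyO.measurableE R)) => //.
move=> _ [_ [r ->] <-]; rewrite setTI.
rewrite [X in measurable X](_ : _ = [set t | f t < r])//.
Qed.

Lemma measurable_sqrt_of_sqr (f : T -> R) : (forall t, 0 <= f t) ->
  measurable_fun setT (fun t => f t ^+ 2) -> measurable_fun setT f.
Proof.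
move=> f0 mf; rewrite (_ : f = fun t => Num.sqrt (f t ^+ 2)).
  apply: measurableT_comp => //.
  by apply: continuous_measurable_fun; exact: sqrt_continuous.
by apply/funext => t; rewrite sqrtr_sqr ger0_norm.
Qed.

End MeasurableSups.

Section HilbertBorel.
Context (R : realType) dP (O : measurableType dP) (P : probability O R).
Local Notation H := (L2 P).
Local Notation ip := (@L2ip _ _ _ P).
Local Notation nrm := (ip_norm ip).
Local Notation BH := (g_sigma_algebraType (ip_open ip)).

Variable q : nat -> H.
Hypothesis q_dense : ip_dense ip (range q).

(** By density an open set is the union of the balls it contains with centre a term of [q] and
    radius [1/(k+1)], a countable union. *)
Lemma measurable_to_L2 d (T : measurableType d) (f : T -> H) :
  (forall j, measurable_fun setT (fun t => nrm (f t - q j))) ->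
  measurable_fun setT (f : T -> BH).
Proof.
move=> mf mT.
apply: (measurability _ (erefl : @measurable _ BH = <<s ip_open ip >>)) => //.
move=> _ [U oU <-]; rewrite setTI.
pose B jk := [set u | nrm (u - q jk.1) < jk.2.+1%:R^-1].
have -> : f @^-1` U = \bigcup_(j in setT) \bigcup_(k in [set k | B (j, k) `<=` U])
    (f @^-1` B (j, k)).
  apply/seteqP; split => [t /= Ut|t [j _ [k /= BU] /BU]//].
  have [e e0 eU] := oU _ Ut.
  have e20 : 0 < e / 2 by rewrite divr_gt0.
  have [k] := ltr_add_invr e20; rewrite add0r => ke.
  have k0 : 0 < (k.+1%:R^-1 : R) by rewrite invr_gt0.
  have [_ [j _ <-] fq] := q_dense (f t) k0.
  exists j => //; exists k => //= v Bv; apply: eU.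
  apply: (le_lt_trans (ler_ip_dist ip v (q j) (f t))).
  rewrite (ip_distC ip (q j)) [ltRHS](splitr e).
  have {}Bv : nrm (v - q j) < k.+1%:R^-1 := Bv.
  exact: ltrD (lt_trans Bv ke) (lt_trans fq ke).
apply: bigcup_measurable => j _; apply: bigcup_measurable => k _.
rewrite -[X in measurable X]setTI.
rewrite [X in _ `&` X](_ : _ = (fun t => nrm (f t - q j)) @^-1` `]-oo, k.+1%:R^-1[).
  exact: mf.
by apply/seteqP; split => t /=; rewrite in_itv.
Qed.

Lemma measurable_L2_dist d (T : measurableType d) (f : T -> H) (h : H) :
  measurable_fun setT (f : T -> BH) -> measurable_fun setT (fun t => nrm (f t - h)).
Proof.
move=> mf; apply: measurable_fun_ltr_preimage => r.
rewrite -[X in measurable X]setTI.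
apply: (mf measurableT [set u | nrm (u - h) < r]).
apply: sub_sigma_algebra => u /= ur; exists (r - nrm (u - h)); first by rewrite subr_gt0.
move=> v uv; apply: (le_lt_trans (ler_ip_dist ip v u h)).
by rewrite -ltrBrDr.
Qed.

(** With both points moving, the distance is a countable infimum over [q]. Measurability of the
    linear operations comes only afterwards, from weak measurability. *)
Lemma measurable_L2_distM d (T : measurableType d) (f g : T -> H) :
  measurable_fun setT (f : T -> BH) -> measurable_fun setT (g : T -> BH) ->
  measurable_fun setT (fun t => nrm (f t - g t)).
Proof.
move=> mf mg.
rewrite (_ : (fun t => _) = fun t => inf (range (fun j =>
    nrm (f t - q j) + nrm (q j - g t)))).
  apply: (@measurable_inf_seq _ _ _ (fun j t => nrm (f t - q j) + nrm (q j - g t))).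
    by move=> t; exists 0 => _ [j _ <-]; rewrite addr_ge0 ?ip_norm_ge0.
  move=> j; apply: measurable_funD; first exact: measurable_L2_dist.
  by under eq_fun do rewrite ip_distC; exact: measurable_L2_dist.
apply/funext => t; rewrite (@ip_dist_inf _ _ ip _ _ (range q)).
  by rewrite image_comp.
by move=> e /q_dense; exact.
Qed.

Lemma measurable_L2_norm d (T : measurableType d) (f : T -> H) :
  measurable_fun setT (f : T -> BH) -> measurable_fun setT (fun t => nrm (f t)).
Proof. by move=> /(@measurable_L2_dist _ _ _ 0); under eq_fun do rewrite subr0. Qed.

Lemma measurable_L2_rip d (T : measurableType d) (f g : T -> H) :
  measurable_fun setT (f : T -> BH) -> measurable_fun setT (g : T -> BH) ->
  measurable_fun setT (fun t => reC (ip (f t) (g t))).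
Proof.
move=> mf mg; under eq_fun do rewrite (rip_polar ip).
apply: measurable_funM => //; apply: measurable_funB.
  by apply: measurable_funD; apply: measurable_funX; exact: measurable_L2_norm.
exact/measurable_funX/measurable_L2_distM.
Qed.

(* ||u||^2 is the supremum of 2 Re<u, v> - ||v||^2 over any set of v's that
   accumulates at u. *)
Lemma measurable_L2_norm_weak d (T : measurableType d) (f : T -> H) (g : nat -> T -> H) :
  (forall t e, 0 < e -> exists j, nrm (f t - g j t) < e) ->
  (forall j, measurable_fun setT (fun t => reC (ip (f t) (g j t)))) ->
  (forall j, measurable_fun setT (fun t => nrm (g j t))) ->
  measurable_fun setT (fun t => nrm (f t)).
Proof.
move=> fg mfg mg; apply: measurable_sqrt_of_sqr; first by move=> t; exact: ip_norm_ge0.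
rewrite (_ : (fun t => _) = fun t => sup (range (fun j =>
    2 * reC (ip (f t) (g j t)) - nrm (g j t) ^+ 2))).
  apply: (@measurable_sup_seq _ _ _ (fun j t => 2 * reC (ip (f t) (g j t)) - nrm (g j t) ^+ 2)).
    move=> t; exists (nrm (f t) ^+ 2) => _ [j _ <-].
    have := sqr_ge0 (nrm (f t - g j t)); rewrite (ip_normB_sqr ip); lra.
  move=> j; apply: measurable_funB; last exact: measurable_funX.
  exact: measurable_funM.
apply/funext => t; rewrite (@ip_norm_sup _ _ ip _ (range (g ^~ t))) ?image_comp//.
by move=> e /(fg t)[j]; exists (g j t) => //; exists j.
Qed.

(** Pettis' theorem in a separable space: the distances to the [q i] are recovered from inner
    products with the [q j]. *)
Lemma measurable_to_L2_weak d (T : measurableType d) (f : T -> H) :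
  (forall j, measurable_fun setT (fun t => reC (ip (f t) (q j)))) ->
  measurable_fun setT (f : T -> BH).
Proof.
move=> mf; apply: measurable_to_L2 => i.
apply: (@measurable_L2_norm_weak _ _ _ (fun j _ => q j)) => [t e e0|j|j].
- by have [_ [j _ <-] h] := q_dense (f t - q i) e0; exists j.
- under eq_fun do rewrite (ipBl ip) reD reN.
  by apply: measurable_funB; [exact: mf|exact: measurable_cst].
- exact: measurable_cst.
Qed.

Lemma measurable_L2D d (T : measurableType d) (f g : T -> H) :
  measurable_fun setT (f : T -> BH) -> measurable_fun setT (g : T -> BH) ->
  measurable_fun setT ((fun t => f t + g t) : T -> BH).
Proof.
move=> mf mg; apply: measurable_to_L2_weak => j.
under eq_fun do rewrite (ipDl ip) reD.
by apply: measurable_funD; exact: (measurable_L2_rip _ (@measurable_cst _ _ T BH setT (q j))).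
Qed.

Lemma measurable_L2Z d (T : measurableType d) (k : R[i]) (f : T -> H) :
  measurable_fun setT (f : T -> BH) ->
  measurable_fun setT ((fun t => k *: f t) : T -> BH).
Proof.
move=> mf; apply: measurable_to_L2_weak => j.
rewrite (_ : (fun t => _) = (fun t => reC (ip (f t) (k^* *: q j)))).
  exact: (measurable_L2_rip mf (@measurable_cst _ _ T BH setT (k^* *: q j))).
by apply/funext => t; rewrite (ipZl ip) (ipZr ip) conjCK.
Qed.

Lemma measurable_L2_ip d (T : measurableType d) (f g : T -> H) :
  measurable_fun setT (f : T -> BH) -> measurable_fun setT (g : T -> BH) ->
  measurable_fun setT (fun t => ip (f t) (g t)).
Proof.
move=> mf mg; apply/measurable_complexP; split; first exact: measurable_L2_rip.
rewrite (_ : _ \o _ = fun t => reC (ip (f t) ('i *: g t))).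
  exact: (measurable_L2_rip mf (measurable_L2Z _ mg)).
by apply/funext => t; exact: (im_ip ip).
Qed.

End HilbertBorel.

(** * Laws of the counts of a Poisson process *)

Section SequenceSpace.
Context (R : realType).

(** Generators of the product sigma-algebra on sequences, so that a countable family of counts
    becomes a single random element. *)
Definition coord_cylinder : set (set (nat -> \bar R)) :=
  [set A | exists i V, measurable V /\ A = [set k | V (k i)]].

Definition seqE := g_sigma_algebraType coord_cylinder.

Definition rectangle (m : nat) (V : nat -> set (\bar R)) : set seqE :=
  [set k | forall i, (i < m)%N -> V i (k i)].

Definition rectangles : set (set seqE) :=
  [set A | exists m V, (forall i, measurable (V i)) /\ A = rectangle m V].

Lemma measurable_coord i : measurable_fun setT (fun k : seqE => k i : \bar R).
Proof.
move=> _ V mV; rewrite setTI; apply: sub_sigma_algebra.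
by exists i, V.
Qed.

Lemma measurable_to_seqE d (T : measurableType d) (Z : nat -> T -> \bar R) :
  (forall i, measurable_fun setT (Z i)) ->
  measurable_fun setT ((fun x i => Z i x) : T -> seqE).
Proof.
move=> mZ mT.
apply: (measurability _ (erefl : @measurable _ seqE = <<s coord_cylinder >>)) => //.
by move=> _ [_ [i [V [mV ->]]] <-]; exact: mZ.
Qed.

Lemma measurable_rectangle m V : (forall i, measurable (V i)) ->
  measurable (rectangle m V).
Proof.
move=> mV.
rewrite (_ : rectangle m V = \bigcap_(i in [set i | (i < m)%N]) [set k : seqE | V i (k i)])//.
apply: bigcap_measurableType => i _.
by rewrite -[X in measurable X]setTI; exact: measurable_coord.
Qed.

Lemma rectangle_widen m m' V : (m <= m')%N ->
  rectangle m V = rectangle m' (fun i => if (i < m)%N then V i else setT).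
Proof.
move=> mm'; apply/seteqP; split => k Vk i im.
  by case: ifPn => // im'; exact: Vk.
by have := Vk i (leq_trans im mm'); rewrite im.
Qed.

Lemma rectangles_setI : setI_closed rectangles.
Proof.
move=> _ _ [m [V [mV ->]]] [m' [V' [mV' ->]]].
pose M := maxn m m'.
rewrite (@rectangle_widen m M) ?leq_maxl// (@rectangle_widen m' M) ?leq_maxr//.
exists M, (fun i => (if (i < m)%N then V i else setT) `&` (if (i < m')%N then V' i else setT)).
split; first by move=> i; apply: measurableI; case: ifPn.
apply/seteqP; split => k; first by move=> [h h'] i iM; split; [exact: h|exact: h'].
by move=> h; split => i iM; have [] := h i iM.
Qed.

Lemma rectanglesT : rectangles setT.
Proof. by exists 0%N, (fun=> setT); split => //; apply/seteqP; split. Qed.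

Lemma measurable_seqE_rectangles : @measurable _ seqE = <<s rectangles >>.
Proof.
apply/seteqP; split; apply: smallest_sub.
- exact: smallest_sigma_algebra.
- move=> _ [i [V [mV ->]]]; apply: sub_sigma_algebra.
  exists i.+1, (fun j => if j == i then V else setT); split.
    by move=> j; case: ifPn.
  apply/seteqP; split => k /=; first by move=> Vk j _; case: ifPn => // /eqP ->.
  by move=> /(_ i (ltnSn i)); rewrite eqxx.
- exact: (@sigma_algebra_measurable _ seqE).
- by move=> _ [m [V [mV ->]]]; exact: measurable_rectangle.
Qed.

Context d (T : measurableType d) (P : probability T R).

Lemma seqE_law (Z Z' : T -> seqE) :
  measurable_fun setT Z -> measurable_fun setT Z' ->
  (forall m V, (forall i, measurable (V i)) ->
     P (Z @^-1` rectangle m V) = P (Z' @^-1` rectangle m V)) ->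
  forall A, measurable A -> P (Z @^-1` A) = P (Z' @^-1` A).
Proof.
move=> mZ mZ' ZZ'.
pose X : {mfun T >-> seqE} := HB.pack Z (isMeasurableFun.Build _ _ _ _ _ mZ).
pose X' : {mfun T >-> seqE} := HB.pack Z' (isMeasurableFun.Build _ _ _ _ _ mZ').
apply: (@measure_unique _ R seqE rectangles (fun=> setT) measurable_seqE_rectangles
  rectangles_setI (fun=> rectanglesT) _ (distribution P X) (distribution P X')).
- by rewrite bigcup_const.
- by move=> _ [m [V [mV ->]]]; exact: ZZ'.
- by move=> _; rewrite ltey_eq fin_num_measure.
Qed.

(* Two applications of uniqueness, one per factor; the measure A |-> P (A & B)
   is finite. *)
Lemma seqE_indep (Z Z' : T -> seqE) :
  measurable_fun setT Z -> measurable_fun setT Z' ->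
  (forall m V V', (forall i, measurable (V i)) -> (forall i, measurable (V' i)) ->
     P (Z @^-1` rectangle m V `&` Z' @^-1` rectangle m V') =
     (P (Z @^-1` rectangle m V) * P (Z' @^-1` rectangle m V'))%E) ->
  forall A A', measurable A -> measurable A' ->
  P (Z @^-1` A `&` Z' @^-1` A') = (P (Z @^-1` A) * P (Z' @^-1` A'))%E.
Proof.
move=> mZ mZ' ZZ'.
have pre (Y : T -> seqE) : measurable_fun setT Y -> forall A, measurable A ->
    measurable (Y @^-1` A).
  by move=> mY A mA; rewrite -[X in measurable X]setTI; exact: mY.
have rr A A' : rectangles A -> rectangles A' ->
    P (Z @^-1` A `&` Z' @^-1` A') = (P (Z @^-1` A) * P (Z' @^-1` A'))%E.
  move=> [m [V [mV ->]]] [m' [V' [mV' ->]]]; pose M := maxn m m'.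
  rewrite (@rectangle_widen m M) ?leq_maxl// (@rectangle_widen m' M) ?leq_maxr//.
  by apply: ZZ' => i; case: ifPn.
have mr A : rectangles A -> measurable A.
  by move=> [m [V [mV ->]]]; exact: measurable_rectangle.
have step (Y : T -> seqE) (B : set T) : measurable_fun setT Y -> measurable B ->
    (forall A, rectangles A -> P (Y @^-1` A `&` B) = (P (Y @^-1` A) * P B)%E) ->
    forall A, measurable A -> P (Y @^-1` A `&` B) = (P (Y @^-1` A) * P B)%E.
  move=> mY mB YB A.
  pose X : {mfun T >-> seqE} := HB.pack Y (isMeasurableFun.Build _ _ _ _ _ mY).
  have PB : P B \is a fin_num by exact: fin_num_measure.
  have PB0 : 0 <= fine (P B) by rewrite fine_ge0.
  pose m1 := [the measure _ _ of mscale (NngNum PB0) (distribution P X)].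
  pose Q := [the measure _ _ of mrestr P mB].
  pose m2 : measure seqE R :=
    measure_function_pushforward__canonical__measure_function_Measure Q
      (@measurable_funPT _ _ _ _ X).
  move=> mA; suff : m1 A = m2 A.
    by rewrite /m1 /= /mscale /= /m2 /= /pushforward /= /mrestr fineK// muleC => ->.
  move: A mA.
  apply: (@measure_unique _ R seqE rectangles (fun=> setT) measurable_seqE_rectangles
    rectangles_setI (fun=> rectanglesT) _ m1 m2).
  - by rewrite bigcup_const.
  - move=> A rA; rewrite /m1 /= /mscale /= /m2 /= /pushforward /= /mrestr fineK//.
    by rewrite muleC -YB.
  - move=> _; rewrite /m1 /= /mscale /= ltey_eq fin_numM//.
    exact: fin_num_measure.
move=> A A' mA mA'.
apply: (step Z _ mZ (pre _ mZ' _ mA')) => // {mA}A rA.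
rewrite setIC muleC; apply: (step Z' _ mZ' (pre _ mZ _ (mr _ rA))) => // {mA'}A' rA'.
by rewrite setIC muleC; exact: rr.
Qed.

End SequenceSpace.

Section Factorization.
Context (R : realType) d (T : measurableType d) (P : probability T R).
Context d' (T' : measurableType d') (Phi : T -> T').

Definition factors : set (L2 P) :=
  [set u | exists2 g : T' -> R[i], measurable_fun setT g & u = g \o Phi %[ae P]].

(** For a limit, approximants at rate [8 ^- k] converge almost everywhere, and the [climit] of their
    functions of [Phi] is again a function of [Phi]. Applied to indicators of events of [Phi], this
    gives the Doob-Dynkin lemma. *)
Lemma factors_closed_subspace : closed_subspace factors.
Proof.
split.
- exists (cst 0); first exact: measurable_cst.
  exact: L20.
- move=> k u v [g mg ug] [h mh vh]; exists (fun x => k * g x + h x).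
    by apply: measurable_complexD => //; exact: measurable_complexZ.
  exact: L2_lin.
- move=> u uG.
  have e8 k : 0 < Num.sqrt (8 ^- k : R) by rewrite sqrtr_gt0 invr_gt0 exprn_gt0.
  have ex k : exists vg : L2 P * (T' -> R[i]), [/\ measurable_fun setT vg.2,
      vg.1 = vg.2 \o Phi %[ae P] & ip_norm (@L2ip _ _ _ P) (vg.1 - u) ^+ 2 <= 8 ^- k].
    have [v [g mg vg] vu] := uG _ (e8 k); exists (v, g); split => //.
    rewrite -[leRHS](@sqr_sqrtr _ (8 ^- k)) ?invr_ge0 ?exprn_ge0//.
    by rewrite ler_pXn2r ?nnegrE ?ip_norm_ge0 ?sqrtr_ge0// ltW.
  have [v vP] := choice ex.
  exists (fun x => climit (fun k => (v k).2 x)).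
    by apply: measurable_climit => k; have [] := vP k.
  have h : {ae P, forall x k, (v k).1 x = (v k).2 (Phi x)}.
    by apply/ae_foralln => k; apply/ae_eqP; have [] := vP k.
  have lim : {ae P, forall x, u x = climit (fun k => (v k).1 x)}.
    by apply: (@L2_fast_limit _ _ _ _ u (fun k => (v k).1)) => k; have [] := vP k.
  apply: filterS2 lim h => x -> hx _ /=.
  by congr climit; apply/funext => k; rewrite hx.
Qed.

End Factorization.

Lemma G_measurableE (R : realType) d (T : measurableType d) (P : probability T R)
    (G : set (set T)) :
  [set` G_measurable (mu:=P) G] =
  factors (P:=P) (id : T -> g_sigma_algebraType G).
Proof.
apply/seteqP; split => u /=; first by move=> /asboolP[g mg ug]; exists g.
by move=> [g mg ug]; apply/asboolP; exists g.
Qed.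

Lemma G_measurable_closed_subspace (R : realType) d (T : measurableType d)
    (P : probability T R) (G : set (set T)) :
  closed_subspace [set` G_measurable (mu:=P) G].
Proof. by rewrite G_measurableE; exact: factors_closed_subspace. Qed.

Section Atoms.
Context d (Y : measurableType d).

(** An atom is the set of points with a given pattern of membership in the first [m] sets [C i],
    within their union. The patterns are enumerated by [enum_val], and [D j] is empty beyond the
    last one. Cutting with the union keeps the atoms inside any set that contains all these
    [C i]. *)
Lemma disjoint_atoms (m : nat) (C : nat -> set Y) : (forall i, measurable (C i)) ->
  exists N (D : nat -> set Y) (b : nat -> nat -> bool),
  [/\ forall j, measurable (D j), trivIset setT D,
      forall j, D j `<=` \bigcup_(i < m) C i &
      forall i, (i < m)%N -> C i = \big[setU/set0]_(j < N | b i j) D j].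
Proof.
move=> mC; pose F := {ffun 'I_m -> bool}.
pose A (f : F) : set Y := (\bigcup_(i < m) C i) `&`
  \bigcap_(i in [set: 'I_m]) (if f i then C i else ~` C i).
pose D (j : nat) : set Y := if insub j is Some s then A (enum_val (s : 'I_#|F|)) else set0.
pose b (i j : nat) := if (insub i, insub j) is (Some i0, Some s)
  then enum_val (s : 'I_#|F|) (i0 : 'I_m) else false.
have mA f : measurable (A f).
  apply: measurableI; first exact: bigcup_measurable.
  by apply: fin_bigcap_measurable => // i _; case: ifP => // _; exact: measurableC.
exists #|F|, D, b; split.
- by move=> j; rewrite /D; case: insub.
- apply/trivIsetP => i j _ _ ij; rewrite /D.
  case: insubP => [s _ si|_]; last by rewrite set0I.
  case: insubP => [t _ tj|_]; last by rewrite setI0.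
  apply/seteqP; split => // y [[_ /= ys] [_ /= yt]].
  move/eqP : ij; apply; rewrite -si -tj; congr nat_of_ord.
  apply: enum_val_inj; apply/ffunP => k; have := ys k I; have := yt k I.
  by case: (enum_val s k); case: (enum_val t k).
- by move=> j; rewrite /D; case: insub => // s y [].
- move=> i im; pose i0 := Ordinal im.
  rewrite big_mkcond /= -(bigcup_mkord _ (fun j => if b i j then D j else set0)).
  apply/seteqP; split => y.
    move=> Cy; pose f : F := [ffun k : 'I_m => y \in C k].
    exists (enum_rank f) => /=; first exact: ltn_ord.
    rewrite /b insubT /= (valK (enum_rank f)) enum_rankK ffunE (mem_set Cy).
    rewrite /D (valK (enum_rank f)) enum_rankK; split; first by exists i.
    by move=> k _; rewrite ffunE; case: ifPn => [/set_mem|/negP h /mem_set].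
  move=> [j /= jN]; case: ifP => // bij.
  rewrite /D insubT /= => -[_ /(_ i0 I)].
  move: bij; rewrite /b insubT insubT /=.
  by rewrite (_ : Sub i im = i0)// => ->.
Qed.

End Atoms.

Section PoissonLaw.
Context (R : realType) dO (Omega : measurableType dO) (Pr : probability Omega R).
Context dY (Y : measurableType dY) (lambda : {measure set Y -> \bar R}).
Context (eta : R.-sigmafker Omega ~> Y) (eta_poisson : is_poisson_process Pr lambda eta).

Definition counts (C : nat -> set Y) (w : Omega) : seqE R := fun i => eta w (C i).

Lemma measurable_eta B : measurable B -> measurable_fun setT (fun w => eta w B).
Proof. exact: measurable_kernel. Qed.

Lemma measurable_eta_preimage B (V : set (\bar R)) : measurable B -> measurable V ->
  measurable [set w | V (eta w B)].
Proof.
by move=> mB mV; rewrite -[X in measurable X]setTI; exact: measurable_eta.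
Qed.

Lemma measurable_counts C : (forall i, measurable (C i)) ->
  measurable_fun setT (counts C).
Proof. by move=> mC; apply: measurable_to_seqE => i; exact: measurable_eta. Qed.

Lemma measurable_eta_eq B (x : \bar R) : measurable B ->
  measurable [set w | eta w B = x].
Proof. by move=> mB; exact: (measurable_eta_preimage mB (emeasurable_set1 x)). Qed.

Lemma poisson_natE w B : measurable B ->
  eta w B = +oo%E \/ exists k : nat, eta w B = k%:R%:E.
Proof. by move=> mB; have [|] := poisson_nat eta_poisson w mB; [right|left]. Qed.

Lemma poisson_point_law B B' : measurable B -> measurable B' ->
  lambda B = lambda B' -> forall k : nat,
  Pr [set w | eta w B = k%:R%:E] = Pr [set w | eta w B' = k%:R%:E].
Proof.
move=> mB mB' BB' k; have [Boo|] := ltP (lambda B) +oo%E.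
  by rewrite !(poisson_law eta_poisson)// -?BB'.
rewrite leye_eq => /eqP Boo.
have h A : measurable A -> lambda A = +oo%E -> Pr [set w | eta w A = k%:R%:E] = 0%E.
  move=> mA Aoo; apply/negligibleP; first exact: measurable_eta_eq.
  have := poisson_infty eta_poisson mA Aoo.
  by apply: negligibleS => w /= -> .
by rewrite !h// -BB'.
Qed.

Lemma eta_preimageE B (V : set (\bar R)) : measurable B -> ~ V +oo%E ->
  [set w | V (eta w B)] =
  \bigcup_(k in [set k : nat | V k%:R%:E]) [set w | eta w B = k%:R%:E].
Proof.
move=> mB Voo; apply/seteqP; split => w /=; last by move=> [k /= Vk ->].
by have [-> //|[k Ek]] := poisson_natE w mB; exists k; rewrite /= -?Ek.
Qed.

Lemma trivIset_eta_eq B :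
  trivIset setT (fun k : nat => [set w | eta w B = k%:R%:E]).
Proof.
apply/trivIsetP => i j _ _ ij; apply/seteqP; split => // w [/= -> /eqP].
by rewrite eqe eqr_nat => /eqP ijE; rewrite ijE eqxx in ij.
Qed.

(** A set without [+oo] is met through countably many point events, whose probabilities are fixed by
    the intensity; a set containing [+oo] is handled by its complement. *)
Lemma poisson_marginal_law B B' : measurable B -> measurable B' ->
  lambda B = lambda B' -> forall V, measurable V ->
  Pr [set w | V (eta w B)] = Pr [set w | V (eta w B')].
Proof.
move=> mB mB' BB'.
have fin V : ~ V +oo%E -> Pr [set w | V (eta w B)] = Pr [set w | V (eta w B')].
  move=> Voo; have sum A : measurable A -> Pr [set w | V (eta w A)] =
      (\sum_(k <oo | k \in [set k : nat | V k%:R%:E]) Pr [set w | eta w A = k%:R%:E])%E.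
    move=> mA; rewrite eta_preimageE// measure_bigcup//.
      by move=> k _; exact: measurable_eta_eq.
    by exact: (sub_trivIset _ (@trivIset_eta_eq A)).
  by rewrite !sum//; apply: eq_eseriesr => k _; exact: poisson_point_law.
move=> V mV; have [Voo|Voo] := pselect (V +oo%E); last exact: fin.
have := fin (~` V) (fun h => h Voo).
rewrite (_ : [set w | (~` V) (eta w B)] = ~` [set w | V (eta w B)])//.
rewrite (_ : [set w | (~` V) (eta w B')] = ~` [set w | V (eta w B')])//.
rewrite !probability_setC; [|exact: measurable_eta_preimage..].
have fn A : measurable A -> Pr [set w | V (eta w A)] \is a fin_num.
  by move=> mA; apply: fin_num_measure; exact: measurable_eta_preimage.
rewrite -(fineK (fn _ mB)) -(fineK (fn _ mB')) -!EFinB => -[h].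
by congr (_%:E); move: h; lra.
Qed.

(** The Poisson masses sum to 1 by the exponential series, which leaves no mass for [+oo]. *)
Lemma poisson_finite_ae B : measurable B -> (lambda B < +oo)%E ->
  {ae Pr, forall w, (eta w B < +oo)%E}.
Proof.
move=> mB Boo; set F := [set w | (eta w B < +oo)%E].
have FE : F = \bigcup_k [set w | eta w B = k%:R%:E].
  rewrite /F (@eta_preimageE B [set x | (x < +oo)%E])//=.
  by apply: eq_bigcupl; split => k //= _; exact: ltry.
have mF : measurable F by rewrite FE; apply: bigcup_measurable => k _; exact: measurable_eta_eq.
suff PF : Pr F = 1%E.
  suff : Pr.-negligible (~` F) by [].
  apply/negligibleP; first exact: measurableC.
  by have := probability_setC Pr mF; rewrite PF subee.
rewrite FE measure_bigcup//; last 2 first.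
- by move=> k _; exact: measurable_eta_eq.
- exact: trivIset_eta_eq.
pose r := fine (lambda B).
have -> : (\sum_(k <oo | k \in setT) Pr [set w | eta w B = k%:R%:E] =
    \sum_(k <oo) (r ^+ k / k`!%:R * expR (- r))%:E)%E.
  rewrite eseries_mkcond; apply: eq_eseriesr => k _; rewrite in_setT.
  exact: (poisson_law eta_poisson).
apply: cvg_lim => //.
rewrite (_ : (fun n => _) = EFin \o (fun n => series (exp_coeff r) n * expR (- r))).
  apply: cvg_EFin; first by near=> n.
  rewrite -(expRxMexpNx_1 r); apply: cvgM; last exact: cvg_cst.
  exact: is_cvg_series_exp_coeff.
apply/funext => n /=; rewrite sumEFin; congr (_%:E).
by rewrite /series /= mulr_suml.
Unshelve. all: by end_near. Qed.

Lemma counts_disjoint_rectangle D m V : (forall i, measurable (D i)) ->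
  trivIset setT D -> (forall i, measurable (V i)) ->
  Pr (counts D @^-1` rectangle m V) = (\prod_(i < m) Pr [set w | V i (eta w (D i))])%E.
Proof.
move=> mD tD mV.
have := poisson_indep eta_poisson (B := fun i : 'I_m => D i) (fun i => mD i).
have t : trivIset setT (fun i : 'I_m => D i).
  apply/trivIsetP => i j _ _ ij; move/trivIsetP : tD; apply => //.
move=> /(_ t (fun i => V i) (fun i => mV i)) <-; congr (Pr _).
apply/seteqP; split => w /= Vw i; last by move=> im; exact: (Vw (Ordinal im)).
by move=> _; exact: Vw.
Qed.

End PoissonLaw.

Section CountsLaw.
Context (R : realType) dO (Omega : measurableType dO) (Pr : probability Omega R).
Context dY (Y : measurableType dY) (lambda : {measure set Y -> \bar R}).
Context (eta : R.-sigmafker Omega ~> Y) (eta_poisson : is_poisson_process Pr lambda eta).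

Local Notation counts := (counts eta).

(** Recovers the counts of sets from those of the atoms composing them; [b i j] tells whether atom
    [j] is part of the i-th set. *)
Definition regroup N (b : nat -> nat -> bool) (k : seqE R) : seqE R :=
  fun i => (\sum_(j < N | b i j) k j)%E.

Lemma measurable_regroup N (b : nat -> nat -> bool) : measurable_fun setT (@regroup N b).
Proof.
apply: measurable_to_seqE => i; rewrite /=.
rewrite (_ : (fun x => _) =
    (fun x : seqE R => \sum_(j < N) if b i j then x j else 0)%E); last first.
  by apply/funext => x; rewrite big_mkcond.
apply: emeasurable_sum => j; case: (b i j); last exact: measurable_cst.
exact: measurable_coord.
Qed.

Lemma counts_regroup N (b : nat -> nat -> bool) m (C D : nat -> set Y) w :
  (forall j, measurable (D j)) ->
  trivIset setT D ->
  (forall i, (i < m)%N -> C i = \big[setU/set0]_(j < N | b i j) D j) ->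
  forall i, (i < m)%N -> counts C w i = regroup N b (counts D w) i.
Proof.
move=> mD tD CD i im; rewrite /counts CD// measure_bigsetU_ord//.
apply/trivIsetP => j k _ _ jk; move/trivIsetP : tD; exact.
Qed.

Lemma counts_regroup_preimage N (b : nat -> nat -> bool) m (C D : nat -> set Y) V :
  (forall j, measurable (D j)) -> trivIset setT D ->
  (forall i, (i < m)%N -> C i = \big[setU/set0]_(j < N | b i j) D j) ->
  counts C @^-1` rectangle m V = counts D @^-1` (regroup N b @^-1` rectangle m V).
Proof.
move=> mD tD CD; have h w := counts_regroup w mD tD CD.
by apply/seteqP; split => w /= Vw i im; [rewrite -h//|rewrite h//]; exact: Vw.
Qed.

Lemma measurable_regroup_preimage N b A : measurable A ->
  measurable (@regroup N b @^-1` A).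
Proof.
by move=> mA; rewrite -[X in measurable X]setTI; exact: measurable_regroup.
Qed.

(** Preimages commute with unions and intersections, so preimages of atoms compose the preimages of
    the [C i]. On disjoint sets the law is a product of laws given by the intensities, which [f]
    preserves. *)
Lemma counts_law (f : Y -> Y) : measurable_fun setT f ->
  (forall B, measurable B -> lambda (f @^-1` B) = lambda B) ->
  forall C, (forall i, measurable (C i)) -> forall A, measurable A ->
  Pr (counts C @^-1` A) = Pr (counts (fun i => f @^-1` C i) @^-1` A).
Proof.
move=> mf f_inv.
have mpre B : measurable B -> measurable (f @^-1` B).
  by move=> mB; rewrite -[X in measurable X]setTI; exact: mf.
have disj D : (forall i, measurable (D i)) -> trivIset setT D ->
    forall A, measurable A ->
    Pr (counts D @^-1` A) = Pr (counts (fun i => f @^-1` D i) @^-1` A).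
  move=> mD tD; apply: seqE_law; [exact: measurable_counts| |move=> m V mV].
    by apply: measurable_counts => i; exact: mpre.
  rewrite !(counts_disjoint_rectangle eta_poisson)//; last 2 first.
  - by move=> i; exact: mpre.
  - apply/trivIsetP => i j _ _ ij; rewrite -preimage_setI.
    by move/trivIsetP : tD => /(_ _ _ I I ij) ->; rewrite preimage_set0.
  apply: eq_bigr => i _; apply: (poisson_marginal_law eta_poisson) => //.
    exact: mpre.
  by rewrite f_inv.
move=> C mC; apply: seqE_law; [exact: measurable_counts| |move=> m V mV].
  by apply: measurable_counts => i; exact: mpre.
have [N [D [b [mD tD _ CD]]]] := disjoint_atoms m mC.
rewrite (counts_regroup_preimage _ mD tD CD).
have mD' j : measurable (f @^-1` D j) by exact: mpre.
have tD' : trivIset setT (fun j => f @^-1` D j).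
  apply/trivIsetP => i j _ _ ij; rewrite -preimage_setI.
  by move/trivIsetP : tD => /(_ _ _ I I ij) ->; rewrite preimage_set0.
have CD' i : (i < m)%N -> f @^-1` C i = \big[setU/set0]_(j < N | b i j) f @^-1` D j.
  by move=> im; rewrite CD// (big_morph _ (preimage_setU f) (preimage_set0 f)).
rewrite (counts_regroup_preimage _ mD' tD' CD').
by apply: disj => //; apply: measurable_regroup_preimage; exact: measurable_rectangle.
Qed.

(** The atoms of the two families lie in [W] and [W'], so together they form one disjoint family, to
    which the independence property of the Poisson process applies. *)
Lemma counts_indep (W W' : set Y) : W `&` W' = set0 ->
  forall C C', (forall i, measurable (C i)) -> (forall i, measurable (C' i)) ->
  (forall i, C i `<=` W) -> (forall i, C' i `<=` W') ->
  forall A A', measurable A -> measurable A' ->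
  Pr (counts C @^-1` A `&` counts C' @^-1` A') =
  (Pr (counts C @^-1` A) * Pr (counts C' @^-1` A'))%E.
Proof.
move=> WW'.
have disj D D' : (forall i, measurable (D i)) -> (forall i, measurable (D' i)) ->
    trivIset setT D -> trivIset setT D' ->
    (forall i, D i `<=` W) -> (forall i, D' i `<=` W') ->
    forall A A', measurable A -> measurable A' ->
    Pr (counts D @^-1` A `&` counts D' @^-1` A') =
    (Pr (counts D @^-1` A) * Pr (counts D' @^-1` A'))%E.
  move=> mD mD' tD tD' DW DW'.
  apply: seqE_indep; [exact: measurable_counts..|move=> m V V' mV mV'].
  rewrite !(counts_disjoint_rectangle eta_poisson)//.
  (* The first [m] sets of [D], then [D'] shifted by [m]: the two rectangles become one of length
     [m + m]. *)
  pose M i := if (i < m)%N then D i else D' (i - m)%N.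
  pose U i := if (i < m)%N then V i else V' (i - m)%N.
  have mM i : measurable (M i) by rewrite /M; case: ifP.
  have mU i : measurable (U i) by rewrite /U; case: ifP.
  have DD' i j : D i `&` D' j = set0.
    by rewrite -subset0 -WW'; exact: setISS.
  have tM : trivIset setT M.
    apply/trivIsetP => i j _ _ ij; rewrite /M.
    case: ifPn => im; case: ifPn => jm.
    - by move/trivIsetP : tD; exact.
    - exact: DD'.
    - by rewrite setIC; exact: DD'.
    - move/trivIsetP : tD'; apply => //.
      apply: contra ij => /eqP; rewrite -!leqNgt in im jm *.
      by move=> /(congr1 (addn^~ m)); rewrite !subnK// => /eqP.
  have -> : counts D @^-1` rectangle m V `&` counts D' @^-1` rectangle m V' =
      counts M @^-1` rectangle (m + m) U.
    apply/seteqP; split => w /=.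
      move=> [h h'] i im; rewrite /counts /M /U; case: ifPn => im'; first exact: h.
      by apply: h'; rewrite -leqNgt in im'; rewrite ltn_subLR.
    move=> h; split => i im.
      by have := h i (ltn_addl _ im); rewrite /counts /M /U im.
    have := h (m + i)%N; rewrite ltn_add2l => /(_ im).
    by rewrite /counts /M /U ltnNge leq_addr /= addKn.
  rewrite (counts_disjoint_rectangle eta_poisson)// big_split_ord /=.
  congr (_ * _)%E; apply: eq_bigr => i _; rewrite /M /U.
    by rewrite ltn_ord.
  by rewrite ltnNge leq_addr /= addKn.
move=> C C' mC mC' CW CW'.
apply: seqE_indep; [exact: measurable_counts..|move=> m V V' mV mV'].
have [N [D [b [mD tD DC CD]]]] := disjoint_atoms m mC.
have [N' [D' [b' [mD' tD' DC' CD']]]] := disjoint_atoms m mC'.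
rewrite (counts_regroup_preimage _ mD tD CD) (counts_regroup_preimage _ mD' tD' CD').
apply: disj => //.
- by move=> j; apply: (subset_trans (DC j)) => y [i _ /CW].
- by move=> j; apply: (subset_trans (DC' j)) => y [i _ /CW'].
- by apply: measurable_regroup_preimage; exact: measurable_rectangle.
- by apply: measurable_regroup_preimage; exact: measurable_rectangle.
Qed.

End CountsLaw.

(** * Sigma-algebras generated by counts *)

Section CountableBasis.
Context d (Y : measurableType d).

(** Indexing the finite intersections of a countable generator by finite sequences keeps them
    countable and turns intersection into concatenation. *)
Lemma countable_pi_system : countably_generated Y ->
  exists G : seq nat -> set Y, [/\ @measurable _ Y = <<s range G >>, G [::] = setT &
    forall s t, G s `&` G t = G (s ++ t)].
Proof.
move=> [G cG Gm]; have [f finj] := (countable_injP _ cG).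
(* [g] enumerates [G] along an injection into the naturals, with [setT] at the indices outside its
   image. *)
pose g i := if pselect (exists2 A, G A & f A = i) is left h then s2val (cid2 h) else setT.
have gf A : G A -> g (f A) = A.
  move=> GA; rewrite /g; case: pselect => [h|]; last by case; exists A.
  by case: cid2 => B /= GB fB; apply: finj => //; exact/mem_set.
have gG i : G (g i) \/ g i = setT.
  by rewrite /g; case: pselect => [h|]; [left; case: cid2|right].
pose Gs (s : seq nat) := \big[setI/setT]_(i <- s) g i.
exists Gs; split; last 2 first.
- by rewrite /Gs big_nil.
- by move=> s t; rewrite /Gs big_cat.
rewrite Gm; apply/seteqP; split; apply: smallest_sub.
- exact: smallest_sigma_algebra.
- move=> A GA; apply: sub_sigma_algebra; exists [:: f A] => //.
  by rewrite /Gs big_seq1 gf.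
- exact: smallest_sigma_algebra.
- move=> _ [s _ <-]; rewrite -Gm; apply: bigsetI_measurable => i _.
  have [|->//] := gG i; rewrite Gm; exact: sub_sigma_algebra.
Qed.

End CountableBasis.

Section CompleteSigmaAlgebra.
Context (R : realType) dO (Omega : measurableType dO) (Pr : probability Omega R).
Hypothesis Pr_complete : measure_is_complete Pr.

Lemma negligibleY_refl (A : set Omega) : Pr.-negligible (A `+` A).
Proof. by rewrite setYK; exact: negligible_set0. Qed.

Lemma negligibleY_sym (A B : set Omega) : Pr.-negligible (A `+` B) ->
  Pr.-negligible (B `+` A).
Proof. by rewrite setYC. Qed.

Lemma negligibleY_trans (A B C : set Omega) : Pr.-negligible (A `+` B) ->
  Pr.-negligible (B `+` C) -> Pr.-negligible (A `+` C).
Proof.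
move=> AB BC; apply: negligibleS (negligibleU AB BC) => x /= [[Ax Cx]|[Cx Ax]].
  by have [Bx|Bx] := pselect (B x); [right; left|left; left].
by have [Bx|Bx] := pselect (B x); [left; right|right; right].
Qed.

Lemma negligibleYC (A B : set Omega) : Pr.-negligible (A `+` B) ->
  Pr.-negligible (~` A `+` ~` B).
Proof.
apply: negligibleS => x /= [[Ax Bx]|[Bx Ax]].
  by right; split => //; exact: contrapT.
by left; split => //; exact: contrapT.
Qed.

Lemma negligibleY_bigcup (A B : nat -> set Omega) :
  (forall n, Pr.-negligible (A n `+` B n)) ->
  Pr.-negligible (\bigcup_n A n `+` \bigcup_n B n).
Proof.
move=> AB; apply: negligibleS (negligible_bigcup AB) => x /= [[[n _ An] Bx]|[[n _ Bn] Ax]].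
  by exists n => //; left; split => // Bn; apply: Bx; exists n.
by exists n => //; right; split => // An; apply: Ax; exists n.
Qed.

Lemma negligibleY_ae (T : Type) (f g : Omega -> T) (V : set T) :
  {ae Pr, forall w, f w = g w} -> Pr.-negligible ((f @^-1` V) `+` (g @^-1` V)).
Proof.
by apply: negligibleS => w /= [[h1 h2]|[h1 h2]] fg; apply: h2; rewrite ?fg// -fg.
Qed.

Lemma complete_measurable (A B : set Omega) : measurable B ->
  Pr.-negligible (A `+` B) -> measurable A.
Proof.
move=> mB AB.
have -> : A = (B `\` (B `\` A)) `|` (A `\` B).
  apply/seteqP; split => x; last first.
    by move=> [[Bx nBA]|[]//]; apply: contrapT => Ax; exact: nBA.
  move=> Ax; have [Bx|Bx] := pselect (B x); last by right.
  by left; split => // -[].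
apply: measurableU; last by apply/Pr_complete/negligibleS/AB => x; left.
by apply: measurableD => //; apply/Pr_complete/negligibleS/AB => x; right.
Qed.

(** The comparison target for [sigma_eta], a smallest complete sigma-algebra: once the generating
    events belong to this family, every event of [sigma_eta] is an event of [Phi] up to a null
    set. *)
Lemma complete_preimage_sigma_algebra d (T : measurableType d) (Phi : Omega -> T) :
  measurable_fun setT Phi -> complete_sub_sigma_algebra Pr
    [set D | exists2 V, measurable V & Pr.-negligible (D `+` Phi @^-1` V)].
Proof.
move=> mPhi; have mpre V : measurable V -> measurable (Phi @^-1` V).
  by move=> mV; rewrite -[X in measurable X]setTI; exact: mPhi.
split.
- split.
  + by exists set0 => //; rewrite preimage_set0; exact: negligibleY_refl.
  + move=> A [V mV AV]; exists (~` V); first exact: measurableC.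
    by rewrite setTD; exact: negligibleYC.
  + move=> A hA; have ex n : exists V, measurable V /\ Pr.-negligible (A n `+` Phi @^-1` V).
      by have [V mV AV] := hA n; exists V.
    have [V VP] := choice ex; exists (\bigcup_n V n).
      by apply: bigcup_measurable => n _; have [] := VP n.
    by rewrite preimage_bigcup; apply: negligibleY_bigcup => n; have [] := VP n.
- by move=> A [V mV AV]; apply: complete_measurable AV; exact: mpre.
- move=> A B [V mV BV] AB; exists V => //; exact: negligibleY_trans BV.
Qed.

End CompleteSigmaAlgebra.

(** In this form the summands may be replaced by functions [h i] of a sequence, which have no sign
    and whose series need not converge at every argument: the upper limit is measurable all the
    same. *)
Lemma measure_bigcup_limn_esup d (T : measurableType d) (R : realType)
    (mu : {measure set T -> \bar R}) (F : nat -> set T) :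
  (forall n, measurable (F n)) -> trivIset setT F ->
  mu (\bigcup_n F n) = limn_esup (fun n => \sum_(0 <= i < n) mu (F i))%E.
Proof.
move=> mF tF.
have := measure_semi_sigma_additive F mF tF (bigcup_measurable (fun n _ => mF n)).
by move=> /(_ _ mu) /cvg_limn_einf_sup[_ ->].
Qed.

Section SigmaEta.
Context (R : realType) dO (Omega : measurableType dO) (Pr : probability Omega R).
Hypothesis Pr_complete : measure_is_complete Pr.
Context dY (Y : measurableType dY) (lambda : {sigma_finite_measure set Y -> \bar R}).
Context (eta : R.-sigmafker Omega ~> Y) (eta_poisson : is_poisson_process Pr lambda eta).

Local Notation counts := (counts eta).
Local Notation sigma_eta := (sigma_eta Pr eta).

Lemma complete_measurable_sigma_algebra :
  complete_sub_sigma_algebra Pr (@measurable _ Omega).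
Proof.
split => //; first exact: sigma_algebra_measurable.
by move=> A B mB; exact: complete_measurable.
Qed.

Lemma sigma_eta_gen A B V : measurable B -> B `<=` A -> measurable V ->
  sigma_eta A [set w | V (eta w B)].
Proof. by move=> mB BA mV; apply: sub_gen_smallest; exists B, V. Qed.

Lemma sigma_eta_sub A (G : set (set Omega)) : complete_sub_sigma_algebra Pr G ->
  (forall B V, measurable B -> B `<=` A -> measurable V -> G [set w | V (eta w B)]) ->
  sigma_eta A `<=` G.
Proof.
by move=> cG AG; apply: smallest_sub => // _ [B [V [mB BA mV ->]]]; exact: AG.
Qed.

Lemma sigma_eta_measurable A : sigma_eta A `<=` measurable.
Proof.
apply: sigma_eta_sub; first exact: complete_measurable_sigma_algebra.
by move=> B V mB _; exact: measurable_eta_preimage.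
Qed.

Lemma sigma_eta_complete A : complete_sub_sigma_algebra Pr (sigma_eta A).
Proof.
split; [split| |].
- by move=> G [[[G0 _ _] _ _] _].
- move=> B hB G hG; have [[[_ GC _] _ _] _] := hG.
  by apply: GC; exact: hB.
- move=> F hF G hG; have [[[_ _ GU] _ _] _] := hG.
  by apply: GU => n; exact: hF.
- exact: sigma_eta_measurable.
- move=> B C hC BC G hG; have [[_ _ Gc] _] := hG.
  by apply: Gc BC; exact: hC.
Qed.

Lemma sigma_eta_sigma_algebra A : sigma_algebra setT (sigma_eta A).
Proof. by have [] := sigma_eta_complete A. Qed.

Lemma sigma_etaS A B : A `<=` B -> sigma_eta A `<=` sigma_eta B.
Proof.
move=> AB; apply: sigma_eta_sub; first exact: sigma_eta_complete.
by move=> C V mC CA mV; apply: sigma_eta_gen => //; exact: subset_trans AB.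
Qed.

(* B enumerates the traces of a countable generating pi-system on a partition
   into sets of finite intensity, where the counts are almost surely finite. *)
Lemma counts_basis : countably_generated Y ->
  exists B : nat -> set Y, (forall i, measurable (B i)) /\
  forall W C, measurable W -> measurable C -> C `<=` W ->
  exists2 h : seqE R -> \bar R, measurable_fun setT h &
    {ae Pr, forall w, eta w C = h (counts (fun i => B i `&` W) w)}.
Proof.
move=> /countable_pi_system[G [Gm GT GI]].
have mG s : measurable (G s) by rewrite Gm; apply: sub_sigma_algebra; exists s.
have [F0 F0T F0P] := sigma_finiteT lambda.
pose F := seqDU F0.
have mF k : measurable (F k).
  apply: measurableD; first by have [] := F0P k.
  by apply: bigsetU_measurable => i _; have [] := F0P i.
have Foo k : (lambda (F k) < +oo)%E.
  have [m0 f0] := F0P k; apply: le_lt_trans f0.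
  by apply: le_measure; rewrite ?inE//; exact: subset_seqDU.
have FT : \bigcup_k F k = setT by rewrite -seqDU_bigcup_eq F0T.
have tF : trivIset setT F := trivIset_seqDU F0.
pose B i := if unpickle i is Some sk then G (sk : seq nat * nat).1 `&` F sk.2 else set0.
have mB i : measurable (B i).
  by rewrite /B; case: unpickle => // -[s k]; exact: measurableI.
exists B; split => // W C mW mC CW.
pose Phi := counts (fun i => B i `&` W).
have mBW i : measurable (B i `&` W) by exact: measurableI.
(* On each piece a Dynkin argument: complements become differences of counts, legitimate because the
   count of [F k] within [W] is almost surely finite. *)
pose Z k := [set A : set Y | measurable A /\
    exists2 h : seqE R -> \bar R, measurable_fun setT h &
    {ae Pr, forall w, eta w (A `&` F k `&` W) = h (Phi w)}].
have key k : measurable `<=` Z k.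
  have GD : setI_closed (range G).
    by move=> _ _ [s _ <-] [t _ <-]; rewrite GI; exists (s ++ t).
  rewrite Gm -setI_closed_g_dynkin_g_sigma_algebra//.
  apply: smallest_sub; last first.
    move=> _ [s _ <-]; split => //.
    exists (fun x : seqE R => x (pickle (s, k))); first exact: measurable_coord.
    by apply: aeW => w; rewrite /Phi /counts /B pickleK.
  have base s : exists2 h : seqE R -> \bar R, measurable_fun setT h &
      {ae Pr, forall w, eta w (G s `&` F k `&` W) = h (Phi w)}.
    exists (fun x : seqE R => x (pickle (s, k))); first exact: measurable_coord.
    by apply: aeW => w; rewrite /Phi /counts /B pickleK.
  have fin : {ae Pr, forall w, (eta w (F k `&` W) < +oo)%E}.
    apply: (poisson_finite_ae eta_poisson); first exact: measurableI.
    apply: le_lt_trans (Foo k); apply: le_measure; rewrite ?inE//.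
    exact: measurableI.
  split.
  - by split => //; rewrite -GT; exact: base.
  - move=> A [mA [h mh hA]]; split; first exact: measurableC.
    have [h' mh' h'T] := base [::]; rewrite GT in h'T.
    exists (fun x => h' x - h x)%E; first exact: emeasurable_funB.
    apply: filterS3 fin hA h'T => w fw <- <-; rewrite setTI.
    have -> : ~` A `&` F k `&` W = (F k `&` W) `\` (A `&` F k `&` W).
      apply/seteqP; split => y; first by move=> [[nA Fy] Wy]; split => // -[[]].
      by move=> [[Fy Wy] nA]; split => //; split => // Ay; apply: nA.
    rewrite measureD//; try exact: measurableI.
      congr (_ - eta w _)%E; apply: setIidr.
      by move=> y [[]].
    by apply: measurableI => //; exact: measurableI.
  - move=> A tA hA; have mA n : measurable (A n) by have [] := hA n.
    split; first exact: bigcup_measurable.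
    have ex n : exists h : seqE R -> \bar R, measurable_fun setT h /\
        {ae Pr, forall w, eta w (A n `&` F k `&` W) = h (Phi w)}.
      by have [_ [h mh hE]] := hA n; exists h.
    have [h hP] := choice ex.
    exists (fun x => limn_esup (fun n => \sum_(0 <= i < n) h i x)%E).
      apply: measurable_fun_limn_esup => n; apply: emeasurable_sum => i.
      by have [] := hP i.
    have hE : {ae Pr, forall w n, eta w (A n `&` F k `&` W) = h n (Phi w)}.
      by apply/ae_foralln => n; have [] := hP n.
    apply: filterS hE => w hw; rewrite !setI_bigcupl.
    have mAn n : measurable (A n `&` F k `&` W).
      by apply: measurableI => //; exact: measurableI.
    have tAn : trivIset setT (fun n => A n `&` F k `&` W).
      by apply: trivIset_setIr; exact: trivIset_setIr.
    rewrite measure_bigcup_limn_esup//; congr limn_esup; apply/funext => n.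
    by apply: eq_bigr => i _; rewrite hw.
have ex k : exists h : seqE R -> \bar R, measurable_fun setT h /\
    {ae Pr, forall w, eta w (C `&` F k) = h (Phi w)}.
  have [_ [h mh hE]] := key k C mC; exists h; split => //.
  apply: filterS hE => w <-; congr (eta w _); apply/esym/setIidl.
  by move=> y [/CW].
have [h hP] := choice ex.
exists (fun x => limn_esup (fun n => \sum_(0 <= i < n) h i x)%E).
  apply: measurable_fun_limn_esup => n; apply: emeasurable_sum => i.
  by have [] := hP i.
have hE : {ae Pr, forall w n, eta w (C `&` F n) = h n (Phi w)}.
  by apply/ae_foralln => n; have [] := hP n.
apply: filterS hE => w hw.
have mCF n : measurable (C `&` F n) by exact: measurableI.
have tCF : trivIset setT (fun n => C `&` F n) by exact: trivIset_setIl.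
rewrite -[C in LHS]setIT -FT setI_bigcupr measure_bigcup_limn_esup//.
by congr limn_esup; apply/funext => n; apply: eq_bigr => i _; rewrite hw.
Qed.

End SigmaEta.

Section NegligibleMeasure.
Context (R : realType) d (T : measurableType d) (P : probability T R).

Lemma measure_negligibleY (A B : set T) : measurable A -> measurable B ->
  P.-negligible (A `+` B) -> P A = P B.
Proof.
move=> mA mB AB; have le (C D : set T) : measurable C -> measurable D ->
    P.-negligible (C `+` D) -> (P C <= P D)%E.
  move=> mC mD CD; have h : P (C `\` D) = 0%E.
    apply: measure_negligible; first exact: measurableD.
    by apply: negligibleS CD => x; left.
  have mCD : measurable (C `\` D) by exact: measurableD.
  rewrite -[leRHS]adde0 -h; apply: le_trans (measureU2 P mD mCD).
  apply: le_measure; rewrite ?inE//; first exact: measurableU.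
  by move=> x Cx; have [Dx|Dx] := pselect (D x); [left|right].
by apply/eqP; rewrite eq_le !le//; exact: negligibleY_sym.
Qed.

End NegligibleMeasure.

Section CountsFactor.
Context (R : realType) dO (Omega : measurableType dO) (Pr : probability Omega R).
Hypothesis Pr_complete : measure_is_complete Pr.
Context dY (Y : measurableType dY) (lambda : {measure set Y -> \bar R}).
Context (eta : R.-sigmafker Omega ~> Y) (eta_poisson : is_poisson_process Pr lambda eta).

Local Notation counts := (counts eta).
Local Notation sigma_eta := (sigma_eta Pr eta).

Definition counts_basis_spec (B : nat -> set Y) :=
  (forall i, measurable (B i)) /\
  forall W C, measurable W -> measurable C -> C `<=` W ->
  exists2 h : seqE R -> \bar R, measurable_fun setT h &
    {ae Pr, forall w, eta w C = h (counts (fun i => B i `&` W) w)}.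

Variables (B : nat -> set Y) (B_basis : counts_basis_spec B).

Definition window_counts (W : set Y) (w : Omega) := counts (fun i => B i `&` W) w.

Let mB i : measurable (B i). Proof. exact: B_basis.1. Qed.

Let mBW W i : measurable W -> measurable (B i `&` W).
Proof. by move=> mW; exact: measurableI. Qed.

Lemma measurable_window_counts W : measurable W ->
  measurable_fun setT (window_counts W).
Proof. by move=> mW; apply: measurable_counts => i; exact: mBW. Qed.

Lemma sigma_eta_window_counts W : measurable W -> sigma_eta W `<=`
  [set D | exists2 V, measurable V & Pr.-negligible (D `+` window_counts W @^-1` V)].
Proof.
move=> mW; apply: sigma_eta_sub.
  by apply: complete_preimage_sigma_algebra => //; exact: measurable_window_counts.
move=> C V mC CW mV; have [h mh hE] := B_basis.2 W C mW mC CW.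
exists (h @^-1` V); first by rewrite -[X in measurable X]setTI; exact: mh.
exact: (negligibleY_ae V hE).
Qed.

(** Doob-Dynkin for a window: the functions of the window counts form a closed subspace that
    contains the indicators of all events of the window. *)
Lemma window_factors W (u : L2 Pr) : measurable W ->
  u \in G_measurable (sigma_eta W) -> factors (window_counts W) u.
Proof.
move=> mW; apply: closed_subspace_G_measurable.
- exact: factors_closed_subspace.
- exact: sigma_eta_sigma_algebra.
- exact: sigma_eta_measurable.
- move=> A sA; have [V mV AV] := sigma_eta_window_counts mW sA.
  exists (cindic R V); first exact: measurable_cindic.
  have mA := sigma_eta_measurable Pr_complete sA.
  have mpV : measurable (window_counts W @^-1` V).
    by rewrite -[X in measurable X]setTI; exact: measurable_window_counts.
  rewrite (L2ind_ae mA mpV AV); apply: filterS (L2indE Pr mpV) => w + _.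
  by move=> -> // .
Qed.

Lemma measurable_counts_sigma_eta W (C : nat -> set Y) :
  (forall i, measurable (C i)) -> (forall i, C i `<=` W) ->
  measurable_fun setT (counts C : g_sigma_algebraType (sigma_eta W) -> seqE R).
Proof.
move=> mC CW; apply: measurable_to_seqE => i _ V mV; rewrite setTI.
by apply: sub_sigma_algebra; exact: sigma_eta_gen.
Qed.

Lemma G_measurable_counts W (C : nat -> set Y) (g : seqE R -> R[i]) (u : L2 Pr) :
  (forall i, measurable (C i)) -> (forall i, C i `<=` W) ->
  measurable_fun setT g -> u = g \o counts C %[ae Pr] ->
  u \in G_measurable (sigma_eta W).
Proof.
move=> mC CW mg ug; apply/asboolP; exists (g \o counts C) => //.
by apply: measurableT_comp => //; exact: measurable_counts_sigma_eta.
Qed.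

(** Both events are replaced, up to null sets, by events of the window counts, and these are
    independent because the windows are disjoint. *)
Lemma sigma_eta_indep W W' : measurable W -> measurable W' -> W `&` W' = set0 ->
  forall D D', sigma_eta W D -> sigma_eta W' D' ->
  Pr (D `&` D') = (Pr D * Pr D')%E.
Proof.
move=> mW mW' WW' D D' sD sD'.
have mD := sigma_eta_measurable Pr_complete sD.
have mD' := sigma_eta_measurable Pr_complete sD'.
have [V mV DV] := sigma_eta_window_counts mW sD.
have [V' mV' DV'] := sigma_eta_window_counts mW' sD'.
have mpV : measurable (window_counts W @^-1` V).
  by rewrite -[X in measurable X]setTI; exact: measurable_window_counts.
have mpV' : measurable (window_counts W' @^-1` V').
  by rewrite -[X in measurable X]setTI; exact: measurable_window_counts.
rewrite (measure_negligibleY mD mpV DV) (measure_negligibleY mD' mpV' DV').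
rewrite -(counts_indep eta_poisson WW')//.
- apply: measure_negligibleY; [exact: measurableI|exact: measurableI|].
  apply: negligibleS (negligibleU DV DV') => w /= [[[Dw Dw'] nV]|[[Vw Vw'] nD]].
    have [Vw|Vw] := pselect ((window_counts W @^-1` V) w); last by left; left.
    by right; left; split => // Vw'; apply: nV.
  have [Dw|Dw] := pselect (D w); last by left; right.
  by right; right; split => // Dw'; apply: nD.
- by move=> i; exact: mBW.
- by move=> i; exact: mBW.
Qed.

(** Finite lists of pairs (index, value) form a countable type in which concatenation is
    intersection, so the cylinders are a countable pi-system. The value [+oo] is never
    prescribed. *)
Definition cylinder W (s : seq (nat * nat)) : set Omega :=
  [set w | forall p, p \in s -> eta w (B p.1 `&` W) = p.2%:R%:E].

Lemma cylinder_cat W s t : cylinder W s `&` cylinder W t = cylinder W (s ++ t).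
Proof.
apply/seteqP; split => w.
  by move=> [hs ht] p; rewrite mem_cat => /orP[]; [exact: hs|exact: ht].
by move=> h; split => p ps; apply: h; rewrite mem_cat ps ?orbT.
Qed.

Lemma cylinder_nil W : cylinder W [::] = setT.
Proof. by apply/seteqP; split. Qed.

Lemma cylinder_cons W p s : cylinder W (p :: s) =
  [set w | eta w (B p.1 `&` W) = p.2%:R%:E] `&` cylinder W s.
Proof.
apply/seteqP; split => w; last first.
  by move=> [h1 h2] q; rewrite in_cons => /orP[/eqP ->//|]; exact: h2.
move=> h; split; first by apply: h; rewrite in_cons eqxx.
by move=> q qs; apply: h; rewrite in_cons qs orbT.
Qed.

Lemma sigma_eta_cylinder W s : measurable W -> sigma_eta W (cylinder W s).
Proof.
move=> mW; have [s0 sC sU] := sigma_eta_sigma_algebra Pr_complete eta W.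
have sI : setI_closed (sigma_eta W).
  by have [] := (sigma_algebraP (fun _ _ => @subsetT _ _)).1 (sigma_eta_sigma_algebra Pr_complete eta W).
elim: s => [|p s ih]; first by rewrite cylinder_nil -(setD0 setT); exact: sC.
rewrite cylinder_cons; apply: sI => //.
by apply: (sigma_eta_gen (V := [set p.2%:R%:E])) => //; exact: mBW.
Qed.

Lemma measurable_cylinder W s : measurable W -> measurable (cylinder W s).
Proof.
by move=> mW; apply: (sigma_eta_measurable Pr_complete (sigma_eta_cylinder s mW)).
Qed.

(** Finite values are enough: a set of values without [+oo] gives a countable union of cylinders,
    and a set containing [+oo] the complement of such a union. *)
Lemma sigma_eta_cylinders W : measurable W ->
  sigma_eta W `<=` ae_completion Pr (range (cylinder W)).
Proof.
move=> mW D sD; split; first exact: sigma_eta_measurable sD.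
have [V mV DV] := sigma_eta_window_counts mW sD; exists (window_counts W @^-1` V) => //.
move: V mV {DV}; rewrite /measurable /=.
pose S := <<s range (cylinder W)>>.
have sS : sigma_algebra setT S by exact: smallest_sigma_algebra.
have [S0 SC SU] := sS.
suff : <<s coord_cylinder (R:=R)>> `<=` [set V | S (window_counts W @^-1` V)] by exact.
apply: smallest_sub.
  split.
  - by rewrite /= preimage_set0.
  - by move=> A hA /=; rewrite setTD preimage_setC -setTD; exact: SC.
  - by move=> F hF /=; rewrite preimage_bigcup; exact: SU.
have fin i V : ~ V +oo%E -> S [set w | V (eta w (B i `&` W))].
  move=> Voo; rewrite (eta_preimageE eta_poisson (mBW i mW) Voo).
  rewrite bigcup_mkcond; apply: SU => k; case: ifP => // _.
  apply: sub_sigma_algebra; exists [:: (i, k)] => //.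
  by rewrite cylinder_cons cylinder_nil setIT.
move=> _ [i [V [mV ->]]] /=; have [Voo|Voo] := pselect (V +oo%E); last exact: (fin i).
rewrite (_ : _ @^-1` _ = setT `\` [set w | (~` V) (eta w (B i `&` W))]).
  by apply: SC; apply: fin => /(_ Voo).
apply/seteqP; split => w /=; first by move=> Vw; split.
by move=> [_ h]; apply: contrapT.
Qed.

End CountsFactor.

(** * Translation unitaries *)

Section CountsShift.
Context (R : realType) dO (Omega : measurableType dO) (Pr : probability Omega R).
Hypothesis Pr_complete : measure_is_complete Pr.
Context dY (Y : measurableType dY) (lambda : {measure set Y -> \bar R}).
Context (eta : R.-sigmafker Omega ~> Y) (eta_poisson : is_poisson_process Pr lambda eta).
Hypothesis Omega_generated : measurable = sigma_eta Pr eta setT.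

Local Notation counts := (counts eta).
Local Notation sigma_eta := (sigma_eta Pr eta).
Local Notation nrm := (ip_norm (@L2ip _ _ _ Pr)).

Variables (B : nat -> set Y) (B_basis : counts_basis_spec Pr eta B).

Let mB i : measurable (B i). Proof. exact: B_basis.1. Qed.

Lemma all_factors (u : L2 Pr) : factors (counts B) u.
Proof.
have : u \in G_measurable (sigma_eta setT).
  apply/asboolP; exists (u : Omega -> R[i]); last exact: ae_eq_refl.
  move=> _ V mV; rewrite /measurable /= -Omega_generated.
  by apply: sub_sigma_algebra; exact: (measurable_L0 u).
move=> /(window_factors Pr_complete B_basis measurableT).
move=> [g mg ug]; exists g => //; apply: filterS ug => w /[apply] ->.
by congr g; apply/funext => i; rewrite /window_counts /counts setIT.
Qed.

Variable f : Y -> Y.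
Hypotheses (mf : measurable_fun setT f)
  (f_inv : forall A, measurable A -> lambda (f @^-1` A) = lambda A).

Let mpre A : measurable A -> measurable (f @^-1` A).
Proof. by move=> mA; rewrite -[X in measurable X]setTI; exact: mf. Qed.

Lemma counts_preimage_integral (C : nat -> set Y) (h : seqE R -> \bar R) :
  (forall i, measurable (C i)) -> measurable_fun setT h -> (forall k, (0 <= h k)%E) ->
  (\int[Pr]_w h (counts (fun i => f @^-1` C i) w) = \int[Pr]_w h (counts C w))%E.
Proof.
move=> mC mh h0.
have mfC i : measurable (f @^-1` C i) by exact: mpre.
pose X : {mfun Omega >-> seqE R} := HB.pack (counts C)
  (isMeasurableFun.Build _ _ _ _ _ (measurable_counts eta mC)).
pose X' : {mfun Omega >-> seqE R} := HB.pack (counts (fun i => f @^-1` C i))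
  (isMeasurableFun.Build _ _ _ _ _ (measurable_counts eta mfC)).
transitivity (\int[distribution Pr X']_k h k)%E.
  by rewrite ge0_integral_distribution.
transitivity (\int[distribution Pr X]_k h k)%E; last first.
  by rewrite ge0_integral_distribution.
apply: eq_measure_integral => A mA _.
exact/esym/(counts_law eta_poisson mf f_inv mC).
Qed.

(** Merges two families into one, so that the joint law of their counts becomes the law of one
    sequence. *)
Definition interleave (C D : nat -> set Y) (i : nat) : set Y :=
  if odd i then D i./2 else C i./2.

(** The identity says that the merged count sequence lies almost surely in a fixed measurable set
    [A]. This is a property of its law, which [counts_law] preserves. *)
Lemma counts_ae_preimage (C D : nat -> set Y) (g h : seqE R -> R[i]) :
  (forall i, measurable (C i)) -> (forall i, measurable (D i)) ->
  measurable_fun setT g -> measurable_fun setT h ->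
  {ae Pr, forall w, g (counts C w) = h (counts D w)} ->
  {ae Pr, forall w, g (counts (fun i => f @^-1` C i) w) =
     h (counts (fun i => f @^-1` D i) w)}.
Proof.
move=> mC mD mg mh gh.
pose ev (k : seqE R) : seqE R := fun i => k i.*2.
pose od (k : seqE R) : seqE R := fun i => k i.*2.+1.
have mev : measurable_fun setT ev.
  by apply: measurable_to_seqE => i; exact: measurable_coord.
have mod' : measurable_fun setT od.
  by apply: measurable_to_seqE => i; exact: measurable_coord.
pose A := [set k : seqE R | g (ev k) = h (od k)].
have mA : measurable A.
  pose s (k : seqE R) := sqmod (g (ev k) + (-1) * h (od k)).
  have ms : measurable_fun setT s.
    apply: (measurableT_comp (@measurable_sqmod R)).
    apply: measurable_complexD; first exact: measurableT_comp.
    by apply: measurable_complexZ; exact: measurableT_comp.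
  rewrite (_ : A = s @^-1` [set 0]).
    by rewrite -[X in measurable X]setTI; exact: ms.
  apply/seteqP; split => k; rewrite /A /s /= mulN1r.
    by move=> ->; rewrite subrr; apply/eqP; rewrite sqmod_eq0.
  by move=> /eqP; rewrite sqmod_eq0 subr_eq0 => /eqP.
pose M := interleave C D.
have mM i : measurable (M i) by rewrite /M /interleave; case: ifP.
have mfM i : measurable (f @^-1` M i) by exact: mpre.
have evM (C' D' : nat -> set Y) w : ev (counts (interleave C' D') w) = counts C' w.
  by apply/funext => i; rewrite /ev /counts /interleave odd_double doubleK.
have odM (C' D' : nat -> set Y) w : od (counts (interleave C' D') w) = counts D' w.
  apply/funext => i; rewrite /od /counts /interleave /= odd_double /=.
  by rewrite uphalf_double.
have PA : Pr (counts M @^-1` (~` A)) = 0%E.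
  apply: measure_negligible.
    rewrite -[X in measurable X]setTI; apply: measurable_counts => //.
    exact: measurableC.
  by apply: negligibleS gh => w /=; rewrite /A /= evM odM.
have PA' : Pr (counts (fun i => f @^-1` M i) @^-1` (~` A)) = 0%E.
  rewrite -(counts_law eta_poisson mf f_inv mM)//.
  exact: measurableC.
have : Pr.-negligible (counts (fun i => f @^-1` M i) @^-1` (~` A)).
  apply/negligibleP => //.
  rewrite -[X in measurable X]setTI; apply: measurable_counts => //.
  exact: measurableC.
have -> : (fun i => f @^-1` M i) =
    interleave (fun i => f @^-1` C i) (fun i => f @^-1` D i).
  by apply/funext => i; rewrite /M /interleave; case: ifP.
by apply: negligibleS => w /=; rewrite /A /= evM odM.
Qed.

(** Each [u] is given one representation on the basis [B]; [counts_ae_preimage] carries the formula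
    over to every other representation. *)
Lemma shift_exists : exists U : L2 Pr -> L2 Pr,
  forall C (g : seqE R -> R[i]) (u : L2 Pr), (forall i, measurable (C i)) ->
  measurable_fun setT g ->
  u = g \o counts C %[ae Pr] ->
  U u = g \o counts (fun i => f @^-1` C i) %[ae Pr].
Proof.
have mfB i : measurable (f @^-1` B i) by exact: mpre.
have ex (u : L2 Pr) : exists v : L2 Pr, exists g : seqE R -> R[i],
    [/\ measurable_fun setT g, u = g \o counts B %[ae Pr] &
        v = g \o counts (fun i => f @^-1` B i) %[ae Pr]].
  have [g mg ug] := all_factors u.
  have mgB : measurable_fun setT (g \o counts B).
    by apply: measurableT_comp => //; exact: measurable_counts.
  have mgfB : measurable_fun setT (g \o counts (fun i => f @^-1` B i)).
    by apply: measurableT_comp => //; exact: measurable_counts.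
  have lty : (\int[Pr]_w (sqmod ((g \o counts (fun i => f @^-1` B i)) w))%:E < +oo)%E.
    rewrite (counts_preimage_integral (h := fun k => (sqmod (g k))%:E))//.
    - exact: L2_sq_lty ug.
    - exact: measurable_sqmodE.
    - by move=> k; rewrite lee_fin sqmod_ge0.
  by exists (mkL2 mgfB lty), g; split => //; exact: mkL2E.
have [U UP] := choice ex; exists U => C g u mC mg ug.
have [h [mh uh Uh]] := UP u.
have gh : {ae Pr, forall w, g (counts C w) = h (counts B w)}.
  by apply: filterS2 ug uh => w /(_ I) /= <- /(_ I).
apply: filterS2 (counts_ae_preimage mC mB mg mh gh) Uh => w /= -> /(_ I) + _.
by [].
Qed.

Definition shiftU : L2 Pr -> L2 Pr := projT1 (cid shift_exists).

Lemma shiftU_counts C (g : seqE R -> R[i]) (u : L2 Pr) : (forall i, measurable (C i)) ->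
  measurable_fun setT g -> u = g \o counts C %[ae Pr] ->
  shiftU u = g \o counts (fun i => f @^-1` C i) %[ae Pr].
Proof. exact: (projT2 (cid shift_exists)). Qed.

Lemma shiftU_lin k u v : shiftU (k *: u + v) = k *: shiftU u + shiftU v.
Proof.
have [g mg ug] := all_factors u; have [h mh vh] := all_factors v.
apply: L2_inj; have := L2_lin k (shiftU_counts mB mg ug) (shiftU_counts mB mh vh).
have mgh : measurable_fun setT (fun x => k * g x + h x).
  by apply: measurable_complexD => //; exact: measurable_complexZ.
apply: filterS2 (shiftU_counts mB mgh (L2_lin k ug vh)) => w + + _.
by move=> -> // ->.
Qed.

Lemma shiftU_mul (u v w : L2 Pr) : w = (fun x => u x * v x) %[ae Pr] ->
  shiftU w = (fun x => shiftU u x * shiftU v x) %[ae Pr].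
Proof.
move=> wuv; have [g mg ug] := all_factors u; have [h mh vh] := all_factors v.
have mgh : measurable_fun setT (fun x => g x * h x) by exact: measurable_complexM.
have wE : w = (fun x => g x * h x) \o counts B %[ae Pr].
  by apply: filterS3 wuv ug vh => x + + + _; move=> -> // -> // -> .
apply: filterS3 (shiftU_counts mB mgh wE) (shiftU_counts mB mg ug)
  (shiftU_counts mB mh vh) => x + + + _.
by move=> -> // -> // -> .
Qed.

Lemma shiftU_norm u : nrm (shiftU u) = nrm u.
Proof.
have [g mg ug] := all_factors u.
have mfB i : measurable (f @^-1` B i) by exact: mpre.
apply/eqP; rewrite -(@eqrXn2 _ 2) ?ip_norm_ge0//; apply/eqP/EFin_inj.
rewrite (L2_norm_sqrE _ ug); last first.
  by apply: measurableT_comp => //; exact: measurable_counts.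
rewrite (L2_norm_sqrE _ (shiftU_counts mB mg ug)); last first.
  by apply: measurableT_comp => //; exact: measurable_counts.
apply: (counts_preimage_integral (h := fun k => (sqmod (g k))%:E)) => //.
  exact: measurable_sqmodE.
by move=> k; rewrite lee_fin sqmod_ge0.
Qed.

Lemma shiftUB u v : shiftU (u - v) = shiftU u - shiftU v.
Proof. by rewrite addrC -scaleN1r shiftU_lin scaleN1r addrC. Qed.

Lemma shiftUZ k u : shiftU (k *: u) = k *: shiftU u.
Proof.
have U0 : shiftU 0 = 0 by have := shiftUB 0 0; rewrite !subrr.
by rewrite -[k *: u]addr0 shiftU_lin U0 addr0.
Qed.

Lemma shiftU_ip u v : L2ip (shiftU u) (shiftU v) = L2ip u v.
Proof.
pose ip := @L2ip _ _ _ Pr.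
have rip u' v' : reC (ip (shiftU u') (shiftU v')) = reC (ip u' v').
  by rewrite !(rip_polar ip) -shiftUB !shiftU_norm.
apply/eqP; rewrite eq_complex; apply/andP; split; apply/eqP; first exact: rip.
by rewrite !(im_ip ip) -shiftUZ; exact: rip.
Qed.

Lemma shiftU_window W u : measurable W -> u \in G_measurable (sigma_eta W) ->
  shiftU u \in G_measurable (sigma_eta (f @^-1` W)).
Proof.
move=> mW /(window_factors Pr_complete B_basis mW)[g mg ug].
have mBW i : measurable (B i `&` W) by exact: measurableI.
apply: (G_measurable_counts (C := fun i => f @^-1` (B i `&` W)) (g := g)) => //.
- by move=> i; exact: mpre.
- by move=> i y [].
- exact: (shiftU_counts mBW mg ug).
Qed.

End CountsShift.

Section Translate.
Context (R : realType) (n : nat) d (Y : measurableType d).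
Context (act : Y -> 'rV[R]_n -> Y) (act_meas : is_measurable_action act).

(** Translates of sets are preimages under this map, and preimages commute with all set
    operations. *)
Definition untranslate (c : 'rV[R]_n) (y : Y) : Y := act y (- c).

Lemma translateE A c : translate act A c = untranslate c @^-1` A.
Proof.
apply/seteqP; split => y.
  by move=> [z Az <-]; rewrite /untranslate /= -(actD act_meas) subrr (act0 act_meas).
move=> Ay; exists (act y (- c)) => //.
by rewrite -(actD act_meas) addNr (act0 act_meas).
Qed.

Lemma measurable_untranslate c : measurable_fun setT (untranslate c).
Proof.
have := act_measurable act_meas; rewrite /untranslate => ma.
apply: (measurableT_comp ma (g := fun y => (y, (- c) : borelRV R n))).
by apply: measurable_fun_pair => //; exact: measurable_cst.
Qed.

Lemma measurable_translate A c : measurable A -> measurable (translate act A c).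
Proof.
move=> mA; rewrite translateE -[X in measurable X]setTI.
exact: measurable_untranslate.
Qed.

Lemma untranslateD a b : untranslate (a + b) = untranslate b \o untranslate a.
Proof.
by apply/funext => y; rewrite /untranslate /= -(actD act_meas) opprD.
Qed.

Lemma translateD A a b : translate act (translate act A a) b = translate act A (a + b).
Proof. by rewrite !translateE addrC untranslateD. Qed.

Lemma translate0 A : translate act A 0 = A.
Proof.
rewrite translateE; apply/seteqP.
by split => y; rewrite /untranslate /= oppr0 (act0 act_meas).
Qed.

Lemma translate_setD A B c :
  translate act (A `\` B) c = translate act A c `\` translate act B c.
Proof. by rewrite !translateE. Qed.

End Translate.

Section ShiftUnitaryUnique.
Context (R : realType) dO (Omega : measurableType dO) (Pr : probability Omega R).
Hypothesis Pr_complete : measure_is_complete Pr.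
Context dY (Y : measurableType dY) (lambda : {measure set Y -> \bar R}).
Context (eta : R.-sigmafker Omega ~> Y) (eta_poisson : is_poisson_process Pr lambda eta).
Variables (B : nat -> set Y) (B_basis : counts_basis_spec Pr eta B).
Context (n : nat) (act : Y -> 'rV[R]_n -> Y) (act_meas : is_measurable_action act).
Variables (X : set Y) (mX : measurable X).

Local Notation nrm := (ip_norm (@L2ip _ _ _ Pr)).
Local Notation window a b := (translate act X a `\` translate act X b).

Lemma measurable_window a b : measurable (window a b).
Proof. by apply: measurableD; exact: measurable_translate. Qed.

(* Both maps are isometries agreeing on the indicators of cylinders, whose span
   is dense. *)
Lemma shift_unitary_unique a b c (S S' : L2 Pr -> L2 Pr) :
  is_shift_unitary eta act X a b c S -> is_shift_unitary eta act X a b c S' ->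
  forall u, u \in G_measurable (sigma_window Pr eta act X a b) -> S u = S' u.
Proof.
move=> [[Slin Sip _] Scyl] [[Slin' Sip' _] Scyl'].
set W := window a b; have mW : measurable W by exact: measurable_window.
set A := [set` G_measurable (mu:=Pr) (sigma_window Pr eta act X a b)].
have [A0 Alin Acl] : closed_subspace A by exact: G_measurable_closed_subspace.
pose M := [set u | A u /\ S u = S' u].
suff h u : u \in G_measurable (sigma_window Pr eta act X a b) -> M u.
  by move=> u /h[].
have isom (Q : L2 Pr -> L2 Pr) :
    (forall k u v, A u -> A v -> Q (k *: u + v) = k *: Q u + Q v) ->
    (forall u v, A u -> A v -> L2ip (Q u) (Q v) = L2ip u v) ->
    forall u v, A u -> A v -> nrm (Q u - Q v) = nrm (u - v).
  move=> Ql Qi {}u v Au Av.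
  have -> : Q u - Q v = Q (u - v).
    by rewrite (addrC u (- v)) -(scaleN1r v) Ql// scaleN1r addrC.
  have Auv : A (u - v) by rewrite (addrC u (- v)) -(scaleN1r v); exact: Alin.
  by rewrite /ip_norm Qi.
apply: (closed_subspace_density (A := range (cylinder eta B W))).
- split.
  + split => //; have h0 : (0 : L2 Pr) = (-1) *: 0 + 0 by rewrite scaler0 addr0.
    by rewrite h0 Slin// Slin'// !scaleN1r !addNr.
  + move=> k v w [Av Sv] [Aw Sw]; split; first exact: Alin.
    by rewrite Slin// Slin'// Sv Sw.
  + move=> v hv; have Av : A v.
      by apply: Acl => e /hv[w [Aw _] wv]; exists w.
    split => //; apply: (@ip_norm_inj _ _ (@L2ip _ _ _ Pr)).
    apply/eqP; rewrite eq_le ip_norm_ge0 andbT; apply/ler_addgt0Pl => e e0.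
    have e20 : 0 < e / 2 by rewrite divr_gt0.
    have [w [Aw Sw] wv] := hv _ e20.
    rewrite addr0 (le_trans (ler_ip_dist _ _ (S w) _))//.
    rewrite isom// Sw isom// (ip_distC _ v w) [leRHS](splitr e).
    by apply: lerD; exact: ltW.
- by move=> _ _ [s _ <-] [t _ <-]; rewrite cylinder_cat; exists (s ++ t).
- by exists [::] => //; rewrite cylinder_nil.
- by move=> _ [s _ <-]; exact: (measurable_cylinder Pr_complete B_basis).
- move=> _ [s _ <-]; split.
    apply/asboolP; exists (cindic R (cylinder eta B W s)); last first.
      by apply: L2indE; exact: (measurable_cylinder Pr_complete B_basis).
    apply: measurable_cindic; apply: sub_sigma_algebra.
    exact: (sigma_eta_cylinder Pr_complete B_basis).
  (* The list [s] is reread as a tuple of counts, so that the indicator takes the cylinder form on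
     which a shift unitary is prescribed. *)
  pose k j := nth (0%N, 0%N) s j.
  pose D : set ((size s).-tuple (\bar R)) :=
    [set t | forall j, tnth t j = (k j).2%:R%:E].
  have mD : measurable D.
    rewrite (_ : D = \bigcap_(j in [set: 'I_(size s)])
       ((@tnth _ _)^~ j @^-1` [set (k j).2%:R%:E])).
      apply: fin_bigcap_measurable => // j _.
      rewrite -[X in measurable X]setTI; apply: measurable_tnth => //.
    by apply/seteqP; split => t h j => [_|]; exact: h.
  have mBW i : measurable (B i `&` W) by apply: measurableI => //; exact: B_basis.1.
  have E : L2ind Pr (cylinder eta B W s) = (fun w => cindic R D
      [tuple eta w (B (k i).1 `&` W) | i < size s]) %[ae Pr].
    apply: filterS (L2indE Pr (measurable_cylinder Pr_complete B_basis s mW)).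
    move=> w /[apply] ->; rewrite /cindic !indicE; congr ((_%:R)%:C).
    congr nat_of_bool; apply/idP/idP => /set_mem h; apply/mem_set.
      move=> j; rewrite tnth_mktuple; apply: (h (k j)).
      by apply: mem_nth; exact: ltn_ord.
    move=> p /(nthP (0%N, 0%N))[j js <-].
    by have := h (Ordinal js); rewrite tnth_mktuple.
  apply: L2_inj.
  have h j : measurable (B (k (j : 'I_(size s))).1 `&` W) /\ B (k j).1 `&` W `<=` W.
    by split => // y [].
  have := Scyl' _ (fun i => B (k i).1 `&` W) _ _ h (measurable_cindic (R:=R) mD) E.
  apply: filterS2 (Scyl _ (fun i => B (k i).1 `&` W) _ _ h (measurable_cindic (R:=R) mD) E).
  by move=> w + + _; move=> -> // ->.
- exact: (sigma_eta_sigma_algebra Pr_complete).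
- exact: (sigma_eta_cylinders Pr_complete eta_poisson B_basis).
Qed.

End ShiftUnitaryUnique.

Section TranslationUnitary.
Context (R : realType) dO (Omega : measurableType dO) (Pr : probability Omega R).
Hypothesis Pr_complete : measure_is_complete Pr.
Context dY (Y : measurableType dY) (lambda : {measure set Y -> \bar R}).
Context (eta : R.-sigmafker Omega ~> Y) (eta_poisson : is_poisson_process Pr lambda eta).
Hypothesis Omega_generated : measurable = sigma_eta Pr eta setT.
Variables (B : nat -> set Y) (B_basis : counts_basis_spec Pr eta B).
Context (n : nat) (act : Y -> 'rV[R]_n -> Y) (act_meas : is_measurable_action act).
Hypothesis lambda_invariant : forall (A : set Y) (a : 'rV[R]_n), measurable A ->
  lambda (translate act A a) = lambda A.

Local Notation counts := (counts eta).
Local Notation sigma_eta := (sigma_eta Pr eta).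
Local Notation tr := (translate act).

Let mB i : measurable (B i). Proof. exact: B_basis.1. Qed.

Let inv c A : measurable A -> lambda (untranslate act c @^-1` A) = lambda A.
Proof. by move=> mA; rewrite -(translateE act_meas) lambda_invariant. Qed.

Definition translateU c : L2 Pr -> L2 Pr :=
  shiftU Pr_complete eta_poisson Omega_generated B_basis
    (measurable_untranslate act_meas c) (@inv c).

Local Notation U := translateU.

Lemma translateU_counts c (C : nat -> set Y) (g : seqE R -> R[i]) (u : L2 Pr) :
  (forall i, measurable (C i)) -> measurable_fun setT g -> u = g \o counts C %[ae Pr] ->
  U c u = g \o counts (fun i => tr (C i) c) %[ae Pr].
Proof.
move=> mC mg ug; rewrite (_ : (fun i => _) = (fun i => untranslate act c @^-1` C i)).
  exact: shiftU_counts.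
by apply/funext => i; rewrite (translateE act_meas).
Qed.

Lemma translateU_lin c k u v : U c (k *: u + v) = k *: U c u + U c v.
Proof. exact: shiftU_lin. Qed.

Lemma translateUB c u v : U c (u - v) = U c u - U c v.
Proof. exact: shiftUB. Qed.

Lemma translateU_0 c : U c 0 = 0.
Proof. by have := translateUB c 0 0; rewrite !subrr. Qed.

Lemma translateU_norm c u : ip_norm (@L2ip _ _ _ Pr) (U c u) = ip_norm (@L2ip _ _ _ Pr) u.
Proof. exact: shiftU_norm. Qed.

Lemma translateU_ip c u v : L2ip (U c u) (U c v) = L2ip u v.
Proof. exact: shiftU_ip. Qed.

Lemma translateU_mul c (u v w : L2 Pr) : w = (fun x => u x * v x) %[ae Pr] ->
  U c w = (fun x => U c u x * U c v x) %[ae Pr].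
Proof. exact: shiftU_mul. Qed.

Lemma translateU_comp a b u : U a (U b u) = U (a + b) u.
Proof.
have [g mg ug] := all_factors Pr_complete Omega_generated B_basis u.
have mtB i : measurable (tr (B i) b) by exact: measurable_translate.
apply: L2_inj.
apply: filterS2 (translateU_counts a mtB mg (translateU_counts b mB mg ug))
  (translateU_counts (a + b) mB mg ug) => w + + _; move=> -> // -> //=.
by congr g; apply/funext => i; rewrite /counts translateD// addrC.
Qed.

Lemma translateU0 u : U 0 u = u.
Proof.
have [g mg ug] := all_factors Pr_complete Omega_generated B_basis u.
apply: L2_inj; apply: filterS2 (translateU_counts 0 mB mg ug) ug => w + + _.
move=> -> // -> //=.
by congr g; apply/funext => i; rewrite /counts translate0.
Qed.

Lemma translateU_window c W u : measurable W -> u \in G_measurable (sigma_eta W) ->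
  U c u \in G_measurable (sigma_eta (tr W c)).
Proof. by rewrite (translateE act_meas); exact: shiftU_window. Qed.

Variables (X : set Y) (mX : measurable X).

Lemma translateU_is_shift_unitary a b c : is_shift_unitary eta act X a b c (U c).
Proof.
have trW : tr (tr X a `\` tr X b) c = tr X (a + c) `\` tr X (b + c).
  by rewrite translate_setD// !translateD.
split; first split.
- by move=> k u v _ _; exact: translateU_lin.
- by move=> u v _ _; exact: translateU_ip.
- apply/seteqP; split => u.
    move=> [v /= vG <-]; rewrite /sigma_window -trW.
    by apply: translateU_window => //; exact: measurable_window.
  (* Surjectivity: [U (- c)] is inverse to [U c] and maps the translated window back. *)
  move=> /= uG; exists (U (- c) u); last by rewrite translateU_comp subrr translateU0.
  rewrite /= /sigma_window.
  have -> : tr X a `\` tr X b = tr (tr X (a + c) `\` tr X (b + c)) (- c).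
    by rewrite translate_setD// !translateD// !addrK.
  by apply: translateU_window => //; exact: measurable_window.
- move=> m C f u hC mf uf.
  (* The finite family is padded with empty sets to a sequence; [g] reads only the first [m]
     coordinates. *)
  pose D i := if insub i is Some j then C (j : 'I_m) else set0.
  have mD i : measurable (D i).
    by rewrite /D; case: insub => // j; have [] := hC j.
  pose g (k : seqE R) := f [tuple k i | i < m].
  have mg : measurable_fun setT g.
    apply: (measurableT_comp mf); apply/measurable_fun_tnthP => i.
    rewrite (_ : _ \o _ = fun k : seqE R => k i); first exact: measurable_coord.
    by apply/funext => k /=; rewrite tnth_mktuple.
  have ug : u = g \o counts D %[ae Pr].
    apply: filterS uf => w /[apply] -> /=; congr f; apply: eq_from_tnth => i.
    by rewrite !tnth_mktuple /counts /D valK.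
  apply: filterS (translateU_counts c mD mg ug) => w /[apply] -> /=.
  congr f; apply: eq_from_tnth => i.
  by rewrite !tnth_mktuple /counts /D valK.
Qed.

(** [get] returns a shift unitary because [U c] is one, and uniqueness leaves no choice on the
    window subspace. *)
Lemma shift_unitaryE a b c u : u \in G_measurable (sigma_window Pr eta act X a b) ->
  shift_unitary eta act X a b c u = U c u.
Proof.
move=> uG; apply: (shift_unitary_unique Pr_complete eta_poisson B_basis act_meas mX
  _ (translateU_is_shift_unitary a b c)) => //.
apply: getPex; exists (U c); exact: translateU_is_shift_unitary.
Qed.

End TranslationUnitary.

(** * Measurable families in L^2 *)

Section RationalSpan.
Context (R : realType) d (T : measurableType d) (P : probability T R).
Local Notation ip := (@L2ip _ _ _ P).
Local Notation nrm := (ip_norm ip).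

Lemma L2_normZ (k : R[i]) (u : L2 P) : nrm (k *: u) = Num.sqrt (sqmod k) * nrm u.
Proof.
apply/eqP; rewrite -(@eqrXn2 _ 2) ?mulr_ge0 ?ip_norm_ge0 ?sqrtr_ge0//.
by rewrite (ip_normZ_sqr ip) exprMn (sqr_sqrtr (sqmod_ge0 k)).
Qed.

Definition ratc (c : rat * rat) : R[i] := ratr c.1 +i* ratr c.2.

Definition ratc_mul (b c : rat * rat) : rat * rat :=
  (b.1 * c.1 - b.2 * c.2, b.1 * c.2 + b.2 * c.1).

Lemma ratcM b c : ratc (ratc_mul b c) = ratc b * ratc c.
Proof. by rewrite /ratc /ratc_mul /= rmorphB rmorphD !rmorphM. Qed.

Lemma ratc_approx (k : R[i]) (e : R) : 0 < e -> exists c, sqmod (k - ratc c) < e.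
Proof.
move=> e0; have e20 : 0 < Num.sqrt (e / 2) by rewrite sqrtr_gt0 divr_gt0.
have ap (x : R) : exists r : rat, (x - ratr r) ^+ 2 < e / 2.
  have [|r] := @rat_in_itvoo R (x - Num.sqrt (e / 2)) x.
    by rewrite ltrBlDr ltrDl.
  rewrite in_itv /= => /andP[r1 r2]; exists r.
  rewrite -[ltRHS](@sqr_sqrtr _ (e / 2)) ?divr_ge0 ?(ltW e0)//.
  rewrite ltr_pXn2r ?nnegrE ?sqrtr_ge0 ?subr_ge0 ?(ltW r2)//.
  by rewrite ltrBlDr addrC -ltrBlDr.
case: k => a b; have [p pE] := ap a; have [q qE] := ap b.
exists (p, q); rewrite /sqmod /= [ltRHS](splitr e).
exact: ltrD.
Qed.

Variables (S : countType) (E : S -> set T).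

(** Lists with repetitions keep the index type countable and make addition a concatenation;
    [ratc_mul] scales the coefficients. *)
Definition rat_comb (J : seq ((rat * rat) * S)) : L2 P :=
  \sum_(p <- J) ratc p.1 *: L2ind P (E p.2).

Definition rat_comb_seq (j : nat) : L2 P :=
  if unpickle j is Some J then rat_comb J else 0.

Lemma rat_comb_seq_pickle J : rat_comb_seq (pickle J) = rat_comb J.
Proof. by rewrite /rat_comb_seq pickleK. Qed.

Lemma rat_comb_cat J J' : rat_comb (J ++ J') = rat_comb J + rat_comb J'.
Proof. by rewrite /rat_comb big_cat. Qed.

Lemma rat_comb_scale c J :
  rat_comb [seq (ratc_mul c p.1, p.2) | p <- J] = ratc c *: rat_comb J.
Proof.
rewrite /rat_comb big_map scaler_sumr; apply: eq_bigr => p _ /=.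
by rewrite ratcM scalerA.
Qed.

(** Multiples by Gaussian rationals stay in the family, and an arbitrary complex multiple is a limit
    of such multiples, so the closure of the rational span is a complex subspace. *)
Lemma rat_comb_closure : closed_subspace
  [set u | forall e, 0 < e -> exists J, nrm (u - rat_comb J) < e].
Proof.
set M := [set u | _].
have MD u v : M u -> M v -> M (u + v).
  move=> Mu Mv e e0; have e20 : 0 < e / 2 by rewrite divr_gt0.
  have [J hJ] := Mu _ e20; have [J' hJ'] := Mv _ e20.
  exists (J ++ J'); rewrite rat_comb_cat opprD addrACA [ltRHS](splitr e).
  exact: le_lt_trans (ler_ip_normD ip _ _) (ltrD hJ hJ').
have Mc u : (forall e, 0 < e -> exists2 v, M v & nrm (v - u) < e) -> M u.
  move=> hu e e0; have e20 : 0 < e / 2 by rewrite divr_gt0.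
  have [v Mv vu] := hu _ e20; have [J hJ] := Mv _ e20; exists J.
  apply: (le_lt_trans (ler_ip_dist ip u v (rat_comb J))).
  by rewrite (ip_distC ip) [ltRHS](splitr e) ltrD.
have MQ c u : M u -> M (ratc c *: u).
  move=> Mu e e0; set m := Num.sqrt (sqmod (ratc c)).
  (* [m] may vanish, hence the division by [m + 1]. *)
  have m1 : 0 < m + 1 by rewrite ltr_wpDl ?sqrtr_ge0.
  have [|J hJ] := Mu (e / (m + 1)); first by rewrite divr_gt0.
  exists [seq (ratc_mul c p.1, p.2) | p <- J].
  rewrite rat_comb_scale -scalerBr L2_normZ -/m.
  apply: (@le_lt_trans _ _ ((m + 1) * nrm (u - rat_comb J))).
    by rewrite ler_wpM2r ?ip_norm_ge0// lerDl.
  by rewrite mulrC -ltr_pdivlMr.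
have MZ k u : M u -> M (k *: u).
  move=> Mu; apply: Mc => e e0.
  have m1 : 0 < nrm u + 1 by rewrite ltr_wpDl ?ip_norm_ge0.
  have [|c hc] := @ratc_approx k ((e / (nrm u + 1)) ^+ 2).
    by rewrite exprn_gt0 ?divr_gt0.
  exists (ratc c *: u); first exact: MQ.
  rewrite (ip_distC ip) -scalerBl L2_normZ.
  apply: (@le_lt_trans _ _ (Num.sqrt (sqmod (k - ratc c)) * (nrm u + 1))).
    by rewrite ler_wpM2l ?sqrtr_ge0// lerDl.
  rewrite -ltr_pdivlMr// -(@ltr_pXn2r _ 2) ?nnegrE ?sqrtr_ge0 ?divr_ge0 ?(ltW e0) ?(ltW m1)//.
  by rewrite sqr_sqrtr ?sqmod_ge0.
split.
- move=> e e0; exists [::].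
  by rewrite /rat_comb big_nil subrr (ip_norm0 ip).
- by move=> k u v Mu Mv; exact: (MD _ _ (MZ _ _ Mu) Mv).
- exact: Mc.
Qed.

Lemma rat_comb_ind s e : 0 < e -> exists J, nrm (L2ind P (E s) - rat_comb J) < e.
Proof.
move=> e0; exists [:: ((1, 0), s)].
rewrite /rat_comb big_seq1 /ratc /= rmorph1 rmorph0 (_ : 1 +i* 0 = 1)//.
by rewrite scale1r subrr (ip_norm0 ip).
Qed.

End RationalSpan.

Section WindowDense.
Context (R : realType) dO (Omega : measurableType dO) (Pr : probability Omega R).
Hypothesis Pr_complete : measure_is_complete Pr.
Context dY (Y : measurableType dY) (lambda : {measure set Y -> \bar R}).
Context (eta : R.-sigmafker Omega ~> Y) (eta_poisson : is_poisson_process Pr lambda eta).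
Variables (B : nat -> set Y) (B_basis : counts_basis_spec Pr eta B).
Local Notation nrm := (ip_norm (@L2ip _ _ _ Pr)).

Definition window_seq (W : set Y) (j : nat) : L2 Pr :=
  rat_comb_seq Pr (cylinder eta B W) j.

Lemma window_seq_dense W u : measurable W ->
  u \in G_measurable (sigma_eta Pr eta W) ->
  forall e, 0 < e -> exists j, nrm (u - window_seq W j) < e.
Proof.
move=> mW uW e e0.
suff [J hJ] : exists J, nrm (u - rat_comb Pr (cylinder eta B W) J) < e.
  by exists (pickle J); rewrite /window_seq rat_comb_seq_pickle.
have := closed_subspace_density (A := range (cylinder eta B W))
  (rat_comb_closure Pr (cylinder eta B W)).
move=> /(_ (sigma_eta Pr eta W)); apply => //.
- by move=> _ _ [s _ <-] [t _ <-]; rewrite cylinder_cat; exists (s ++ t).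
- by exists [::] => //; rewrite cylinder_nil.
- by move=> _ [s _ <-]; exact: (measurable_cylinder Pr_complete B_basis).
- by move=> _ [s _ <-] e' e'0; exact: rat_comb_ind.
- exact: (sigma_eta_sigma_algebra Pr_complete).
- exact: (sigma_eta_cylinders Pr_complete eta_poisson B_basis).
Qed.

Lemma window_seq_G_measurable W j : measurable W ->
  window_seq W j \in G_measurable (sigma_eta Pr eta W).
Proof.
move=> mW; have cA := G_measurable_closed_subspace Pr (sigma_eta Pr eta W).
have [A0 _ _] := cA; rewrite /window_seq /rat_comb_seq.
case: unpickle => [J|]; last exact: A0.
pose E (p : (rat * rat) * seq (nat * nat)) := L2ind Pr (cylinder eta B W p.2).
suff h p : E p \in G_measurable (sigma_eta Pr eta W).
  exact: (closed_subspace_sum J (fun p => ratc R p.1) cA h).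
apply/asboolP; exists (cindic R (cylinder eta B W p.2)); last first.
  by apply: L2indE; exact: (measurable_cylinder Pr_complete B_basis).
apply: measurable_cindic; apply: sub_sigma_algebra.
exact: (sigma_eta_cylinder Pr_complete B_basis).
Qed.

End WindowDense.

Section JointMeasurability.
Context (R : realType) dO (Omega : measurableType dO) (Pr : probability Omega R).
Context dY (Y : measurableType dY) (lambda : {sigma_finite_measure set Y -> \bar R}).
Context (eta : R.-sigmafker Omega ~> Y) (eta_poisson : is_poisson_process Pr lambda eta).
Context dT (T : measurableType dT).

(* eta is only sigma-finite pointwise, so joint measurability is obtained on the
   event that all the F k have finite mass, for F k of finite intensity. *)
Lemma joint_eta (A : set (T * Y)) : measurable A ->
  exists2 g : T * Omega -> \bar R, measurable_fun setT g &
    {ae Pr, forall w, forall t, eta w (xsection A t) = g (t, w)}.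
Proof.
move=> mA.
have [F0 F0T F0P] := sigma_finiteT lambda.
pose F := seqDU F0.
have mF k : measurable (F k).
  apply: measurableD; first by have [] := F0P k.
  by apply: bigsetU_measurable => i _; have [] := F0P i.
have Foo k : (lambda (F k) < +oo)%E.
  have [m0 f0] := F0P k; apply: le_lt_trans f0.
  by apply: le_measure; rewrite ?inE//; exact: subset_seqDU.
have FT : \bigcup_k F k = setT by rewrite -seqDU_bigcup_eq F0T.
have tF : trivIset setT F := trivIset_seqDU F0.
pose good := [set w | forall k, (eta w (F k) < +oo)%E].
have aegood : {ae Pr, forall w, good w}.
  by apply/ae_foralln => k; exact: (poisson_finite_ae eta_poisson (mF k) (Foo k)).
(* Equality is required for every [t] on the single event [good], so that the exceptional null set
   does not depend on [t]. *)
pose Z k := [set C : set (T * Y) | measurable C /\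
  exists2 g : T * Omega -> \bar R, measurable_fun setT g &
  forall w t, good w -> eta w (xsection C t `&` F k) = g (t, w)].
have key k : measurable `<=` Z k.
  pose Rect : set (set (T * Y)) := [set C `*` D | C in measurable & D in measurable].
  have RI : setI_closed Rect.
    move=> _ _ [C1 mC1 [D1 mD1 <-]] [C2 mC2 [D2 mD2 <-]].
    exists (C1 `&` C2); first exact: measurableI.
    by exists (D1 `&` D2); [exact: measurableI|rewrite setXI].
  have rect C D : measurable C -> measurable D -> Z k (C `*` D).
    move=> mC mD; split; first exact: measurableX.
    exists (fun z => (\1_C z.1)%:E * eta z.2 (D `&` F k))%E.
      apply: emeasurable_funM.
        apply: (measurableT_comp (f := EFin \o \1_C)) => //.
        by apply/measurable_EFinP; exact: measurable_indic.
      apply: (measurableT_comp (f := fun w => eta w (D `&` F k))) => //.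
      by apply: measurable_kernel; exact: measurableI.
    move=> w t _ /=; rewrite indicE; have [tC|tC] := boolP (t \in C).
      by rewrite in_xsectionX// mul1e.
    by rewrite notin_xsectionX// set0I measure0 mul0e.
  rewrite measurable_prod_measurableType -setI_closed_g_dynkin_g_sigma_algebra//.
  apply: smallest_sub; last first.
    by move=> _ [C mC [D mD <-]]; exact: rect.
  split.
  - by rewrite -setXTT; exact: rect.
  - move=> C [mC [g mg gE]]; split; first exact: measurableC.
    exists (fun z => eta z.2 (F k) - g z)%E.
      apply: emeasurable_funB => //.
      by apply: (measurableT_comp (f := fun w => eta w (F k))) => //; exact: measurable_kernel.
    move=> w t gw; rewrite -gE//.
    have -> : xsection (~` C) t `&` F k = F k `\` (xsection C t `&` F k).
      apply/seteqP; split => y.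
        by move=> [/xsectionP nC Fy]; split => // -[/xsectionP].
      move=> [Fy nC]; split => //; apply/xsectionP => Cy; apply: nC.
      by split => //; exact/xsectionP.
    have mCt : measurable (xsection C t `&` F k).
      by apply: measurableI => //; exact: measurable_xsection.
    rewrite measureD//; last exact: gw.
    by congr (_ - eta w _)%E; apply: setIidr => y [].
  - move=> C tC hC; have mC i : measurable (C i) by have [] := hC i.
    split; first exact: bigcup_measurable.
    have ex i : exists g : T * Omega -> \bar R, measurable_fun setT g /\
        forall w t, good w -> eta w (xsection (C i) t `&` F k) = g (t, w).
      by have [_ [g mg gE]] := hC i; exists g.
    have [g gP] := choice ex.
    exists (fun z => limn_esup (fun n => \sum_(0 <= i < n) g i z)%E).
      apply: measurable_fun_limn_esup => n; apply: emeasurable_sum => i.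
      by have [] := gP i.
    move=> w t gw; rewrite xsection_bigcup setI_bigcupl.
    rewrite measure_bigcup_limn_esup//.
    + congr limn_esup; apply/funext => n; apply: eq_bigr => i _.
      by have [_ ->] := gP i.
    + by move=> i; apply: measurableI => //; exact: measurable_xsection.
    + by apply: trivIset_setIr; exact: trivIset_xsection.
have ex k : exists g : T * Omega -> \bar R, measurable_fun setT g /\
    forall w t, good w -> eta w (xsection A t `&` F k) = g (t, w).
  by have [_ [g mg gE]] := key k A mA; exists g.
have [g gP] := choice ex.
exists (fun z => limn_esup (fun n => \sum_(0 <= i < n) g i z)%E).
  apply: measurable_fun_limn_esup => n; apply: emeasurable_sum => i.
  by have [] := gP i.
apply: filterS aegood => w gw t.
have mAt := measurable_xsection t mA.
rewrite -[X in eta w X]setIT -FT setI_bigcupr measure_bigcup_limn_esup//.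
- congr limn_esup; apply/funext => n; apply: eq_bigr => i _.
  by have [_ ->] := gP i.
- by move=> i; exact: measurableI.
- exact: trivIset_setIl.
Qed.

Definition family_event (A : nat -> set (T * Y)) (s : seq (nat * nat)) (t : T) : set Omega :=
  [set w | forall p, p \in s -> eta w (xsection (A p.1) t) = p.2%:R%:E].

Lemma measurable_family_event A s t : (forall i, measurable (A i)) ->
  measurable (family_event A s t).
Proof.
move=> mA; rewrite (_ : family_event A s t =
    \bigcap_(p in [set p | p \in s]) [set w | eta w (xsection (A p.1) t) = p.2%:R%:E])//.
apply: fin_bigcap_measurable; first exact: finite_seq.
by move=> p _; apply: measurable_eta_eq; exact: measurable_xsection.
Qed.

(** For each [t] the event differs by a null set from the section at [t] of one measurable subset of
    [T * Omega], and the probability of a section is measurable in [t]. *)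
Lemma measurable_family_event_prob A s D : (forall i, measurable (A i)) ->
  measurable D -> measurable_fun setT (fun t => fine (Pr (family_event A s t `&` D))).
Proof.
move=> mA mD.
have ex i : exists g : T * Omega -> \bar R, measurable_fun setT g /\
    {ae Pr, forall w, forall t, eta w (xsection (A i) t) = g (t, w)}.
  by have [g mg gE] := joint_eta (mA i); exists g.
have [g gP] := choice ex.
pose S : set (T * Omega) := (\bigcap_(p in [set p | p \in s])
  [set z | g p.1 z = p.2%:R%:E]) `&` (setT `*` D).
have mS : measurable S.
  apply: measurableI; last exact: measurableX.
  apply: fin_bigcap_measurable; first exact: finite_seq.
  move=> p _; have [mg _] := gP p.1.
  rewrite -[X in measurable X]setTI; apply: (mg measurableT [set p.2%:R%:E]).
  exact: emeasurable_set1.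
have -> : (fun t => fine (Pr (family_event A s t `&` D))) =
    (fun t => fine (Pr (xsection S t))).
  apply/funext => t; congr fine; apply: measure_negligibleY.
  - by apply: measurableI => //; exact: measurable_family_event.
  - exact: measurable_xsection.
  - have ae : {ae Pr, forall w i t, eta w (xsection (A i) t) = g i (t, w)}.
      by apply/ae_foralln => i; have [] := gP i.
    apply: negligibleS ae => w /= [[[Ew Dw] nS]|[/xsectionP[Ew [_ Dw]] nE]] ae.
      apply: nS; apply/xsectionP; split => //.
      by move=> p /= ps; rewrite -ae; exact: Ew.
    by apply: nE; split => // p ps; rewrite ae; exact: (Ew p).
apply: (measurableT_comp (f := fine)) => //.
exact: measurable_fun_xsection.
Qed.

End JointMeasurability.

Section L2Families.
Context (R : realType) dO (Omega : measurableType dO) (Pr : probability Omega R).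
Hypothesis Pr_complete : measure_is_complete Pr.
Context dY (Y : measurableType dY) (lambda : {sigma_finite_measure set Y -> \bar R}).
Context (eta : R.-sigmafker Omega ~> Y) (eta_poisson : is_poisson_process Pr lambda eta).
Hypothesis Omega_generated : measurable = sigma_eta Pr eta setT.
Variables (B : nat -> set Y) (B_basis : counts_basis_spec Pr eta B).

Local Notation ip := (@L2ip _ _ _ Pr).
Local Notation BH := (g_sigma_algebraType (ip_open ip)).
Local Notation dense_seq := (window_seq Pr eta B setT).

Lemma all_G_measurable (u : L2 Pr) : u \in G_measurable (sigma_eta Pr eta setT).
Proof.
apply/asboolP; exists (u : Omega -> R[i]); last exact: ae_eq_refl.
move=> _ V mV; rewrite /measurable /= -Omega_generated.
by apply: sub_sigma_algebra; exact: (measurable_L0 u).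
Qed.

Lemma dense_seq_dense : ip_dense ip (range dense_seq).
Proof.
move=> u e e0; have [j hj] := window_seq_dense Pr_complete eta_poisson B_basis
  measurableT (all_G_measurable u) e0.
by exists (dense_seq j) => //; exists j.
Qed.

Context dT (T : measurableType dT).

(** Weak measurability can be tested on cylinder indicators, because the dense sequence consists of
    their rational combinations. *)
Lemma measurable_to_L2_cylinder (phi : T -> L2 Pr) :
  (forall s, measurable_fun setT (fun t => ip (phi t) (L2ind Pr (cylinder eta B setT s)))) ->
  measurable_fun setT (phi : T -> BH).
Proof.
move=> mphi; apply: (measurable_to_L2_weak dense_seq_dense) => j.
suff h J : measurable_fun setT (fun t => ip (phi t) (rat_comb Pr (cylinder eta B setT) J)).
  rewrite /window_seq /rat_comb_seq; case: unpickle => [J|].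
    by have /measurable_complexP[] := h J.
  under eq_fun do rewrite linear0r.
  exact: measurable_cst.
elim: J => [|p J ih].
  rewrite /rat_comb big_nil; under eq_fun do rewrite linear0r.
  exact: measurable_cst.
rewrite (_ : (fun t => _) = fun t =>
    (ratc R p.1)^* * ip (phi t) (L2ind Pr (cylinder eta B setT p.2)) +
    ip (phi t) (rat_comb Pr (cylinder eta B setT) J)).
  by apply: measurable_complexD => //; exact: measurable_complexZ.
by apply/funext => t; rewrite /rat_comb big_cons (ipDr ip) (ipZr ip).
Qed.

(** The inner product of two indicators is the probability of the intersection, so weak
    measurability is [measurable_family_event_prob]. *)
Lemma measurable_L2ind_family (A : nat -> set (T * Y)) s : (forall i, measurable (A i)) ->
  measurable_fun setT ((fun t => L2ind Pr (family_event eta A s t)) : T -> BH).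
Proof.
move=> mA; apply: measurable_to_L2_cylinder => s'.
have mc := measurable_cylinder Pr_complete B_basis s' measurableT.
rewrite (_ : (fun t => _) = fun t =>
    (fine (Pr (family_event eta A s t `&` cylinder eta B setT s')))%:C).
  exact/measurable_complexC/(measurable_family_event_prob eta_poisson).
by apply/funext => t; rewrite L2ip_ind//; exact: measurable_family_event.
Qed.

Lemma measurable_rat_comb_family (E : T -> seq (nat * nat) -> set Omega) j :
  (forall s, measurable_fun setT ((fun t => L2ind Pr (E t s)) : T -> BH)) ->
  measurable_fun setT ((fun t => rat_comb_seq Pr (E t) j) : T -> BH).
Proof.
move=> mE; rewrite /rat_comb_seq; case: unpickle => [J|]; last exact: measurable_cst.
elim: J => [|p J ih].
  rewrite (_ : (fun t => _) = cst 0); first exact: measurable_cst.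
  by apply/funext => t; rewrite /rat_comb big_nil.
rewrite (_ : (fun t => _) = fun t =>
    ratc R p.1 *: L2ind Pr (E t p.2) + rat_comb Pr (E t) J).
  apply: (measurable_L2D dense_seq_dense) => //.
  exact: (measurable_L2Z dense_seq_dense).
by apply/funext => t; rewrite /rat_comb big_cons.
Qed.

Lemma measurable_window_seq (W : T -> set Y) j :
  measurable [set z : T * Y | W z.1 z.2] ->
  measurable_fun setT ((fun t => window_seq Pr eta B (W t) j) : T -> BH).
Proof.
move=> mW; apply: measurable_rat_comb_family => s.
(* The section of [A i] at [t] is [B i] cut by [W t], so the cylinders of [W t] are the events of
   one measurable family. *)
pose A i : set (T * Y) := (setT `*` B i) `&` [set z : T * Y | W z.1 z.2].
have mA i : measurable (A i).
  by apply: measurableI => //; apply: measurableX => //; exact: B_basis.1.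
have -> : (fun t => L2ind Pr (cylinder eta B (W t) s)) =
    (fun t => L2ind Pr (family_event eta A s t)); last exact: measurable_L2ind_family.
apply/funext => t; congr (L2ind Pr _); apply/funext => w.
rewrite /cylinder /family_event /=; apply/propext.
have E i : xsection (A i) t = B i `&` W t.
  by apply/seteqP; split => y; [move=> /xsectionP[[]]|move=> [? ?]; apply/xsectionP].
by split => h p ps; [rewrite E|rewrite -E]; exact: h.
Qed.

End L2Families.

Section TranslationMeasurable.
Context (R : realType) dO (Omega : measurableType dO) (Pr : probability Omega R).
Hypothesis Pr_complete : measure_is_complete Pr.
Context dY (Y : measurableType dY) (lambda : {sigma_finite_measure set Y -> \bar R}).
Context (eta : R.-sigmafker Omega ~> Y) (eta_poisson : is_poisson_process Pr lambda eta).
Hypothesis Omega_generated : measurable = sigma_eta Pr eta setT.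
Variables (B : nat -> set Y) (B_basis : counts_basis_spec Pr eta B).
Context (n : nat) (act : Y -> 'rV[R]_n -> Y) (act_meas : is_measurable_action act).
Hypothesis lambda_invariant : forall (A : set Y) (a : 'rV[R]_n), measurable A ->
  lambda (translate act A a) = lambda A.

Local Notation ip := (@L2ip _ _ _ Pr).
Local Notation nrm := (ip_norm ip).
Local Notation BH := (g_sigma_algebraType (ip_open ip)).
Local Notation dense_seq := (window_seq Pr eta B setT).
Local Notation U := (translateU Pr_complete eta_poisson Omega_generated B_basis
  act_meas lambda_invariant).

Let mB i : measurable (B i). Proof. exact: B_basis.1. Qed.

Lemma measurable_oppRV : measurable_fun setT (fun c : borelRV R n => - c : borelRV R n).
Proof.
move=> mT; apply: (measurability _ (erefl : @measurable _ (borelRV R n) = <<s open >>)) => //.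
move=> _ [V oV <-]; rewrite setTI; apply: sub_sigma_algebra.
have := @opp_continuous ('rV[R]_n : topologicalZmodType).
by move=> /continuousP; exact.
Qed.

Lemma measurable_untranslate2 :
  measurable_fun setT (fun z : borelRV R n * Y => untranslate act z.1 z.2).
Proof.
have := act_measurable act_meas; rewrite /untranslate => ma.
apply: (measurableT_comp ma (g := fun z : borelRV R n * Y => (z.2, (- z.1) : borelRV R n))).
apply: measurable_fun_pair => //.
by apply: (measurableT_comp measurable_oppRV).
Qed.

Lemma measurable_translate2 (A : set Y) : measurable A ->
  measurable [set z : borelRV R n * Y | translate act A z.1 z.2].
Proof.
move=> mA; rewrite (_ : [set z | _] =
    (fun z : borelRV R n * Y => untranslate act z.1 z.2) @^-1` A).
  by rewrite -[X in measurable X]setTI; exact: measurable_untranslate2.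
by apply/seteqP; split => z; rewrite /= translateE.
Qed.

(** A shifted cylinder prescribes the counts of translated sets, which are sections of measurable
    subsets of [borelRV R n * Y]. Measurability in [c] thus reduces to that of a family of
    events. *)
Lemma translateU_cylinder c s : U c (L2ind Pr (cylinder eta B setT s)) =
  L2ind Pr (family_event (T := borelRV R n) eta
    (fun i => [set z : borelRV R n * Y | translate act (B i) z.1 z.2]) s c).
Proof.
pose D : set (seqE R) := [set k | forall p, p \in s -> k p.1 = p.2%:R%:E].
have mD : measurable D.
  rewrite (_ : D = \bigcap_(p in [set p | p \in s]) [set k : seqE R | k p.1 = p.2%:R%:E])//.
  apply: fin_bigcap_measurable; first exact: finite_seq.
  move=> p _; rewrite -[X in measurable X]setTI.
  exact: (measurable_coord p.1 measurableT (emeasurable_set1 _)).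
have mc := measurable_cylinder Pr_complete B_basis s measurableT.
have mf := measurable_family_event eta s (c : borelRV R n)
  (fun i => measurable_translate2 (mB i)).
apply: L2_inj.
have E : L2ind Pr (cylinder eta B setT s) = cindic R D \o counts eta B %[ae Pr].
  apply: filterS (L2indE Pr mc) => w /[apply] -> /=.
  rewrite /cindic !indicE; congr ((_%:R)%:C); congr nat_of_bool.
  apply/idP/idP => /set_mem h; apply/mem_set => p ps.
    by rewrite -(h p ps) /counts setIT.
  by rewrite setIT -(h p ps).
apply: filterS2 (translateU_counts Pr_complete eta_poisson Omega_generated B_basis
  act_meas lambda_invariant c mB (measurable_cindic (R := R) mD) E) (L2indE Pr mf).
move=> w + + _; move=> -> // -> //=.
rewrite /cindic !indicE; congr ((_%:R)%:C); congr nat_of_bool.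
have xE i : xsection [set z : borelRV R n * Y | translate act (B i) z.1 z.2] c =
    translate act (B i) c.
  by apply/seteqP; split => y; [move=> /xsectionP|move=> ?; apply/xsectionP].
apply/idP/idP => /set_mem h; apply/mem_set => p ps.
  by rewrite xE -(h p ps).
by rewrite -(h p ps) xE.
Qed.

Lemma measurable_translateU_dense j :
  measurable_fun setT ((fun c : borelRV R n => U c (dense_seq j)) : borelRV R n -> BH).
Proof.
have dd := dense_seq_dense Pr_complete eta_poisson Omega_generated B_basis.
rewrite /window_seq /rat_comb_seq; case: unpickle => [J|]; last first.
  rewrite (_ : (fun c => _) = cst 0); first exact: measurable_cst.
  by apply/funext => c; rewrite translateU_0.
elim: J => [|p J ih].
  rewrite (_ : (fun t => _) = cst 0); first exact: measurable_cst.
  by apply/funext => c; rewrite /rat_comb big_nil translateU_0.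
rewrite (_ : (fun t => _) = fun c =>
    ratc R p.1 *: U c (L2ind Pr (cylinder eta B setT p.2)) +
    U c (rat_comb Pr (cylinder eta B setT) J)).
  apply: (measurable_L2D dd) => //; apply: (measurable_L2Z dd).
  rewrite (_ : (fun t => _) = (fun c : borelRV R n => L2ind Pr (family_event eta
    (fun i => [set z : borelRV R n * Y | translate act (B i) z.1 z.2]) p.2 c))).
    apply: (measurable_L2ind_family Pr_complete eta_poisson Omega_generated B_basis) => i.
    exact: measurable_translate2.
  by apply/funext => c; rewrite translateU_cylinder.
by apply/funext => c; rewrite /rat_comb big_cons translateU_lin.
Qed.

(** Because [U (a t)] is an isometry, the images of the dense sequence approximate [U (a t) (g t)]
    as well as the sequence approximates [g t]. The distance to [dense_seq i] is then an infimum of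
    terms in which [a] and [g] appear separately. *)
Lemma measurable_translateU dT (T : measurableType dT) (a : T -> borelRV R n)
    (g : T -> L2 Pr) :
  measurable_fun setT a -> measurable_fun setT (g : T -> BH) ->
  measurable_fun setT ((fun t => U (a t) (g t)) : T -> BH).
Proof.
have dd := dense_seq_dense Pr_complete eta_poisson Omega_generated B_basis.
move=> ma mg; apply: (measurable_to_L2 dd) => i.
rewrite (_ : (fun t => _) = fun t => inf (range (fun j =>
    nrm (g t - dense_seq j) + nrm (U (a t) (dense_seq j) - dense_seq i)))).
  apply: (@measurable_inf_seq _ _ _ (fun j t =>
      nrm (g t - dense_seq j) + nrm (U (a t) (dense_seq j) - dense_seq i))).
    by move=> t; exists 0 => _ [j _ <-]; rewrite addr_ge0 ?ip_norm_ge0.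
  move=> j; apply: measurable_funD; first exact: measurable_L2_dist.
  apply: measurable_L2_dist.
  exact: (measurableT_comp (measurable_translateU_dense j)).
apply/funext => t.
have UB u v : nrm (U (a t) u - U (a t) v) = nrm (u - v).
  by rewrite -translateUB translateU_norm.
rewrite (@ip_dist_inf _ _ ip _ _ (range (fun j => U (a t) (dense_seq j)))).
  by rewrite image_comp; congr inf; apply: eq_imagel => j _ /=; rewrite UB.
move=> e e0; have [_ [j _ <-] h] := dd (g t) _ e0.
by exists (U (a t) (dense_seq j)); [exists j|rewrite UB].
Qed.

End TranslationMeasurable.

(** * The Polish space R^d x L^2 *)

(** The arithmetic of a sum of two distances, each passing through an approximating point: four
    terms below [t / 4]. *)
Lemma ltr_add_quarters (R : realFieldType) (s t a b c f g h : R) :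
  s < t / 4 -> a < s -> b < s -> c < s -> f < s ->
  g <= a + c -> h <= b + f -> g + h < t.
Proof. by lra. Qed.

Section RowVectors.
Context (R : realType) (n : nat).

Lemma rV_rat_dense (a : 'rV[R]_n) (e : R) : 0 < e ->
  exists v : 'rV[rat]_n, `|a - map_mx ratr v| < e.
Proof.
move=> e0; have ap (x : R) : exists r : rat, `|x - ratr r| < e.
  have [|r] := @rat_in_itvoo R (x - e) x; first by rewrite ltrBlDr ltrDl.
  rewrite in_itv /= => /andP[r1 r2]; exists r.
  by rewrite ger0_norm ?subr_ge0 ?(ltW r2)// ltrBlDr addrC -ltrBlDr.
have [r rP] := choice ap; exists (\row_j r (a ord0 j)).
suff : ball a e (map_mx ratr (\row_j r (a ord0 j))) by rewrite -ball_normE.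
by split => // i j; rewrite !mxE -ball_normE /= (ord1 i); exact: rP.
Qed.

End RowVectors.

Section PolishProduct.
Context (R : realType) (n : nat) d (O : measurableType d) (P : probability O R).
Local Notation ip := (@L2ip _ _ _ P).
Local Notation nrm := (ip_norm ip).
Local Notation BH := (g_sigma_algebraType (ip_open ip)).
Local Notation bRV := (borelRV R n).

(** A type of its own, to carry the metric [rVL2_dist] built from the L^2 norm. *)
Definition rVL2 : Type := ('rV[R]_n * L2 P)%type.
HB.instance Definition _ := Choice.on rVL2.
HB.instance Definition _ := isPointed.Build rVL2 (0, 0).

Definition rVL2_dist (x y : rVL2) : R := `|x.1 - y.1| + nrm (x.2 - y.2).

Lemma rVL2_distxx x : rVL2_dist x x = 0.
Proof. by rewrite /rVL2_dist !subrr normr0 (ip_norm0 ip) addr0. Qed.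

Lemma rVL2_dist_eq0 x y : rVL2_dist x y = 0 -> x = y.
Proof.
case: x y => [a u] [b v] /eqP; rewrite /rVL2_dist /= paddr_eq0 ?ip_norm_ge0//.
move=> /andP[]; rewrite normr_eq0 subr_eq0 => /eqP -> /eqP h.
by rewrite (ip_norm_inj (ip := ip) h).
Qed.

Lemma rVL2_dist_sym x y : rVL2_dist x y = rVL2_dist y x.
Proof. by rewrite /rVL2_dist distrC (ip_distC ip). Qed.

Lemma rVL2_dist_triangle y x z : rVL2_dist x z <= rVL2_dist x y + rVL2_dist y z.
Proof.
rewrite /rVL2_dist addrACA lerD//; last exact: (ler_ip_dist ip).
exact: ler_distD.
Qed.

HB.instance Definition _ := @isMetric.Build R rVL2 rVL2_dist rVL2_distxx
  rVL2_dist_eq0 rVL2_dist_sym rVL2_dist_triangle.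

Lemma rVL2_ballE (x y : rVL2) (e : R) : ball x e y <-> rVL2_dist x y < e.
Proof. by rewrite ballEmdist. Qed.

Lemma rVL2_openP (U : set rVL2) : open U <->
  forall x, U x -> exists2 e, 0 < e & forall y, rVL2_dist x y < e -> U y.
Proof.
rewrite openE; split => h x Ux.
  have : nbhs x U by exact: h.
  move=> /nbhs_ballP[e /= e0 eU]; exists e; first exact: e0.
  by move=> y xy; apply: eU; exact/rVL2_ballE.
have [e e0 eU] := h x Ux; by apply/nbhs_ballP; exists e => //; move=> y /rVL2_ballE; exact: eU.
Qed.

(** A Cauchy filter contains balls of every radius [1/(k+1)]. Their centres [x k] form a Cauchy
    sequence, and its limit, found coordinate by coordinate, is the limit of the filter. *)
Lemma rVL2_complete (F : set_system rVL2) : ProperFilter F -> cauchy F -> cvg F.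
Proof.
move=> FF /cauchyP cF.
have k0 k : 0 < (k.+1%:R^-1 : R) by rewrite invr_gt0.
have [x xP] := choice (fun k : nat => cF _ (k0 k)).
have small (e : R) : 0 < e -> exists N, forall k, (N <= k)%N -> k.+1%:R^-1 < e.
  move=> e0; have [N] := ltr_add_invr e0; rewrite add0r => Ne; exists N => k Nk.
  by apply: le_lt_trans Ne; rewrite lef_pV2 ?posrE// ler_nat.
have xx i j : rVL2_dist (x i) (x j) < i.+1%:R^-1 + j.+1%:R^-1.
  have [z [/rVL2_ballE zi /rVL2_ballE zj]] := filter_ex (filterI (xP i) (xP j)).
  apply: (le_lt_trans (rVL2_dist_triangle z _ _)).
  by rewrite (rVL2_dist_sym z) ltrD.
have cx (e : R) : 0 < e -> exists N, forall i j, (N <= i)%N -> (N <= j)%N ->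
    rVL2_dist (x i) (x j) < e.
  move=> e0; have e20 : 0 < e / 2 by rewrite divr_gt0.
  have [N NP] := small _ e20; exists N => i j Ni Nj.
  by rewrite (lt_trans (xx i j))// [ltRHS](splitr e) ltrD ?NP.
have d1 y z : `|y.1 - z.1| <= rVL2_dist y z by rewrite lerDl ip_norm_ge0.
have d2 y z : nrm (y.2 - z.2) <= rVL2_dist y z by rewrite lerDr.
have cx1 : cauchy ((fun k => (x k).1) @ \oo).
  apply/cauchyP => e e0; have [N NP] := cx e e0.
  exists (x N).1; exists N => // k /= Nk; rewrite -ball_normE /=.
  exact: le_lt_trans (d1 _ _) (NP _ _ (leqnn N) Nk).
have /cvg_ex[a xa] : cvg ((fun k => (x k).1) @ \oo) by exact: cauchy_cvg.
have [u xu] : exists u, forall e, 0 < e -> exists N, forall k, (N <= k)%N ->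
    nrm ((x k).2 - u) < e.
  apply: (@L2_complete _ _ _ P (fun k => (x k).2)) => e e0.
  have [N NP] := cx e e0; exists N => i j Ni Nj.
  exact: le_lt_trans (d2 _ _) (NP _ _ Ni Nj).
apply: (@cvgP rVL2 F ((a, u) : rVL2)); apply/cvg_ballP => e e0.
have e30 : 0 < e / 3 by rewrite divr_gt0.
have [N1 N1P] := small _ e30.
have /cvgrPdist_lt/(_ _ e30)[N2 _ N2P] := xa.
have [N3 N3P] := xu _ e30.
pose k := maxn N1 (maxn N2 N3).
have kN1 : (N1 <= k)%N by rewrite leq_maxl.
have kN2 : (N2 <= k)%N by rewrite /k maxnCA leq_maxl.
have kN3 : (N3 <= k)%N by rewrite /k [maxn N2 N3]maxnC maxnCA leq_maxl.
apply: filterS (xP k) => y /rVL2_ballE xy; apply/rVL2_ballE.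
apply: (le_lt_trans (rVL2_dist_triangle (x k) _ _)).
have h1 : rVL2_dist (x k) y < e / 3 by exact: lt_trans (N1P _ kN1).
have h2 : `|a - (x k).1| < e / 3 by exact: N2P.
have h3 : nrm (u - (x k).2) < e / 3 by rewrite (ip_distC ip); exact: N3P.
have h4 : rVL2_dist (a, u) (x k) < e / 3 + e / 3 by exact: ltrD.
have -> : e = (e / 3 + e / 3) + e / 3 by field.
exact: ltrD.
Qed.

HB.instance Definition _ := Uniform_isComplete.Build rVL2 rVL2_complete.

Variable q : nat -> L2 P.
Hypothesis q_dense : ip_dense ip (range q).

Definition rVL2_dense_point (p : 'rV[rat]_n * nat) : rVL2 := (map_mx ratr p.1, q p.2).

Lemma rVL2_dense_pointP (x : rVL2) e : 0 < e -> exists p, rVL2_dist x (rVL2_dense_point p) < e.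
Proof.
move=> e0; have e20 : 0 < e / 2 by rewrite divr_gt0.
have [v hv] := rV_rat_dense x.1 e20; have [_ [j _ <-] hj] := q_dense x.2 e20.
by exists (v, j); rewrite [ltRHS](splitr e); exact: ltrD.
Qed.

Lemma rVL2_separable : exists2 D : set rVL2, countable D & dense D.
Proof.
exists (range rVL2_dense_point).
  exact: (card_le_trans (card_image_le _ _) (countableP _)).
move=> U [x Ux] /rVL2_openP/(_ _ Ux)[e e0 eU].
have [p hp] := rVL2_dense_pointP x e0.
by exists (rVL2_dense_point p); split; [exact: eU|exists p].
Qed.

Lemma ip_ball_open (u : L2 P) r : ip_open ip [set v | nrm (v - u) < r].
Proof.
move=> v /= vr; exists (r - nrm (v - u)); first by rewrite subr_gt0.
move=> w wv; apply: (le_lt_trans (ler_ip_dist ip w v u)).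
by rewrite -ltrBrDr.
Qed.

(** One inclusion holds because an open set is a countable union of products of balls with centres
    in countable dense sets, the other because the two projections are continuous. *)
Lemma borel_rVL2 : <<s @open rVL2 >> = @measurable _ (bRV * BH)%type.
Proof.
apply/seteqP; split.
  apply: smallest_sub; first exact: (@sigma_algebra_measurable _ (bRV * BH)%type).
  move=> U /rVL2_openP oU.
  pose r (k : nat) : R := k.+1%:R^-1.
  pose Bx (p : 'rV[rat]_n * nat) k : set (bRV * BH) :=
    [set a : bRV | `|(map_mx ratr p.1 : 'rV[R]_n) - a| < r k] `*`
    [set v : BH | nrm ((v : L2 P) - q p.2) < r k].
  have -> : U = \bigcup_(p in setT) \bigcup_(k in [set k | Bx p k `<=` U]) Bx p k.
    apply/seteqP; split => [x Ux|x [p _ [k /= BU Bxx]]]; last exact: BU.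
    have [e e0 eU] := oU _ Ux.
    have e40 : 0 < e / 4 by rewrite divr_gt0.
    have [k] := ltr_add_invr e40; rewrite add0r -/(r k) => ke.
    have rk0 : 0 < r k by rewrite invr_gt0.
    have [p hp] := rVL2_dense_pointP x rk0.
    have hp1 : `|x.1 - map_mx ratr p.1| < r k.
      by apply: le_lt_trans hp; rewrite lerDl ip_norm_ge0.
    have hp2 : nrm (x.2 - q p.2) < r k by apply: le_lt_trans hp; rewrite lerDr.
    exists p => //; exists k => /=; last by split => //=; rewrite distrC.
    move=> y [/= y1 y2]; apply: eU.
    have d1 := ler_distD (map_mx ratr p.1) x.1 y.1.
    have d2 := ler_ip_dist ip x.2 (q p.2) y.2; rewrite (ip_distC ip (q p.2)) in d2.
    exact: ltr_add_quarters ke hp1 hp2 y1 y2 d1 d2.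
  apply: countable_bigcupT_measurable; first exact: countableP.
  move=> p; apply: bigcup_measurable => k _; apply: measurableX.
    apply: sub_sigma_algebra; have := @ball_open R 'rV[R]_n (map_mx ratr p.1) (r k).
    by rewrite -ball_normE; apply; rewrite invr_gt0.
  by apply: sub_sigma_algebra; exact: ip_ball_open.
rewrite measurable_prod_measurableType; apply: smallest_sub.
  exact: smallest_sigma_algebra.
pose S := g_sigma_algebraType (@open rVL2).
have m1 : measurable_fun setT (fst : S -> bRV).
  move=> mT; apply: (measurability _ (erefl : @measurable _ bRV = <<s open >>)) => //.
  move=> _ [V oV <-]; rewrite setTI; apply: sub_sigma_algebra.
  apply/rVL2_openP => x Vx.
  have /nbhs_ballP[e e0 eV] : nbhs x.1 V by exact: open_nbhs_nbhs.
  exists e => // y xy; apply: eV; rewrite -ball_normE /=.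
  by apply: le_lt_trans xy; rewrite lerDl ip_norm_ge0.
have m2 : measurable_fun setT (snd : S -> BH).
  move=> mT; apply: (measurability _ (erefl : @measurable _ BH = <<s ip_open ip >>)) => //.
  move=> _ [V oV <-]; rewrite setTI; apply: sub_sigma_algebra.
  apply/rVL2_openP => x Vx; have [e e0 eV] := oV _ Vx.
  exists e => // y xy; apply: eV; rewrite (ip_distC ip).
  by apply: le_lt_trans xy; rewrite lerDr.
move=> _ [C mC [D mD <-]].
have -> : C `*` D = (setT `&` fst @^-1` C) `&` (setT `&` snd @^-1` D).
  by rewrite !setTI.
by apply: (@measurableI _ S); [exact: m1|exact: m2].
Qed.

End PolishProduct.

(** * The product system *)

Section BorelRowAddition.
Context (R : realType) (n : nat) d (T : measurableType d).
Local Notation bRV := (borelRV R n).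

(** If the sum lies in the open set [V], the two summands lie in rational balls whose sums stay in
    [V], and there are countably many pairs of such balls. *)
Lemma measurable_addRV (f g : T -> bRV) : measurable_fun setT f -> measurable_fun setT g ->
  measurable_fun setT ((fun t => (f t : 'rV[R]_n) + g t) : T -> bRV).
Proof.
move=> mf mg mT.
apply: (measurability _ (erefl : @measurable _ bRV = <<s open >>)) => //.
move=> _ [V oV <-]; rewrite setTI.
pose r (k : nat) : R := k.+1%:R^-1.
pose Bl (p : 'rV[rat]_n) k : set bRV := [set a : bRV | `|(map_mx ratr p : 'rV[R]_n) - a| < r k].
have mBl p k : measurable (Bl p k).
  apply: sub_sigma_algebra; have := @ball_open R 'rV[R]_n (map_mx ratr p) (r k).
  by rewrite -ball_normE; apply; rewrite invr_gt0.
pose I := [set z : ('rV[rat]_n * 'rV[rat]_n) * nat |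
  forall a b, Bl z.1.1 z.2 a -> Bl z.1.2 z.2 b -> V ((a : 'rV[R]_n) + b)].
have -> : (fun t => (f t : 'rV[R]_n) + g t) @^-1` V =
    \bigcup_z (if z \in I then f @^-1` Bl z.1.1 z.2 `&` g @^-1` Bl z.1.2 z.2 else set0).
  apply/seteqP; split => [t /= Vt|t [z _]]; last first.
    by case: ifPn => // /set_mem Iz [ft gt]; exact: Iz.
  have /nbhs_ballP[e /= e0 eV] : nbhs ((f t : 'rV[R]_n) + g t) V by exact: open_nbhs_nbhs.
  have e40 : 0 < e / 4 by rewrite divr_gt0.
  have [k] := ltr_add_invr e40; rewrite add0r -/(r k) => ke.
  have rk0 : 0 < r k by rewrite invr_gt0.
  have [p hp] := rV_rat_dense (f t) rk0; have [q hq] := rV_rat_dense (g t) rk0.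
  exists ((p, q), k) => //; rewrite mem_set; first by split; rewrite /= /Bl /= distrC.
  move=> a b /= ha hb; apply: eV; rewrite -ball_normE /=.
  apply: (@le_lt_trans _ _ (`|(f t : 'rV[R]_n) - a| + `|(g t : 'rV[R]_n) - b|)).
    by rewrite (le_trans _ (ler_normD _ _))// addrACA opprD.
  have d1 := ler_distD (map_mx ratr p) (f t : 'rV[R]_n) a.
  have d2 := ler_distD (map_mx ratr q) (g t : 'rV[R]_n) b.
  exact: ltr_add_quarters ke hp hq ha hb d1 d2.
apply: countable_bigcupT_measurable; first exact: countableP.
move=> z; case: ifP => // _; apply: measurableI.
  by rewrite -[X in measurable X]setTI; exact: mf.
by rewrite -[X in measurable X]setTI; exact: mg.
Qed.

End BorelRowAddition.

Section LinearSpan.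
Context (R : realType) (V : lmodType R[i]) (A : set V).

Lemma lin_span0 : lin_span A 0.
Proof.
by exists 0%N, (fun=> 0), (fun=> 0); split; [case|rewrite big_ord0].
Qed.

Lemma sub_lin_span : A `<=` lin_span A.
Proof.
move=> v Av; exists 1%N, (fun=> 1), (fun=> v); split => //.
by rewrite big_ord1 scale1r.
Qed.

Lemma lin_spanD k u v : lin_span A u -> lin_span A v -> lin_span A (k *: u + v).
Proof.
move=> [m [c [w [Aw ->]]]] [m' [c' [w' [Aw' ->]]]].
exists (m + m')%N.
exists (fun i : 'I_(m + m') => match fintype.split i with inl j => k * c j | inr j => c' j end).
exists (fun i : 'I_(m + m') => match fintype.split i with inl j => w j | inr j => w' j end); split.
  by move=> i; case: (fintype.split i).
rewrite big_split_ord /= scaler_sumr; congr (_ + _); apply: eq_bigr => i _.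
  by rewrite (unsplitK (inl i)) scalerA.
by rewrite (unsplitK (inr i)).
Qed.

End LinearSpan.

Section ConjugateMultiplication.
Context (R : realType) d (O : measurableType d) (P : probability O R).
Local Notation ip := (@L2ip _ _ _ P).
Local Notation BH := (g_sigma_algebraType (ip_open ip)).
Variables (C : set O) (mC : measurable C).

Let mcm (u : L2 P) : measurable_fun setT (fun x => (u x)^* * cindic R C x).
Proof.
apply: measurable_complexM; last exact: measurable_cindic.
exact/measurable_complex_conj/L2_measurable.
Qed.

Let cm_lty (u : L2 P) : (\int[P]_x (sqmod ((u x)^* * cindic R C x))%:E < +oo)%E.
Proof.
apply: (@le_lt_trans _ _ (\int[P]_x (sqmod (u x))%:E)%E).
  apply: ge0_le_integral => //.
  - by move=> x _; rewrite lee_fin sqmod_ge0.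
  - exact: measurable_sqmodE.
  - exact/measurable_sqmodE/L2_measurable.
  - move=> x _; rewrite lee_fin sqmodM sqmodC indicE.
    have -> : sqmod (u x)^* = sqmod (u x) by case: (L2val u x) => a b; rewrite /sqmod /= sqrrN.
    by case: (x \in C); rewrite ?expr1n ?mulr1 ?expr0n ?mulr0 ?sqmod_ge0.
exact/L2_sq_lty/ae_eq_refl/L2_measurable.
Qed.

(** Multiplication by an element of L^2 need not preserve L^2. But pairing a product [u v] with the
    indicator of [C] is the inner product of [v] with this vector, which depends on [u] alone. *)
Definition conj_mul (u : L2 P) : L2 P := mkL2 (mcm u) (cm_lty u).

Lemma conj_mulE u : conj_mul u = (fun x => (u x)^* * cindic R C x) %[ae P].
Proof. exact: mkL2E. Qed.

Lemma ip_conj_mul (u v w : L2 P) : w = (fun x => u x * v x) %[ae P] ->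
  ip w (L2ind P C) = ip v (conj_mul u).
Proof.
move=> wE; rewrite L2ip_indE//.
rewrite (@L2ipE _ _ _ _ v _ v (fun x => (u x)^* * cindic R C x)) //; last 2 first.
- exact: ae_eq_refl.
- exact: conj_mulE.
apply: cintegral_ae.
- apply: measurable_complexM; first exact: L2_measurable.
  exact: measurable_cindic.
- apply: measurable_complexM; first exact: L2_measurable.
  exact: measurable_complex_conj.
- apply: filterS wE => x /[apply] ->.
  rewrite /cindic; case: (L2val u x) (L2val v x) => [a b] [c e].
  by apply/eqP; rewrite eq_complex /=; apply/andP; split; apply/eqP; ring.
Qed.

(** Both sides are the integral over [C] of the real part of [u v]. In weak measurability the
    operation can thus be moved to the fixed test vector. *)
Lemma conj_mul_sym (u v : L2 P) : reC (ip (conj_mul u) v) = reC (ip u (conj_mul v)).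
Proof.
rewrite (@L2ipE _ _ _ _ (conj_mul u) v (fun x => (u x)^* * cindic R C x) v) //; last 2 first.
- exact: conj_mulE.
- exact: ae_eq_refl.
rewrite (@L2ipE _ _ _ _ u (conj_mul v) u (fun x => (v x)^* * cindic R C x)) //; last 2 first.
- exact: ae_eq_refl.
- exact: conj_mulE.
rewrite /cintegral /=; apply: eq_Rintegral => x _.
by rewrite /cindic; case: (L2val u x) (L2val v x) => [a b] [c e] /=; ring.
Qed.

Variable q : nat -> L2 P.
Hypothesis q_dense : ip_dense ip (range q).

Lemma measurable_conj_mul dT (T : measurableType dT) (f : T -> L2 P) :
  measurable_fun setT (f : T -> BH) ->
  measurable_fun setT ((fun t => conj_mul (f t)) : T -> BH).
Proof.
move=> mf; apply: (measurable_to_L2_weak q_dense) => j.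
under eq_fun do rewrite conj_mul_sym.
exact: (measurable_L2_rip q_dense mf (@measurable_cst _ _ T BH setT (conj_mul (q j)))).
Qed.

End ConjugateMultiplication.

Section LinearSpanClosure.
Context (R : realType) d (O : measurableType d) (P : probability O R).
Local Notation nrm := (ip_norm (@L2ip _ _ _ P)).

Lemma lin_span_closure (A : set (L2 P)) : closed_subspace
  [set u | forall e, 0 < e -> exists2 v, lin_span A v & nrm (u - v) < e].
Proof.
split.
- by move=> e e0; exists 0; [exact: lin_span0|rewrite subrr (ip_norm0 (@L2ip _ _ _ P))].
- move=> k u v hu hv e e0.
  have k0 : 0 < 1 + Num.sqrt (sqmod k) by rewrite ltr_pwDl ?sqrtr_ge0.
  have d0 : 0 < e / 2 / (1 + Num.sqrt (sqmod k)) by rewrite !divr_gt0.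
  have [u' Au' uu'] := hu _ d0; have [v' Av' vv'] := hv (e / 2) ltac:(by rewrite divr_gt0).
  exists (k *: u' + v'); first exact: lin_spanD.
  rewrite opprD addrACA -scalerBr (le_lt_trans (ler_ip_normD (@L2ip _ _ _ P) _ _))//.
  rewrite L2_normZ [ltRHS](splitr e) ler_ltD// (@le_trans _ _
    ((1 + Num.sqrt (sqmod k)) * nrm (u - u')))//.
    by rewrite ler_wpM2r ?ip_norm_ge0// lerDr.
  by rewrite mulrC -ler_pdivlMr// ltW.
- move=> u hu e e0; have e20 : 0 < e / 2 by rewrite divr_gt0.
  have [v hv vu] := hu _ e20; have [w Aw vw] := hv _ e20.
  exists w => //; rewrite (le_lt_trans (ler_ip_dist (@L2ip _ _ _ P) u v w))//.
  by rewrite [ltRHS](splitr e) ltrD// (ip_distC (@L2ip _ _ _ P)).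
Qed.

End LinearSpanClosure.

(** * Tensor decomposition over two disjoint windows *)

Section WindowTensor.
Context (R : realType) dO (Omega : measurableType dO) (Pr : probability Omega R).
Hypothesis Pr_complete : measure_is_complete Pr.
Context dY (Y : measurableType dY) (lambda : {measure set Y -> \bar R}).
Context (eta : R.-sigmafker Omega ~> Y) (eta_poisson : is_poisson_process Pr lambda eta).
Variables (B : nat -> set Y) (B_basis : counts_basis_spec Pr eta B).

Local Notation ip := (@L2ip _ _ _ Pr).
Local Notation nrm := (ip_norm ip).
Local Notation sigma_eta := (sigma_eta Pr eta).

Variables (W1 W2 : set Y) (mW1 : measurable W1) (mW2 : measurable W2).
Hypothesis W12 : W1 `&` W2 = set0.

Local Notation G1 := (sigma_eta W1).
Local Notation G2 := (sigma_eta W2).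

Definition window_rectangles : set (set Omega) :=
  [set D | exists D1 D2, [/\ G1 D1, G2 D2 & D = D1 `&` D2]].

Let sG W : sigma_algebra setT (sigma_eta W).
Proof. exact: (sigma_eta_sigma_algebra Pr_complete). Qed.

Let Gm W : sigma_eta W `<=` measurable.
Proof. exact: (sigma_eta_measurable Pr_complete). Qed.

Let GT W : sigma_eta W setT.
Proof. by have [G0 GC _] := sG W; rewrite -(setD0 setT); exact: GC. Qed.

Let GI W : setI_closed (sigma_eta W).
Proof.
move=> D D' sD sD'; rewrite -(sigma_algebra_id (sG W)).
by apply: (@measurableI _ (g_sigma_algebraType (sigma_eta W))); exact: sub_sigma_algebra.
Qed.

Lemma window_rectangles_measurable : window_rectangles `<=` measurable.
Proof. by move=> _ [D [D' [/Gm mD /Gm mD' ->]]]; exact: measurableI. Qed.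

Lemma window_rectangles_setI : setI_closed window_rectangles.
Proof.
move=> _ _ [D [D' [sD sD' ->]]] [C [C' [sC sC' ->]]].
by exists (D `&` C), (D' `&` C'); split; [exact: GI|exact: GI|rewrite setIACA].
Qed.

(** The count of a subset of the union is the sum of its counts in the two disjoint pieces, each of
    which is measurable for the sigma-algebra generated by the rectangles. *)
Lemma sigma_etaU : sigma_eta (W1 `|` W2) `<=` ae_completion Pr window_rectangles.
Proof.
have mid : measurable_fun setT (id : Omega -> g_sigma_algebraType window_rectangles).
  move=> _ A mA; rewrite setTI preimage_id.
  have : <<s window_rectangles >> `<=` measurable.
    apply: smallest_sub; first exact: sigma_algebra_measurable.
    exact: window_rectangles_measurable.
  exact.
have := complete_preimage_sigma_algebra Pr_complete mid; set G := [set D | _] => sGG.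
move=> D sD; split; first exact: Gm sD.
suff : G D by move=> [V mV DV]; exists V.
apply: sigma_eta_sub sD => // C V mC CW mV.
exists [set w | V (eta w C)]; last by apply: negligibleS (negligible_set0 _) => x [[]|[]].
have m1 : measurable_fun setT ((fun w => eta w (C `&` W1)) :
    g_sigma_algebraType window_rectangles -> \bar R).
  move=> _ A mA; rewrite setTI; apply: sub_sigma_algebra.
  exists [set w | A (eta w (C `&` W1))], setT; split => //; last by rewrite setIT.
  by apply: sigma_eta_gen => //; exact: measurableI.
have m2 : measurable_fun setT ((fun w => eta w (C `&` W2)) :
    g_sigma_algebraType window_rectangles -> \bar R).
  move=> _ A mA; rewrite setTI; apply: sub_sigma_algebra.
  exists setT, [set w | A (eta w (C `&` W2))]; split => //; last by rewrite setTI.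
  by apply: sigma_eta_gen => //; exact: measurableI.
have -> : [set w | V (eta w C)] = setT `&`
    (fun w => (eta w (C `&` W1) + eta w (C `&` W2))%E) @^-1` V.
  rewrite setTI; apply/funext => w /=; congr V.
  rewrite -measureU; [|exact: measurableI|exact: measurableI|].
    by rewrite -setIUr; congr (eta w _); apply/esym/setIidPl.
  by rewrite setIACA W12 setI0.
exact: (emeasurable_funD m1 m2).
Qed.

Lemma window_mul_lty u v : u \in G_measurable (mu:=Pr) G1 -> v \in G_measurable (mu:=Pr) G2 ->
  (\int[Pr]_x (sqmod (u x * v x))%:E < +oo)%E.
Proof.
apply: indep_mul_sq_lty => //.
exact: (sigma_eta_indep Pr_complete eta_poisson B_basis mW1 mW2 W12).
Qed.

Lemma window_mul_ip (u u' v v' w w' : L2 Pr) :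
  u \in G_measurable G1 -> u' \in G_measurable G1 ->
  v \in G_measurable G2 -> v' \in G_measurable G2 ->
  w = (fun x => u x * v x) %[ae Pr] -> w' = (fun x => u' x * v' x) %[ae Pr] ->
  ip w w' = ip u u' * ip v v'.
Proof.
apply: indep_mul_ip => //.
exact: (sigma_eta_indep Pr_complete eta_poisson B_basis mW1 mW2 W12).
Qed.

Lemma window_mul_total w : w \in G_measurable (mu:=Pr) (sigma_eta (W1 `|` W2)) ->
  forall e, 0 < e -> exists2 z, lin_span [set z : L2 Pr | exists u v : L2 Pr,
    [/\ u \in G_measurable G1, v \in G_measurable G2 & z = (fun x => u x * v x) %[ae Pr]]] z &
    nrm (w - z) < e.
Proof.
apply: (closed_subspace_density (lin_span_closure _) window_rectangles_setI
  _ window_rectangles_measurable _ (sG _) sigma_etaU).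
  by exists setT, setT; rewrite setIT; split => //; exact: GT.
move=> _ [D [D' [sD sD' ->]]] e e0.
exists (L2ind Pr (D `&` D')); last by rewrite subrr (ip_norm0 ip).
apply: sub_lin_span; exists (L2ind Pr D), (L2ind Pr D').
have gm (A : set Omega) W : sigma_eta W A -> L2ind Pr A \in G_measurable (sigma_eta W).
  move=> sA; apply/asboolP; exists (cindic R A); last exact: (L2indE Pr (Gm sA)).
  by apply: measurable_cindic; exact: sub_sigma_algebra.
split; [exact: gm|exact: gm|].
have mD := Gm sD; have mD' := Gm sD'.
apply: filterS3 (L2indE Pr (measurableI _ _ mD mD')) (L2indE Pr mD) (L2indE Pr mD').
move=> x + + + _; move=> -> // -> // -> //.
by rewrite /cindic indicI -rmorphM.
Qed.

End WindowTensor.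

(** * Measurability of sections *)

Section PreimageMeasurable.
Context d1 (T : pointedType) (U : measurableType d1) (phi : T -> U).
Context d2 (S : measurableType d2).
Local Notation T' := (g_sigma_algebra_preimageType phi).

Lemma measurable_preimageP (f : S -> T) :
  measurable_fun setT (f : S -> T') <-> measurable_fun setT (phi \o f).
Proof.
split=> mf mS B mB.
  rewrite setTI comp_preimage -[X in measurable X]setTI.
  by apply: mf => //; exists B => //; rewrite setTI.
by case: mB => C mC <-; rewrite setTI -comp_preimage; exact: mf.
Qed.

End PreimageMeasurable.

Section SectionMeasurable.
Context (R : realType) d (O : measurableType d) (P : probability O R).
Local Notation ip := (@L2ip _ _ _ P).
Local Notation nrm := (ip_norm ip).
Local Notation BH := (g_sigma_algebraType (ip_open ip)).
Variable q : nat -> L2 P.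
Hypothesis q_dense : ip_dense ip (range q).

(** Weak measurability with test vectors [g j t] that move with [t]. The distances from [f] to [g j]
    come from inner products with the [g k - g j], and the distances to the fixed [q i] from an
    infimum over [j]. *)
Lemma measurable_to_L2_sections dT (T : measurableType dT) (f : T -> L2 P)
    (g : nat -> T -> L2 P) :
  (forall t e, 0 < e -> exists j, nrm (f t - g j t) < e) ->
  (forall j, measurable_fun setT (g j : T -> BH)) ->
  (forall j, measurable_fun setT (fun t => reC (ip (f t) (g j t)))) ->
  measurable_fun setT (f : T -> BH).
Proof.
move=> fg mg mfg; apply: (measurable_to_L2 q_dense) => i.
have mfgj j : measurable_fun setT (fun t => nrm (f t - g j t)).
  apply: (@measurable_L2_norm_weak _ _ _ _ _ _ (fun t => f t - g j t)
    (fun k t => g k t - g j t)).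
  - move=> t e e0; have [k hk] := fg t e e0; exists k.
    by rewrite opprB addrA subrK.
  - move=> k; rewrite (_ : (fun t => _) = fun t => reC (ip (f t) (g k t)) -
        reC (ip (f t) (g j t)) - (reC (ip (g j t) (g k t)) - reC (ip (g j t) (g j t)))).
      apply: measurable_funB; apply: measurable_funB; first exact: mfg.
      + exact: mfg.
      + exact: (measurable_L2_rip q_dense (mg j) (mg k)).
      + exact: (measurable_L2_rip q_dense (mg j) (mg j)).
    apply/funext => t; rewrite (ipBl ip) (ipBr ip) (ipBr ip) !reD !reN !reD !reN.
    by ring.
  - by move=> k; exact: (measurable_L2_distM q_dense (mg _) (mg _)).
rewrite (_ : (fun t => _) = fun t => inf (range (fun j => nrm (f t - g j t) + nrm (g j t - q i)))).
  apply: (@measurable_inf_seq _ _ _ (fun j t => nrm (f t - g j t) + nrm (g j t - q i))).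
    by move=> t; exists 0 => _ [j _ <-]; rewrite addr_ge0 ?ip_norm_ge0.
  by move=> j; apply: measurable_funD; [exact: mfgj|exact: measurable_L2_dist (mg j)].
apply/funext => t; rewrite (@ip_dist_inf _ _ ip _ _ (range (g ^~ t))) ?image_comp//.
by move=> e /(fg t)[j]; exists (g j t) => //; exists j.
Qed.

End SectionMeasurable.

Section ConeMeasurable.
Context (R : realType) (n : nat) (P : closedConvexCone R n).

Lemma measurable_cone_val : measurable_fun setT (@cone_val R n P).
Proof. exact: (measurable_preimageP (@cone_val R n P) (id : conePt P -> conePt P)).1. Qed.

End ConeMeasurable.

(** * Fibres, multiplication and Borel structure *)

Section PoissonProductSystem.
Context (R : realType) (n : nat) (P : closedConvexCone R n).
Context dO (Omega : measurableType dO) (Pr : probability Omega R).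
Hypothesis Pr_complete : measure_is_complete Pr.
Context dY (Y : measurableType dY) (lambda : {sigma_finite_measure set Y -> \bar R}).
Context (eta : R.-sigmafker Omega ~> Y) (eta_poisson : is_poisson_process Pr lambda eta).
Hypothesis Omega_generated : measurable = sigma_eta Pr eta setT.
Variables (B : nat -> set Y) (B_basis : counts_basis_spec Pr eta B).
Context (act : Y -> 'rV[R]_n -> Y) (act_meas : is_measurable_action act).
Hypothesis lambda_invariant : forall (A : set Y) (a : 'rV[R]_n), measurable A ->
  lambda (translate act A a) = lambda A.
Variables (X : set Y) (mX : measurable X).
Hypothesis X_shift : forall a, cone_set P a -> translate act X a `<=` X.

Local Notation ip := (@L2ip _ _ _ Pr).
Local Notation nrm := (ip_norm ip).
Local Notation BH := (g_sigma_algebraType (ip_open ip)).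
Local Notation bRV := (borelRV R n).
Local Notation tr := (translate act).
Local Notation seta := (sigma_eta Pr eta).
Local Notation E := (poissonE Pr eta act X P).
Local Notation H := (fibre Pr eta act X (P:=P)).
Local Notation U := (translateU Pr_complete eta_poisson Omega_generated B_basis
  act_meas lambda_invariant).
Local Notation dense_seq := (window_seq Pr eta B setT).
Local Notation W a := (X `\` tr X (val a)).

Local Notation fip := (@fibre_ip _ _ _ Pr _ _ eta _ act X P).

Let dd : ip_dense ip (range dense_seq).
Proof. exact: (dense_seq_dense Pr_complete eta_poisson Omega_generated B_basis). Qed.

Let mtr A (a : 'rV[R]_n) : measurable A -> measurable (tr A a).
Proof. exact: measurable_translate. Qed.

Let mW (a : conePt P) : measurable (W a).
Proof. by apply: measurableD => //; exact: mtr. Qed.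

Let cone_valP (a : conePt P) : cone_set P (val a).
Proof. exact: set_mem (valP a). Qed.

Lemma translate_window (a b : conePt P) :
  tr (W b) (val a) = tr X (val a) `\` tr X (val (cone_add a b)).
Proof. by rewrite translate_setD// translateD//= addrC. Qed.

Lemma windowU (a b : conePt P) : W (cone_add a b) = W a `|` tr (W b) (val a).
Proof.
have sub : tr X (val (cone_add a b)) `<=` tr X (val a).
  rewrite /= addrC -translateD// => y [z Xz <-]; exists z => //.
  exact: (X_shift (cone_valP b)).
rewrite translate_window; apply/seteqP; split => y /=.
  move=> [Xy nXy]; have [Xay|] := pselect (tr X (val a) y); first by right.
  by left.
by move=> [[Xy nXy]|[Xy nXy]]; split => //; [move=> /sub|exact: (X_shift (cone_valP a))].
Qed.

Lemma windowI (a b : conePt P) : W a `&` tr (W b) (val a) = set0.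
Proof.
by rewrite translate_window; apply/seteqP; split => // y [[_ h] [h' _]].
Qed.

Lemma fibre_shift (a b : conePt P) (v : H b) :
  U (val a) (L2sub_val v) \in G_measurable (mu:=Pr) (seta (tr (W b) (val a))).
Proof. by apply: translateU_window => //; exact: L2subP. Qed.

Lemma G_measurableM (G : set (set Omega)) (u v w : L2 Pr) :
  u \in G_measurable G -> v \in G_measurable G -> w = (fun x => u x * v x) %[ae Pr] ->
  w \in G_measurable G.
Proof.
move=> /asboolP[f mf uf] /asboolP[g mg vg] wE; apply/asboolP.
exists (fun x => f x * g x); first exact: measurable_complexM.
by apply: filterS3 wE uf vg => x + + + _; move=> -> // -> // -> .
Qed.

Lemma G_measurableS (G G' : set (set Omega)) (u : L2 Pr) : G `<=` G' ->
  u \in G_measurable G -> u \in G_measurable G'.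
Proof.
move=> GG' /asboolP[f mf uf]; apply/asboolP; exists f => // _ V mV.
exact: (sub_sigma_algebra2 GG' (mf measurableT V mV)).
Qed.

Lemma fibre_mul_lty (a b : conePt P) (u : H a) (v : H b) :
  (\int[Pr]_x (sqmod (L2sub_val u x * U (val a) (L2sub_val v) x))%:E < +oo)%E.
Proof.
apply: (window_mul_lty Pr_complete eta_poisson B_basis (mW a) (mtr _ (mW b)) (windowI a b)).
  exact: L2subP.
exact: fibre_shift.
Qed.

Definition fibre_mulL2 (a b : conePt P) (u : H a) (v : H b) : L2 Pr :=
  mkL2 (measurable_complexM (L2_measurable (L2sub_val u))
    (L2_measurable (U (val a) (L2sub_val v)))) (fibre_mul_lty u v).

Lemma fibre_mulL2E (a b : conePt P) (u : H a) (v : H b) : fibre_mulL2 u v =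
  (fun x => L2sub_val u x * U (val a) (L2sub_val v) x) %[ae Pr].
Proof. exact: mkL2E. Qed.

Lemma fibre_mul_subproof (a b : conePt P) (u : H a) (v : H b) :
  fibre_mulL2 u v \in G_measurable (seta (W (cone_add a b))).
Proof.
rewrite windowU; apply: G_measurableM (fibre_mulL2E u v).
  by apply: G_measurableS (L2subP u); exact: (sigma_etaS Pr_complete (@subsetUl _ _ _)).
by apply: G_measurableS (fibre_shift a v); exact: (sigma_etaS Pr_complete (@subsetUr _ _ _)).
Qed.

Definition fibre_mul (a b : conePt P) (u : H a) (v : H b) : H (cone_add a b) :=
  MkL2sub (fibre_mul_subproof u v).

Definition poisson_mul (x y : E) : E :=
  existT _ (cone_add (projT1 x) (projT1 y)) (fibre_mul (projT2 x) (projT2 y)).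

Lemma poisson_mulP : is_poisson_mul poisson_mul.
Proof.
move=> [a u] [b v]; split => //=.
have -> : shift_unitary eta act X 0 (val b) (val a) (L2sub_val v) = U (val a) (L2sub_val v).
  apply: shift_unitaryE => //.
  by rewrite /sigma_window translate0//; exact: L2subP.
exact: fibre_mulL2E.
Qed.

(** Comparison in the ambient L^2 avoids transport along an equality of base points, as between
    [a + (b + c)] and [(a + b) + c]. *)
Lemma poissonE_ext (x y : E) : projT1 x = projT1 y ->
  L2sub_val (projT2 x) = L2sub_val (projT2 y) -> x = y.
Proof.
case: x y => [a u] [b v] /= ab; case: _ / ab v => v uv.
by congr existT; exact: val_inj.
Qed.

Lemma measurable_poissonEP d (T : measurableType d) (f : T -> E) :
  measurable_fun setT f <->
  measurable_fun setT (fun t => cone_val (projT1 (f t)) : bRV) /\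
  measurable_fun setT ((fun t => L2sub_val (projT2 (f t))) : T -> BH).
Proof.
have E1 := measurable_preimageP (@poissonE_incl _ _ _ Pr _ _ eta _ act X P) f.
have E2 := measurable_preimageP (@cone_val R n P) (fun t => projT1 (f t)).
split=> [/E1 mf|[m1 m2]].
  split; last exact: (measurableT_comp measurable_snd mf).
  exact: (E2.1 (measurableT_comp measurable_fst mf)).
apply/E1; apply: measurable_fun_pair => //.
exact: E2.2.
Qed.

Lemma fibre_ip_normB (a : conePt P) (u v : H a) :
  ip_norm (@fip a) (u - v) =
  nrm (L2sub_val u - L2sub_val v).
Proof. by []. Qed.

Lemma fibre_ip_linearl (a : conePt P) (w : H a) :
  linear_for *%R ((@fip a)^~ w).
Proof. by move=> k u v; exact: L2ip_linearl. Qed.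

Lemma fibre_ip_linearr (a : conePt P) (w : H a) :
  linear_for (Num.conj \; *%R) (@fip a w).
Proof. by move=> k u v; exact: L2ip_linearr. Qed.

HB.instance Definition _ (a : conePt P) := @bilinear_isBilinear.Build R[i] (H a) (H a) R[i]
  ( *%R) (Num.conj \; *%R) (@fip a)
  (@fibre_ip_linearl a, @fibre_ip_linearr a).

Lemma fibre_ip_hermitian (a : conePt P) (u v : H a) :
  fibre_ip u v = (-1) ^+ false * Num.conj (fibre_ip v u).
Proof. exact: L2ip_hermitian. Qed.

HB.instance Definition _ (a : conePt P) := @isHermitianSesquilinear.Build R[i] (H a) false
  Num.conj (@fip a) (@fibre_ip_hermitian a).

Lemma fibre_ip_gt0 (a : conePt P) (u : H a) : u != 0 -> 0 < fibre_ip u u.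
Proof. by move=> u0; apply: L2ip_gt0. Qed.

HB.instance Definition _ (a : conePt P) := @isDotProduct.Build R[i] (H a)
  (@fip a) (@fibre_ip_gt0 a).

Lemma fibre_hilbert (a : conePt P) : is_hilbert (@fip a).
Proof.
split; first by exists (@fip a).
move=> u cu; have [l hl] := @L2_complete _ _ _ Pr (fun k => L2sub_val (u k)) cu.
have lG : l \in G_measurable (seta (W a)).
  have [_ _ cl] := G_measurable_closed_subspace Pr (seta (W a)).
  apply: cl => e e0; have [N hN] := hl e e0; exists (L2sub_val (u N)).
    exact: L2subP.
  exact: hN.
by exists (MkL2sub lG) => e e0; exact: hl.
Qed.

(** Totality is proved in the ambient L^2; this brings the approximating combinations back into a
    fibre. *)
Lemma fibre_lin_span (a : conePt P) (A : set (L2 Pr)) (S : set (H a)) (z : L2 Pr) :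
  (forall v, A v -> exists2 w : H a, S w & L2sub_val w = v) -> lin_span A z ->
  exists2 w : H a, lin_span S w & L2sub_val w = z.
Proof.
move=> AS [m [k [v [Av ->]]]].
have ex i : exists w : H a, S w /\ L2sub_val w = v i.
  by have [w Sw wv] := AS _ (Av i); exists w.
have [w hw] := choice ex; exists (\sum_i k i *: w i).
  by exists m, k, w; split => // i; have [] := hw i.
have vD (u u' : H a) : L2sub_val (u + u') = L2sub_val u + L2sub_val u' by [].
rewrite (big_morph (fun u : H a => L2sub_val u) vD (erefl : L2sub_val (0 : H a) = 0)).
by apply: eq_bigr => i _; have [_ <-] := hw i.
Qed.

Definition fibre_window_seq (j : nat) (a : conePt P) : H a :=
  MkL2sub (window_seq_G_measurable Pr_complete B_basis j (mW a)).

Lemma fibre_window_seq_dense (a : conePt P) (u : H a) e : 0 < e ->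
  exists j, ip_norm (@fip a) (u - fibre_window_seq j a) < e.
Proof.
exact: (window_seq_dense Pr_complete eta_poisson B_basis (mW a) (L2subP u)).
Qed.

Lemma fibre_separable (a : conePt P) : ip_separable (@fip a).
Proof.
exists (range (fibre_window_seq^~ a)).
  exact: (card_le_trans (card_image_le _ _) (countableP _)).
move=> u e e0; have [j hj] := fibre_window_seq_dense u e0.
by exists (fibre_window_seq j a) => //; exists j.
Qed.

(** The constant 1 is measurable for every sigma-algebra and has norm 1. *)
Lemma fibre_nonzero (a : conePt P) : exists u : H a, u != 0.
Proof.
have sT : seta (W a) setT.
  have [G0 GC _] := sigma_eta_sigma_algebra Pr_complete eta (W a).
  by rewrite -(setD0 setT); exact: GC.
have oG : L2ind Pr setT \in G_measurable (seta (W a)).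
  apply/asboolP; exists (cindic R setT); last exact: (L2indE Pr measurableT).
  by apply: measurable_cindic.
exists (MkL2sub oG); apply/eqP => /(congr1 (fun u : H a => nrm (L2sub_val u) ^+ 2)).
rewrite (L2ind_norm Pr measurableT) probability_setT (ip_norm0 ip) expr0n /=.
by move/eqP; rewrite oner_eq0.
Qed.

Lemma fibre_bij (a : conePt P) :
  set_bij setT ((fun x : E => projT1 x) @^-1` [set a]) (fun u : H a => existT _ a u : E).
Proof.
split=> [u _|u v _ _ uv|[b u] /= ba] //.
  by apply: val_inj; exact: (congr1 (fun x : E => L2sub_val (projT2 x)) uv).
by case: _ / ba; exists u.
Qed.

Local Notation mul := poisson_mul.

Lemma poisson_mulA : associative mul.
Proof.
move=> x y z; apply: poissonE_ext; first by apply: val_inj; rewrite /= addrA.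
case: x y z => [a u] [b v] [c w] /=; apply: L2_inj.
have := translateU_mul Pr_complete eta_poisson Omega_generated B_basis act_meas
  lambda_invariant (val a) (fibre_mulL2E v w).
rewrite translateU_comp => h.
apply: filterS2 (filterI (fibre_mulL2E u (fibre_mul v w)) (fibre_mulL2E (fibre_mul u v) w))
  (filterI (fibre_mulL2E u v) h) => x [+ +] [+ +] _.
by move=> -> // -> // /= -> // -> //; rewrite mulrA.
Qed.

Lemma fibre_mul_linearl (a b : conePt P) (v : H b) :
  linear_for *:%R (fun u : H a => fibre_mul u v).
Proof.
move=> k u u'; apply: val_inj => /=; apply: L2_inj.
have h := L2_lin k (fibre_mulL2E u v) (fibre_mulL2E u' v).
have h' := L2_lin k (ae_eq_refl Pr _ (L2sub_val u : Omega -> R[i]))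
  (ae_eq_refl Pr _ (L2sub_val u' : Omega -> R[i])).
apply: filterS3 (fibre_mulL2E (k *: u + u') v) h h' => x + + + _.
by move=> -> // -> // -> //; rewrite mulrDl mulrA.
Qed.

Lemma fibre_mul_linearr (a b : conePt P) (u : H a) :
  linear_for *:%R (fun v : H b => fibre_mul u v).
Proof.
move=> k v v'; apply: val_inj => /=; apply: L2_inj.
have h := L2_lin k (fibre_mulL2E u v) (fibre_mulL2E u v').
have h' := L2_lin k (ae_eq_refl Pr _ (U (val a) (L2sub_val v) : Omega -> R[i]))
  (ae_eq_refl Pr _ (U (val a) (L2sub_val v') : Omega -> R[i])).
rewrite -translateU_lin in h'.
apply: filterS3 (fibre_mulL2E u (k *: v + v')) h h' => x + + + _.
by move=> -> // -> // -> //; rewrite mulrDr mulrCA.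
Qed.

Lemma fibre_mul_ip (a b : conePt P) (u u' : H a) (v v' : H b) :
  fibre_ip (fibre_mul u v) (fibre_mul u' v') = fibre_ip u u' * fibre_ip v v'.
Proof.
have := window_mul_ip Pr_complete eta_poisson B_basis (mW a) (mtr (val a) (mW b)) (windowI a b)
  (L2subP u) (L2subP u') (fibre_shift a v) (fibre_shift a v')
  (fibre_mulL2E u v) (fibre_mulL2E u' v').
by rewrite translateU_ip.
Qed.

Lemma fibre_mul_total (a b : conePt P) :
  ip_total (@fip (cone_add a b)) [set t | exists (u : H a) (v : H b), t = fibre_mul u v].
Proof.
move=> w e e0.
have wG : L2sub_val w \in G_measurable (seta (W a `|` tr (W b) (val a))).
  by rewrite -windowU; exact: L2subP.
have [z Az wz] := window_mul_total Pr_complete (mW a) (mtr (val a) (mW b))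
  (windowI a b) wG e0.
have [t At tz] : exists2 t : H (cone_add a b),
    lin_span [set t | exists (u : H a) (v : H b), t = fibre_mul u v] t & L2sub_val t = z.
  apply: fibre_lin_span Az => z' [u [v [uG vG zE]]].
  (* [v] lives on the translated window; it is the translate by [a] of [U (- val a) v], which lies
     in the fibre over [b]. *)
  have v'G : U (- val a) v \in G_measurable (seta (W b)).
    rewrite -[W b](translate0 act_meas) -(subrr (val a)) -(translateD act_meas).
    by apply: translateU_window => //; exact: mtr.
  exists (fibre_mul (MkL2sub uG : H a) (MkL2sub v'G : H b)).
    by exists (MkL2sub uG), (MkL2sub v'G).
  apply: L2_inj; apply: filterS2 (fibre_mulL2E (MkL2sub uG : H a) (MkL2sub v'G : H b)) zE => x + + _.
  by move=> -> // -> //=; rewrite translateU_comp subrr translateU0.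
by exists t => //; rewrite fibre_ip_normB tz.
Qed.

(** The fibre over [cone_add a b] itself serves as the Hilbert tensor product, with the
    multiplication as [tau] and the identity as the unitary. *)
Lemma fibre_mul_unitary (a b : conePt P) :
  exists (T : lmodType R[i]) (ipT : T -> T -> R[i])
         (tau : {bilinear H a -> H b -> T}) (V : T -> H (cone_add a b)),
    [/\ is_hilbert_tensor (@fip a) (@fip b) ipT tau,
        is_unitary_on ipT (@fip (cone_add a b)) setT setT V &
        forall u v, existT _ (cone_add a b) (V (tau u v)) =
          mul (existT _ a u) (existT _ b v)].
Proof.
pose tau : {bilinear H a -> H b -> H (cone_add a b)} :=
  HB.pack (fun (u : H a) (v : H b) => fibre_mul u v)
    (@bilinear_isBilinear.Build R[i] (H a) (H b) (H (cone_add a b)) *:%R *:%R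
      (fun (u : H a) (v : H b) => fibre_mul u v)
      (@fibre_mul_linearl a b, @fibre_mul_linearr a b)).
exists (H (cone_add a b)), (@fip (cone_add a b)), tau, id; split => //.
- split; first exact: fibre_hilbert.
    by move=> u u' v v'; exact: fibre_mul_ip.
  exact: fibre_mul_total.
- by split => //; rewrite image_id.
Qed.

(** Paired with a cylinder indicator, the product of [f] and [U a g] becomes the inner product of
    [U a g] with [conj_mul f], two maps already known to be measurable. *)
Lemma measurable_poisson_mul : measurable_fun setT (fun x : E * E => mul x.1 x.2).
Proof.
have [m1 m2] := (measurable_poissonEP (fun x : E => x)).1 (@measurable_id _ E setT).
have m11 : measurable_fun setT (fun x : E * E => cone_val (projT1 x.1) : bRV).
  exact: (measurableT_comp m1 measurable_fst).
have m12 : measurable_fun setT (fun x : E * E => cone_val (projT1 x.2) : bRV).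
  exact: (measurableT_comp m1 measurable_snd).
have m21 : measurable_fun setT ((fun x => L2sub_val (projT2 x.1)) : E * E -> BH).
  exact: (measurableT_comp m2 measurable_fst).
have m22 : measurable_fun setT ((fun x => L2sub_val (projT2 x.2)) : E * E -> BH).
  exact: (measurableT_comp m2 measurable_snd).
apply/measurable_poissonEP; split; first exact: measurable_addRV m11 m12.
apply: (measurable_to_L2_cylinder Pr_complete eta_poisson Omega_generated B_basis) => s.
have mc := measurable_cylinder Pr_complete B_basis s measurableT.
rewrite (_ : (fun x => _) = fun x : E * E => ip (U (val (projT1 x.1)) (L2sub_val (projT2 x.2)))
    (conj_mul mc (L2sub_val (projT2 x.1)))).
  apply: (measurable_L2_ip dd).
    exact: (measurable_translateU Pr_complete eta_poisson Omega_generated B_basis act_meas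
      lambda_invariant m11 m22).
  exact: (measurable_conj_mul mc dd m21).
by apply/funext => x; apply: ip_conj_mul; exact: fibre_mulL2E.
Qed.

Local Notation wseq := fibre_window_seq.

Lemma measurable_sectionP (s : forall a : conePt P, H a) :
  measurable_fun setT (fun a : conePt P => existT _ a (s a) : E) <->
  measurable_fun setT ((fun a => L2sub_val (s a)) : conePt P -> BH).
Proof.
have h := measurable_poissonEP (fun a : conePt P => existT _ a (s a) : E).
split=> [/h[]//|ms]; apply/h; split => //; exact: measurable_cone_val.
Qed.

Lemma measurable_window_graph :
  measurable [set z : bRV * Y | (X `\` tr X z.1) z.2].
Proof.
rewrite (_ : [set z | _] = (setT `*` X) `\` [set z : bRV * Y | tr X z.1 z.2]).
  apply: measurableD; first exact: measurableX.
  exact: measurable_translate2.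
by apply/seteqP; split => [z [? ?]|z [[? ?] ?]].
Qed.

Lemma measurable_fibre_window_seq j :
  measurable_fun setT ((fun a => L2sub_val (wseq j a)) : conePt P -> BH).
Proof.
have mg : measurable_fun setT (fun z : conePt P * Y => (cone_val z.1, z.2) : bRV * Y).
  apply: measurable_fun_pair; last exact: measurable_snd.
  exact: (measurableT_comp (@measurable_cone_val R n P) measurable_fst).
apply: (measurable_window_seq Pr_complete eta_poisson Omega_generated B_basis
  (W := fun a : conePt P => W a)).
have := mg measurableT _ measurable_window_graph; rewrite setTI; exact.
Qed.

Lemma fibre_measurable_field :
  @is_measurable_field R n P _ E (fibre Pr eta act X (P:=P)) fip (fun a u => existT _ a u).
Proof.
split.
- by apply/measurable_sectionP; exact: measurable_cst.
- move=> s t /measurable_sectionP ms /measurable_sectionP mt.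
  by apply/measurable_sectionP; exact: (measurable_L2D dd ms mt).
- move=> k s /measurable_sectionP ms.
  by apply/measurable_sectionP; exact: (measurable_L2Z dd k ms).
- move=> s t /measurable_sectionP ms /measurable_sectionP mt.
  exact: (measurable_L2_ip dd ms mt).
(* Saturation: testing [t] on the sections [wseq j] alone is enough, since they are dense in every
   fibre. *)
- move=> t ht; apply/measurable_sectionP.
  apply: (measurable_to_L2_sections dd (g := fun j a => L2sub_val (wseq j a))).
  + by move=> a e e0; exact: fibre_window_seq_dense.
  + exact: measurable_fibre_window_seq.
  + move=> j; have := ht (wseq j); rewrite /measurable_section.
    by move=> /(_ ((measurable_sectionP _).2 (measurable_fibre_window_seq j)))/measurable_complexP[].
- exists wseq; split => [j|a u e e0].
    by apply/measurable_sectionP; exact: measurable_fibre_window_seq.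
  have [j hj] := fibre_window_seq_dense u e0.
  by exists (wseq j a) => //; apply: sub_lin_span; exists j.
Qed.

Definition poissonE_rVL2 (x : E) : rVL2 n Pr := (val (projT1 x), L2sub_val (projT2 x)).

Lemma poissonE_rVL2_inj : injective poissonE_rVL2.
Proof.
by move=> x y [xy1 xy2]; apply: poissonE_ext => //; exact: val_inj.
Qed.

(** The window sequence is defined at every row vector, inside the cone or not, so the condition
    makes sense on the whole product. It characterizes the fibre because the fibre is closed and the
    sequence is dense in it. *)
Lemma range_poissonE_rVL2 : range poissonE_rVL2 =
  [set z | cone_set P z.1] `&` \bigcap_k \bigcup_j
  [set z | nrm (z.2 - window_seq Pr eta B (X `\` tr X z.1) j) < k.+1%:R^-1].
Proof.
apply/seteqP; split => [_ [x _ <-]|[a u] [/= Pa hu]].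
  split=> [|k _]; first exact: cone_valP.
  have k0 : 0 < k.+1%:R^-1 :> R by rewrite invr_gt0.
  have [j hj] := fibre_window_seq_dense (projT2 x) k0.
  by exists j.
pose a' : conePt P := exist _ a (mem_set Pa).
have uG : u \in G_measurable (seta (W a')).
  have [_ _ cl] := G_measurable_closed_subspace Pr (seta (W a')).
  apply: cl => e e0; have [k] := ltr_add_invr e0; rewrite add0r => ke.
  have [j _ hj] := hu k I; exists (window_seq Pr eta B (W a') j).
    exact: (window_seq_G_measurable Pr_complete B_basis j (mW a')).
  by rewrite (ip_distC ip); exact: lt_trans hj ke.
by exists (existT _ a' (MkL2sub uG)).
Qed.

Lemma poissonE_standard_borel : standard_borel R E.
Proof.
have [m1 m2] := (measurable_poissonEP (fun x : E => x)).1 (@measurable_id _ E setT).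
exists (rVL2 n Pr), poissonE_rVL2; split.
- exact: metric_hausdorff.
- exact: (rVL2_separable n dd).
- exact: poissonE_rVL2_inj.
- rewrite (borel_rVL2 n dd) range_poissonE_rVL2; apply: measurableI.
    have mP : measurable (cone_set P : set bRV).
      rewrite -[cone_set P]setCK; apply: measurableC; apply: sub_sigma_algebra.
      by rewrite openC; exact: cone_closed.
    by have := @measurable_fst _ _ bRV BH measurableT _ mP; rewrite setTI.
  apply: bigcap_measurable => // k _; apply: bigcup_measurable => j _.
  have md : measurable_fun setT (fun z : bRV * BH =>
      nrm ((z.2 : L2 Pr) - window_seq Pr eta B (X `\` tr X (z.1 : 'rV[R]_n)) j)).
    apply: (measurable_L2_distM dd (f := fun z : bRV * BH => z.2 : L2 Pr)
      (g := fun z : bRV * BH => window_seq Pr eta B (X `\` tr X (z.1 : 'rV[R]_n)) j)).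
      exact: measurable_snd.
    have mw := measurable_window_seq Pr_complete eta_poisson Omega_generated B_basis
      (W := fun a : bRV => X `\` tr X a) j measurable_window_graph.
    exact: (measurableT_comp mw measurable_fst).
  have := md measurableT _ (measurable_itv `]-oo, k.+1%:R^-1[); rewrite setTI.
  by congr measurable; apply/seteqP; split => z /=; rewrite in_itv.
- move=> A; rewrite (borel_rVL2 n dd); split; last first.
    move=> [C mC ->].
    have := measurable_fun_pair m1 m2 => /(_ measurableT _ mC).
    by rewrite setTI.
  move=> [C mC <-]; rewrite setTI.
  (* The sigma-algebra of [conePt P] is itself a pullback from [borelRV R n]; measurable rectangles
     show that the one of [conePt P * BH] is pulled back along [iota]. *)
  pose iota (z : conePt P * BH) : bRV * BH := (cone_val z.1, z.2).
  have [D mD <-] : exists2 D, measurable D & iota @^-1` D = C.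
    have : preimage_set_system setT iota measurable C.
      move: C mC; rewrite measurable_prod_measurableType; apply: smallest_sub.
        exact/sigma_algebra_preimage/sigma_algebra_measurable.
      move=> _ [C1 [D1 mD1 <-] [D2 mD2 <-]]; exists (D1 `*` D2).
        exact: measurableX.
      by rewrite !setTI.
    by move=> [D mD DC]; exists D => //; rewrite -DC setTI.
  by exists D.
Qed.

End PoissonProductSystem.

Theorem theorem3p4 (R : realType) (n : nat) (P : closedConvexCone R n)
    (P_spans : forall v : 'rV[R]_n,
       exists a b, [/\ cone_set P a, cone_set P b & v = a - b])
    (P_pointed : forall v : 'rV[R]_n, cone_set P v -> cone_set P (- v) -> v = 0)
    (dY : measure_display) (Y : measurableType dY)
    (Y_countably_generated : countably_generated Y)
    (act : Y -> 'rV[R]_n -> Y) (act_meas : is_measurable_action act)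
    (lambda : {sigma_finite_measure set Y -> \bar R})
    (lambda_invariant : forall (B : set Y) (a : 'rV[R]_n), measurable B ->
       lambda (translate act B a) = lambda B)
    (X : set Y) (X_meas : measurable X)
    (X_shift : forall a, cone_set P a -> translate act X a `<=` X)
    (X_pure : \bigcap_(a in cone_set P) translate act X a = set0)
    (dO : measure_display) (Omega : measurableType dO) (Pr : probability Omega R)
    (Pr_complete : measure_is_complete Pr)
    (eta : R.-sigmafker Omega ~> Y) (eta_poisson : is_poisson_process Pr lambda eta)
    (Omega_generated : measurable = sigma_eta Pr eta setT) :
  exists mul : poissonE Pr eta act X P -> poissonE Pr eta act X P ->
               poissonE Pr eta act X P,
    is_poisson_mul mul /\
    @is_product_system R n P _ (poissonE Pr eta act X P)
      (fun x => projT1 x) (fibre Pr eta act X (P:=P))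
      (@fibre_ip _ _ _ Pr _ _ eta _ act X P)
      (fun a u => existT _ a u) mul.
Proof.
have [B B_basis] := counts_basis eta_poisson Y_countably_generated.
pose mul := poisson_mul Pr_complete eta_poisson Omega_generated B_basis act_meas
  lambda_invariant X_meas X_shift.
exists mul; split; first exact: poisson_mulP.
split.
- exact: (poissonE_standard_borel P Pr_complete eta_poisson Omega_generated B_basis act_meas X_meas).
- have [m1 _] := (measurable_poissonEP (fun x : poissonE Pr eta act X P => x)).1
    (@measurable_id _ (poissonE Pr eta act X P) setT).
  exact: (measurable_preimageP (@cone_val R n P) _).2.
- by apply/seteqP; split => // a _; exists (existT (fun a => fibre Pr eta act X a : Type) a 0).
- exact: fibre_bij.
- exact: fibre_hilbert.
- exact: (fibre_separable Pr_complete eta_poisson B_basis act_meas X_meas).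
- exact: (fibre_nonzero Pr_complete).
- exact: measurable_poisson_mul.
- exact: poisson_mulA.
- by [].
- exact: fibre_mul_unitary.
- exact: (fibre_measurable_field P Pr_complete eta_poisson Omega_generated B_basis act_meas X_meas).
Qed.
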